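(* Let $p,q\ge 2$ be integers. There exists a class of T-meshes $M\in AD_{p,q}$ for which both the associated GT-spline blending functions $\{N_A\}_{A\in\mathcal{A}_{p,q}(M)}$ of bi-order $(p,q)$ and the associated polynomial T-spline blending functions $\{P_A\}_{A\in\mathcal{A}_{p,q}(M)}$ of bi-degree $(p-1,q-1)$ are linearly independent, namely the class of T-meshes $M$ such that the matrix $\mathbf{C_{CR}}$ obtained by applying the column reduction procedure to $\mathbf{C}^T$ is the void matrix (equivalently, such that the matrix $\mathbf{D_{CR}}$ obtained by applying the column reduction procedure to $\mathbf{D}^T$ is the void matrix). These T-meshes are called VMCR T-meshes. Moreover, all tensor-product meshes belong to this class.
   Context: **T-meshes.** Let $p,q\ge2$ be integers (orders), $\mu,\nu$ positive integers, and $\mathbf{\Sigma^s}=\{s_{-\lfloor p/2\rfloor+1}\le\dots\le s_{\mu+\lfloor p/2\rfloor}\}$, $\mathbf{\Sigma^t}=\{t_{-\lfloor q/2\rfloor+1}\le\dots\le t_{\nu+\lfloor q/2\rfloor}\}$ knot vectors in which each knot has multiplicity at most $p$, resp. $q$. An index T-mesh $M$ is a partition of the index domain $[-\lfloor p/2\rfloor+1,\mu+\lfloor p/2\rfloor]\times[-\lfloor q/2\rfloor+1,\nu+\lfloor q/2\rfloor]$ into (open) rectangles, called cells, whose vertices have integer coordinates (T-junctions are allowed, L- and I-junctions are not). $\mathcal V$ is the set of vertices; edges are the (open) horizontal or vertical segments of the mesh linking two consecutive vertices; $hE$, $vE$ are the sets of horizontal and vertical edges; $S$ is the union of all edges and vertices,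 $hS$ (resp. $vS$) the union of all horizontal (resp. vertical) edges and all vertices. The valence of a vertex is the number of edges having it as an endpoint. The active region is $AR_{p,q}=[1,\mu]\times[1,\nu]$; the frame region is $FR_{p,q}=\big([-\lfloor p/2\rfloor+1,1]\cup[\mu,\mu+\lfloor p/2\rfloor]\big)\times[-\lfloor q/2\rfloor+1,\nu+\lfloor q/2\rfloor]\ \cup\ [-\lfloor p/2\rfloor+1,\mu+\lfloor p/2\rfloor]\times\big([-\lfloor q/2\rfloor+1,1]\cup[\nu,\nu+\lfloor q/2\rfloor]\big)$. $M\in AD_{p,q}$ (admissible) if $S\cap FR_{p,q}$ contains the segments $\{l\}\times[-\lfloor q/2\rfloor+1,\nu+\lfloor q/2\rfloor]$ for $l=-\lfloor p/2\rfloor+1,\dots,1$ and $l=\mu,\dots,\mu+\lfloor p/2\rfloor$, and $[-\lfloor p/2\rfloor+1,\mu+\lfloor p/2\rfloor]\times\{l\}$ for $l=-\lfloor q/2\rfloor+1,\dots,1$ and $l=\nu,\dots,\nu+\lfloor q/2\rfloor$, and all vertices in $(-\lfloor p/2\rfloor+1,\mu+\lfloor p/2\rfloor)\times(-\lfloor q/2\rfloor+1,\nu+\lfloor q/2\rfloor)\cap FR_{p,q}$ have valence 4. A tensor-product mesh is one in which all vertices (interior to the index domain) have valence 4. **Anchors and index vectors.** $\mathcal{A}_{p,q}(M)$ is the set of all $A\subset AR_{p,q}$ that are: vertices if $p,q$ are even; horizontal edges if $p$ is odd and $q$ even; vertical edges if $p$ is even and $q$ odd; cells if $p,q$ are odd.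 Write $A=a\times b$ with each of $a,b$ a singleton or an open interval. The global horizontal index vector is $\mathbf{I^s}(A)=\{i\in\mathbb Z:\{i\}\times b\subset vS\}$ and the global vertical one is $\mathbf{I^t}(A)=\{j\in\mathbb Z: a\times\{j\}\subset hS\}$, in increasing order. The local horizontal index vector $\mathbf{I^s_l}(A)=\{i_1<\dots<i_{p+1}\}$ consists of $p+1$ consecutive elements of $\mathbf{I^s}(A)$ with $a=\{i_{p/2+1}\}$ if $p$ is even and $a=(i_{(p+1)/2},i_{(p+1)/2+1})$ if $p$ is odd; $\mathbf{I^t_l}(A)$ ($q+1$ elements) is defined analogously from $\mathbf{I^t}(A)$ and $b$. **GB-splines.** Given a knot vector $s_1\le\dots\le s_{n+p}$ (multiplicities at most $p$) and functions $u_i,v_i\in C^{p-2}[s_i,s_{i+1}]$, $i=1,\dots,n+p-1$, such that the span $W$ of $\frac{d^{p-2}u_i}{ds^{p-2}},\frac{d^{p-2}v_i}{ds^{p-2}}$ is a (two-dimensional) Chebyshev space on $[s_i,s_{i+1}]$ (each nonzero element has at most one zero there), choose generators $U_i,V_i$ of $W$ with $U_i(s_i)>0$, $U_i(s_{i+1})=0$, $V_i(s_i)=0$, $V_i(s_{i+1})>0$. Put $N^{(2)}_i(s)=V_i(s)/V_i(s_{i+1})$ on $[s_i,s_{i+1})$, $U_{i+1}(s)/U_{i+1}(s_{i+1})$ on $[s_{i+1},s_{i+2})$, and $0$ otherwise; for $3\le k\le p$, $N^{(k)}_i(s)=\int_{-\infty}^s\big(\delta^{(k-1)}_iN^{(k-1)}_i(r)-\delta^{(k-1)}_{i+1}N^{(k-1)}_{i+1}(r)\big)dr$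 with $\delta^{(k)}_i=\big[\int_{-\infty}^{\infty} N^{(k)}_i(r)\,dr\big]^{-1}$, where if $N^{(k)}_i\equiv0$ one sets $\int_{-\infty}^s\delta^{(k)}_iN^{(k)}_i(r)\,dr=1$ for $s\ge s_{i+k}$ and $0$ for $s<s_{i+k}$. The $N^{(p)}_i$ are the GB-splines of order $p$. **GT-splines and T-splines.** To $\mathbf{\Sigma^s}$ are associated vectors of functions $\mathbf{\Omega^s_u}=\{u^s_i\}$, $\mathbf{\Omega^s_v}=\{v^s_i\}$, one pair per knot interval index, and similarly $\mathbf{\Omega^t_u},\mathbf{\Omega^t_v}$ to $\mathbf{\Sigma^t}$. For an index vector $\mathbf{I^s}$, $\mathbf{\Sigma^s}(\mathbf{I^s})=\{s_i:i\in\mathbf{I^s}\}$, and $\mathbf{\Omega^s_u}(\mathbf{I^s})$, $\mathbf{\Omega^s_v}(\mathbf{I^s})$ consist of the $u^s_i$, $v^s_i$ with $i\in\mathbf{I^s}$ other than the last index (similarly for $t$). For each anchor $A$, the GT-spline is $N_A(s,t)=N[\mathbf{\Sigma^s}(\mathbf{I^s_l}(A)),\mathbf{\Omega^s_u}(\mathbf{I^s_l}(A)),\mathbf{\Omega^s_v}(\mathbf{I^s_l}(A))](s)\cdot N[\mathbf{\Sigma^t}(\mathbf{I^t_l}(A)),\mathbf{\Omega^t_u}(\mathbf{I^t_l}(A)),\mathbf{\Omega^t_v}(\mathbf{I^t_l}(A))](t)$, where $N[\cdot]$ is the single univariate GB-spline (order $p$ in $s$, $q$ in $t$) on the given knots and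 functions. The functions are assumed compatible with knot insertion: for every anchor $A$ and consecutive indices $i<i'$ of $\mathbf{I^s}(A)$, $u^s_i,v^s_i$ are admissible (smooth, with the Chebyshev property) on $[s_i,s_{i'}]$ and $u^s_k=u^s_i$, $v^s_k=v^s_i$ for $i\le k<i'$; similarly in $t$. The polynomial T-spline $P_A(s,t)$ is the product of the polynomial B-splines of degree $p-1$ and $q-1$ on the knots $\mathbf{\Sigma^s}(\mathbf{I^s_l}(A))$ and $\mathbf{\Sigma^t}(\mathbf{I^t_l}(A))$. **Matrices $\mathbf C$ and $\mathbf D$.** The underlying tensor-product mesh $\hat M$ of $M$ is the tensor-product mesh on the same index domain, with the same knot and function vectors, obtained by adding vertices and edges to $M$ so that all vertices have valence 4 (the full integer grid, so that global index vectors of its anchors contain all indices). Let $\mathcal{A}_{p,q}(M)=\{A_1,\dots,A_n\}$, $\mathcal{A}_{p,q}(\hat M)=\{\hat A_1,\dots,\hat A_{\hat n}\}$. $\mathbf C=(c_{ij})$ and $\mathbf D=(d_{ij})$ are the $n\times\hat n$ matrices, obtained by repeated knot insertion, with $N_{A_i}=\sum_j c_{ij}\hat N_{\hat A_j}$ and $P_{A_i}=\sum_jd_{ij}\hat P_{\hat A_j}$, where $\hat N_{\hat A_j},\hat P_{\hat A_j}$ are the (linearly independent) GT-splines and T-splines associated to $\hat M$. **Column reduction.** In a matrix, if all elements of some row are zero except the one in column $j$, column $j$ is called innocuous. The column reduction procedure removes all innocuous columns and all zero rows left after this removal, repeatedly until no further reduction is possible. The void matrix is the $0\times0$ matrix.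 *)

(* Defs.v *)
From HB Require Import structures.
From mathcomp Require Import all_boot all_order all_algebra.
From mathcomp Require Import all_classical all_reals all_analysis.

Set Implicit Arguments.
Unset Strict Implicit.
Unset Printing Implicit Defensive.

Import Order.TTheory GRing.Theory Num.Theory numFieldNormedType.Exports.

Local Open Scope classical_set_scope.
Local Open Scope ring_scope.
Local Open Scope card_scope.

(** * Index T-meshes *)

(* Vertices, edges, cells and anchors are all products [a x b] whose factors
   are an integer singleton [Pt i] or an open interval [Iv i j] with integer
   endpoints. *)
Variant side := Pt of int | Iv of int & int.

Definition block : Type := (side * side)%type.

Definition ends (a : side) : set int :=
  match a with Pt i => [set i] | Iv i j => [set i; j] end.

(* The corners of a cell, the endpoints of an edge. *)
Definition corners (A : block) : set (int * int) := ends A.1 `*` ends A.2.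

Section Mesh.
Context {R : realType}.
Implicit Types (a : side) (A : block) (M : set block) (p q mu nu : nat).

Definition side_set a : set R :=
  match a with Pt i => [set i%:~R] | Iv i j => `]i%:~R, j%:~R[ end.

Definition side_closed a : set R :=
  match a with Pt i => [set i%:~R] | Iv i j => `[i%:~R, j%:~R] end.

Definition block_set A : set (R * R) := side_set A.1 `*` side_set A.2.

Definition block_closed A : set (R * R) := side_closed A.1 `*` side_closed A.2.

(* First and last index of a knot vector of order p with mu "central" indices. *)
Definition ilo p : int := - (p./2)%:Z + 1.
Definition ihi p mu : int := mu%:Z + (p./2)%:Z.

Definition index_range p mu : set R := `[(ilo p)%:~R, (ihi p mu)%:~R].

Definition index_domain p q mu nu : set (R * R) :=
  index_range p mu `*` index_range q nu.

Definition active_region mu nu : set (R * R) :=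
  `[1, mu%:R] `*` `[1, nu%:R].

Definition frame_range p mu : set R :=
  `[(ilo p)%:~R, 1] `|` `[mu%:R, (ihi p mu)%:~R].

Definition frame_region p q mu nu : set (R * R) :=
  (frame_range p mu `*` index_range q nu) `|`
  (index_range p mu `*` frame_range q nu).

(* A T-mesh is given by its set of cells. Since the vertices are the corners of
   the cells, L- and I-junctions cannot occur (except for the four corners of
   the index domain). *)
Definition tmesh p q mu nu M : Prop :=
  [/\ forall A, M A -> exists i i' j j' : int,
        [/\ i < i', j < j' & A = (Iv i i', Iv j j')],
      trivIset M block_set
    & \bigcup_(A in M) block_closed A = index_domain p q mu nu].

Definition vertices M : set (int * int) := \bigcup_(A in M) corners A.

Definition vertex_set M : set (R * R) :=
  [set (v.1%:~R, v.2%:~R) | v in vertices M].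

(* The segment lies on the lines of the mesh, that is, it meets no cell. *)
Definition on_lines M A : Prop :=
  forall c, M c -> block_set A `&` block_set c = set0.

Definition hedges M : set block :=
  [set A | exists i i' j : int,
     [/\ A = (Iv i i', Pt j), i < i', vertices M (i, j), vertices M (i', j)
       & (forall k, i < k < i' -> ~ vertices M (k, j)) /\ on_lines M A]].

Definition vedges M : set block :=
  [set A | exists i j j' : int,
     [/\ A = (Pt i, Iv j j'), j < j', vertices M (i, j), vertices M (i, j')
       & (forall k, j < k < j' -> ~ vertices M (i, k)) /\ on_lines M A]].

Definition hS M : set (R * R) :=
  (\bigcup_(A in hedges M) block_set A) `|` vertex_set M.

Definition vS M : set (R * R) :=
  (\bigcup_(A in vedges M) block_set A) `|` vertex_set M.

Definition skeleton M : set (R * R) := hS M `|` vS M.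

Definition valence M (v : int * int) (k : nat) : Prop :=
  [set A | (hedges M `|` vedges M) A /\ corners A v] #= `I_k.

Definition interior_index p q mu nu (v : int * int) : Prop :=
  (ilo p < v.1 < ihi p mu) && (ilo q < v.2 < ihi q nu).

Definition frame_index p mu (l : int) : bool :=
  (ilo p <= l <= 1) || (mu%:Z <= l <= ihi p mu).

Definition admissible p q mu nu M : Prop :=
  [/\ tmesh p q mu nu M,
      forall l, frame_index p mu l ->
        [set l%:~R] `*` index_range q nu
          `<=` skeleton M `&` frame_region p q mu nu,
      forall l, frame_index q nu l ->
        index_range p mu `*` [set l%:~R]
          `<=` skeleton M `&` frame_region p q mu nu
    & forall v, vertices M v -> interior_index p q mu nu v ->
        frame_region p q mu nu (v.1%:~R, v.2%:~R) -> valence M v 4].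

Definition tensor_product p q mu nu M : Prop :=
  forall v, vertices M v -> interior_index p q mu nu v -> valence M v 4.

(* The underlying tensor-product mesh. *)
Definition full_grid p q mu nu : set block :=
  [set A | exists i j : int,
     [/\ ilo p <= i, i < ihi p mu, ilo q <= j, j < ihi q nu
       & A = (Iv i (i + 1), Iv j (j + 1))]].

(** * Anchors and index vectors *)

Definition anchors p q mu nu M : set block :=
  [set A | (match odd p, odd q with
            | false, false => [set (Pt v.1, Pt v.2) | v in vertices M]
            | true, false => hedges M
            | false, true => vedges M
            | true, true => M
            end) A
           /\ block_set A `<=` active_region mu nu].

Definition Is M A : set int :=
  [set i | [set i%:~R] `*` side_set A.2 `<=` vS M].

Definition It M A : set int :=
  [set j | side_set A.1 `*` [set j%:~R] `<=` hS M].

End Mesh.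

Definition consecutive (I : set int) (i i' : int) : Prop :=
  [/\ I i, I i', i < i' & forall k, i < k < i' -> ~ I k].

(* With 1-based positions, [a] is [{i_(p/2+1)}] if p is even and
   [(i_((p+1)/2), i_((p+1)/2+1))] if p is odd: in both cases the first 0-based
   position is [p./2]. *)
Definition is_local_index (p : nat) (I : set int) (a : side) (l : seq int) :=
  [/\ size l = p.+1,
      forall k, (k < p.+1)%N -> I (nth 0 l k),
      forall k, (k < p)%N -> consecutive I (nth 0 l k) (nth 0 l k.+1)
    & a = if odd p then Iv (nth 0 l p./2) (nth 0 l p./2.+1)
          else Pt (nth 0 l p./2)].

Definition local_index (p : nat) (I : set int) (a : side) : seq int :=
  xget [::] [set l | is_local_index p I a l].

(** * Univariate GB-splines and B-splines *)

Section Univariate.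
Context {R : realType}.
Implicit Types (D : set R) (f g u v : R -> R) (s : nat -> R).

Definition diff_quot f (x y : R) : R := (f y - f x) / (y - x).

(* Derivative relative to D: one-sided at the endpoints of a closed interval. *)
Definition deriv_on D f : R -> R :=
  fun x => lim (diff_quot f x @ within D x^').

Definition derivn_on D (n : nat) f : R -> R := iter n (deriv_on D) f.

Definition Ck_on D (n : nat) f : Prop :=
  (forall k, (k <= n)%N -> {within D, continuous (derivn_on D k f)}) /\
  (forall k, (k < n)%N -> forall x, D x ->
     cvg (diff_quot (derivn_on D k f) x @ within D x^')).

Definition span2 f g : set (R -> R) :=
  [set w | exists a b : R, w = fun x => a * f x + b * g x].

Definition chebyshev2 D f g : Prop :=
  (forall a b : R, (forall x, D x -> a * f x + b * g x = 0) ->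
     a = 0 /\ b = 0) /\
  (forall w, span2 f g w -> (exists2 x, D x & w x != 0) ->
     forall x y, D x -> D y -> w x = 0 -> w y = 0 -> x = y).

(* The pair (u, v) can be used on the knot interval [a, b] in order p. *)
Definition admissible_pair (p : nat) (a b : R) u v : Prop :=
  [/\ Ck_on `[a, b] (p - 2) u, Ck_on `[a, b] (p - 2) v
    & chebyshev2 `[a, b] (derivn_on `[a, b] (p - 2) u)
                         (derivn_on `[a, b] (p - 2) v)].

Definition is_generators (W : set (R -> R)) (a b : R)
    (UV : (R -> R) * (R -> R)) : Prop :=
  [/\ span2 UV.1 UV.2 = W,
      0 < UV.1 a /\ UV.1 b = 0
    & UV.2 a = 0 /\ 0 < UV.2 b].

Definition generators (p : nat) (a b : R) u v : (R -> R) * (R -> R) :=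
  xget (u, v) [set UV | is_generators
    (span2 (derivn_on `[a, b] (p - 2) u) (derivn_on `[a, b] (p - 2) v))
    a b UV].

Definition gbU p s (u v : nat -> R -> R) (i : nat) : R -> R :=
  (generators p (s i) (s i.+1) (u i) (v i)).1.

Definition gbV p s (u v : nat -> R -> R) (i : nat) : R -> R :=
  (generators p (s i) (s i.+1) (u i) (v i)).2.

(* [x |-> \int_(-oo)^x delta * N] with [delta = 1 / \int N]; [e] is the last
   knot of the spline [N], used when [N] vanishes identically. *)
Definition normalized_primitive (N : R -> R) (e x : R) : R :=
  if `[< forall y, N y = 0 >] then (if e <= x then 1 else 0)
  else \int[@lebesgue_measure R]_(r in `]-oo, x])
         ((\int[@lebesgue_measure R]_y N y)^-1 * N r).

(* [gbN p s u v m i] is [N_i^(m+2)], supported on [s i, s (i + m + 2)]. The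
   integral of the difference is split in two, as the convention for
   identically zero splines requires. *)
Fixpoint gbN (p : nat) s (u v : nat -> R -> R) (m i : nat) (x : R) : R :=
  match m with
  | 0 =>
      if s i <= x < s i.+1 then gbV p s u v i x / gbV p s u v i (s i.+1)
      else if s i.+1 <= x < s i.+2 then
        gbU p s u v i.+1 x / gbU p s u v i.+1 (s i.+1)
      else 0
  | m'.+1 =>
      normalized_primitive (gbN p s u v m' i) (s (i + m'.+2)%N) x
      - normalized_primitive (gbN p s u v m' i.+1) (s (i.+1 + m'.+2)%N) x
  end.

(* The GB-spline of order p on the knots s 0, ..., s p. *)
Definition gb_spline (p : nat) s (u v : nat -> R -> R) : R -> R :=
  gbN p s u v (p - 2) 0.

(* Cox-de Boor recursion for the degree-d B-spline; as [x / 0 = 0] in [R], the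
   usual convention on vanishing denominators is built in. *)
Fixpoint bspline s (d i : nat) (x : R) : R :=
  match d with
  | 0 => if s i <= x < s i.+1 then 1 else 0
  | d'.+1 =>
      (x - s i) / (s (i + d'.+1)%N - s i) * bspline s d' i x
      + (s (i + d'.+2)%N - x) / (s (i + d'.+2)%N - s i.+1)
        * bspline s d' i.+1 x
  end.

Definition knot_vector (p mu : nat) (s : int -> R) : Prop :=
  (forall i j, ilo p <= i -> i <= j -> j <= ihi p mu -> s i <= s j) /\
  (forall x, [set i | ilo p <= i <= ihi p mu /\ s i = x] #<= `I_p).

(* Compatibility along a global index vector. A two-dimensional space of
   functions exists only on nondegenerate intervals, hence the condition
   [s i < s i']. *)
Definition compatible (p : nat) (s : int -> R) (u v : int -> R -> R)
    (I : set int) : Prop :=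
  forall i i', consecutive I i i' ->
    (s i < s i' -> admissible_pair p (s i) (s i') (u i) (v i)) /\
    (forall k, i <= k < i' -> forall x, s i <= x <= s i' ->
       u k x = u i x /\ v k x = v i x).

End Univariate.

(** * GT-splines and T-splines *)

Section Bivariate.
Context {R : realType}.
Implicit Types (p q : nat) (ss tt : int -> R) (us vs ut vt : int -> R -> R).
Implicit Types (M : set block) (A : block).

Definition local_s p M A : seq int := local_index p (@Is R M A) A.1.
Definition local_t q M A : seq int := local_index q (@It R M A) A.2.

Definition restrict_to T (f : int -> T) (l : seq int) (k : nat) : T := f (nth 0 l k).

Definition gt_spline p q ss us vs tt ut vt M A (x y : R) : R :=
  let ls := local_s p M A in
  let lt := local_t q M A in
  gb_spline p (restrict_to ss ls) (restrict_to us ls) (restrict_to vs ls) x *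
  gb_spline q (restrict_to tt lt) (restrict_to ut lt) (restrict_to vt lt) y.

Definition t_spline p q ss tt M A (x y : R) : R :=
  bspline (restrict_to ss (local_s p M A)) (p - 1) 0 x *
  bspline (restrict_to tt (local_t q M A)) (q - 1) 0 y.

Definition compatible_functions p q mu nu ss us vs tt ut vt M : Prop :=
  forall A, anchors (R := R) p q mu nu M A ->
    compatible p ss us vs (@Is R M A) /\ compatible q tt ut vt (@It R M A).

Definition lin_indep n (F : 'I_n -> R -> R -> R) : Prop :=
  forall c : 'I_n -> R,
    (forall x y, \sum_(i < n) c i * F i x y = 0) -> forall i, c i = 0.

Definition enumerates n T (A : 'I_n -> T) (X : set T) : Prop :=
  injective A /\ range A = X.

(* Determines C whenever the functions G are linearly independent. *)
Definition refinement_matrix n n' (F : 'I_n -> R -> R -> R)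
    (G : 'I_n' -> R -> R -> R) (C : 'M[R]_(n, n')) : Prop :=
  forall i x y, F i x y = \sum_(j < n') C i j * G j x y.

End Bivariate.

(** * Column reduction *)

Section ColumnReduction.
Context {R : realType} {m n : nat}.
Implicit Types (B : 'M[R]_(m, n)) (I : {set 'I_m}) (J : {set 'I_n}).

(* A submatrix of B is given by the sets I and J of its rows and columns. *)
Definition innocuous B I J : {set 'I_n} :=
  [set j in J | [exists i in I,
    (B i j != 0) && [forall j' in J, (j' != j) ==> (B i j' == 0)]]].

Definition cr_step B (IJ : {set 'I_m} * {set 'I_n}) :
    {set 'I_m} * {set 'I_n} :=
  let J' := IJ.2 :\: innocuous B IJ.1 IJ.2 in
  ([set i in IJ.1 | [exists j in J', B i j != 0]], J').

(* A step that is not stationary lowers the total number of rows and columns,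
   so m + n steps reach the fixed point. *)
Definition cr_sets B : {set 'I_m} * {set 'I_n} :=
  iter (m + n) (cr_step B) ([set: 'I_m], [set: 'I_n])%SET.

Definition column_reduction B : 'M[R]_(#|(cr_sets B).1|, #|(cr_sets B).2|) :=
  mxsub enum_val enum_val B.

End ColumnReduction.

Definition is_void (R : realType) (m n : nat) (B : 'M[R]_(m, n)) : Prop :=
  m = 0 /\ n = 0.

Definition VMCR (R : realType) (n n' : nat) (C : 'M[R]_(n, n')) : Prop :=
  is_void (column_reduction C^T).

(* Main.v *)
Require Import Defs.
From mathcomp Require Import all_boot all_order all_algebra.
From mathcomp Require Import all_classical all_reals all_analysis.
From mathcomp Require Import measurable_realfun zify ring lra.

(** A blending function of the mesh is a product of two univariate splines, each
    on some [p + 1] (resp. [q + 1]) of the knots. Inserting one knot writes such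
    a spline as a combination of two others, and repeating this until the knots
    are consecutive gives the expansion over the full grid, that is, one row of
    the refinement matrix.

    The two coefficients of one insertion are nonnegative, and the knots alone
    decide whether they vanish: the first one is nonzero if and only if the new
    knot is strictly to the right of the first knot, and the second one if and
    only if it is strictly to the left of the last knot ([insertable]). As nonnegative terms do not cancel, the zero pattern of
    a whole row is a function of the knots ([expansion_exists]), hence the same
    for generalized and for polynomial splines. Column reduction looks at zero
    patterns only ([VMCR_pattern]).

    For polynomial splines the insertion rule is Boehm's formula
    ([bspline_boehm]). For generalized splines it is proved by induction on the
    order: at order 2 it is a three-term relation between determinants
    ([tent_insert_left]), and integrating the rule of one order gives the rule
    of the next one, with ratios of integrals as coefficients
    ([insertion_primitive], [insertion_rule_next]). These ratios make sense
    because the splines are nonnegative, which in turn follows from the rule of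
    the same order: inserting [x] as a knot again and again splits the spline
    into splines that do not contain [x] in the interior of their support
    ([next_nonneg]).

    If column reduction empties the transpose of a matrix, the rows of the
    matrix are linearly independent, since every innocuous column yields an
    equation with one unknown ([VMCR_rows_free]). The splines on the full grid are linearly independent,
    because near its left end each univariate spline dominates all later ones
    ([dominated_free]), and products of free families are free
    ([product_free]). Together these give the independence of the blending
    functions of both kinds.

    In a tensor-product mesh lines do not stop in the interior, so that all
    anchors share their global index vectors ([tensor_Is]). The expansion of an
    anchor starts at a pair of leading indices, with a nonzero coefficient, and
    distinct anchors have distinct leading pairs ([leading_index_inj]). In any
    set of anchors, one with minimal sum of leading indices is therefore alone
    in having a nonzero entry at its leading pair; column reduction can always
    go on, and ends with the void matrix ([tensor_VMCR]). *)

Set Implicit Arguments.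
Unset Strict Implicit.
Unset Printing Implicit Defensive.

Import Order.TTheory GRing.Theory Num.Theory numFieldNormedType.Exports.

Local Open Scope classical_set_scope.
Local Open Scope ring_scope.

(** * Column reduction *)

Section ColumnReductionTheory.
Context {R : realType} {m n : nat}.
Implicit Types (B : 'M[R]_(m, n)).

Lemma cr_sets_pattern B B' :
  (forall i j, (B i j != 0) = (B' i j != 0)) -> cr_sets B = cr_sets B'.
Proof.
move=> h; rewrite /cr_sets; elim: (m + n)%N => //= k ->.
set IJ := iter _ _ _.
have eq0 i j : (B i j == 0) = (B' i j == 0) by apply: negb_inj; exact: h.
have hJ : innocuous B IJ.1 IJ.2 = innocuous B' IJ.1 IJ.2.
  apply/setP => j; rewrite !inE; congr (_ && _).
  apply: eq_existsb => i; rewrite h; congr [&& _, _ & _].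
  by apply: eq_forallb => j'; rewrite eq0.
rewrite /cr_step hJ; congr pair.
by apply/setP => i; rewrite !inE; congr (_ && _); apply: eq_existsb => j; rewrite h.
Qed.

(** For [B c = 0], a row whose only nonzero entry among the remaining columns
    is in column [j] reads [B i j * c j = 0], as [c] already vanishes on the
    removed columns. *)
Lemma cr_kernel B (c : 'I_n -> R) k :
  (forall i, \sum_j B i j * c j = 0) ->
  let IJ := iter k (cr_step B) ([set: 'I_m], [set: 'I_n])%SET in
  forall j, j \notin IJ.2 -> c j = 0.
Proof.
move=> hc; elim: k => [|k ih] /= j; first by rewrite inE.
set IJ := iter _ _ _ in ih *; rewrite !inE negb_and negbK => /orP[|]; last exact: ih.
move=> /andP[jJ /existsP[i /and3P[iI nz /forallP hz]]].
have := hc i; rewrite (bigD1 j) //= big1 ?addr0; last first.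
  move=> j' nj'; have [j'J|j'J] := boolP (j' \in IJ.2); last by rewrite ih ?mulr0.
  by have := hz j'; rewrite j'J nj' /= => /eqP ->; rewrite mul0r.
by move/eqP; rewrite mulf_eq0 (negPf nz) => /eqP.
Qed.

(** The set of remaining columns is one of the sets [J], so each step removes a
    column and [n] steps remove them all. The row that singles out a column has
    not been removed itself, because removed rows vanish on the remaining
    columns. *)
Lemma cr_sets_void B :
  (forall J : {set 'I_n}, J != finset.set0 -> exists i, exists2 j, j \in J &
     B i j != 0 /\ forall j', j' \in J -> j' != j -> B i j' = 0) ->
  cr_sets B = (finset.set0, finset.set0).
Proof.
move=> h; pose it k := iter k (cr_step B) ([set: 'I_m], [set: 'I_n])%SET.
have hrow k i j : i \notin (it k).1 -> j \in (it k).2 -> B i j = 0.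
  elim: k j => [|k ih] j /=; first by rewrite inE.
  rewrite [in X in X -> _]inE negb_and => /orP[iI|/existsPn hz jJ].
    by rewrite inE => /andP[_]; exact: ih.
  by have := hz j; rewrite jJ /= negbK => /eqP.
have hcard k : (#|(it k).2| <= n - k)%N.
  elim: k => [|k ih] /=; first by rewrite cardsT card_ord subn0.
  have [->|/h[i [j jJ [nz hz]]]] := eqVneq (it k).2 finset.set0.
    by rewrite finset.set0D cards0.
  have jinn : j \in innocuous B (it k).1 (it k).2.
    rewrite !inE jJ /=; apply/existsP; exists i; rewrite nz /= andbC.
    apply/andP; split.
      by apply/forallP => j'; apply/implyP => j'J; apply/implyP => nj; rewrite hz.
    by apply: contraNT nz => iI; rewrite (hrow _ _ _ iI jJ).
  have : ((it k).2 :\: innocuous B (it k).1 (it k).2 \proper (it k).2)%SET.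
    by apply/properP; split; [exact: subsetDl | exists j; rewrite // finset.in_setD jinn].
  by move=> /proper_card /leq_trans /(_ ih); rewrite subnS; case: (n - k)%N.
have hJ k : (n <= k)%N -> (it k).2 = finset.set0.
  by move=> nk; apply/eqP; rewrite -cards_eq0 -leqn0 (leq_trans (hcard k)) //; lia.
have hI k : (it k).2 = finset.set0 -> (0 < m + n)%N -> (k = m + n)%N -> (it k).1 = finset.set0.
  case: k => [|k] h0 m0 ek; first lia.
  apply/setP => i; rewrite !inE; apply/negP => /andP[_ /existsP[j /andP[jJ _]]].
  by move: h0 => /= h0; rewrite h0 inE in jJ.
have [mn0|mn0] := posnP (m + n).
  rewrite /cr_sets; case: (iter _ _ _) => I J; congr pair.
    by apply/setP => i; have := ltn_ord i; lia.
  by apply/setP => i; have := ltn_ord i; lia.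
have e2 := hJ (m + n)%N (leq_addl _ _).
by have e1 := hI _ e2 mn0 erefl; rewrite /cr_sets -/(it _); case: (it _) e1 e2 => /= ? ? -> ->.
Qed.

End ColumnReductionTheory.

Lemma VMCR_pattern (R : realType) n n' (C D : 'M[R]_(n, n')) :
  (forall i j, (C i j != 0) = (D i j != 0)) -> VMCR C <-> VMCR D.
Proof.
move=> h; rewrite /VMCR /is_void (@cr_sets_pattern _ _ _ C^T D^T) //.
by move=> i j; rewrite !mxE.
Qed.

Lemma VMCR_rows_free (R : realType) n n' (C : 'M[R]_(n, n')) (c : 'I_n -> R) :
  VMCR C -> (forall j, \sum_i c i * C i j = 0) -> forall i, c i = 0.
Proof.
move=> [_ hJ] hc i.
have hc' : forall j, \sum_i C^T j i * c i = 0.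
  by move=> j; rewrite -[RHS](hc j); apply: eq_bigr => k _; rewrite mxE mulrC.
by apply: (cr_kernel (k := (n' + n)%N) hc'); rewrite -/(cr_sets _) (cards0_eq hJ) inE.
Qed.

(** Column reduction is applied to the transpose, so the innocuous columns are
    rows of [C]. *)
Lemma VMCR_echelon (R : realType) n n' (C : 'M[R]_(n, n')) :
  (forall J : {set 'I_n}, J != finset.set0 -> exists j, exists2 i, i \in J &
     C i j != 0 /\ forall i', i' \in J -> i' != i -> C i' j = 0) -> VMCR C.
Proof.
move=> h; rewrite /VMCR /is_void cr_sets_void /= ?cards0 //.
move=> J /h[j [i iJ [nz hz]]]; exists j, i => //; rewrite mxE; split=> // i' i'J ni.
by rewrite mxE hz.
Qed.

(** * Normalized primitives *)

Section Primitive.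
Context {R : realType}.
Implicit Types (f g N : R -> R) (a b x B : R).
Local Notation mu := (@lebesgue_measure R).

(** The properties of a spline with support in [[a, b)] that make its integrals
    finite and its primitive constant outside of the support. *)
Definition tame a b N : Prop :=
  [/\ measurable_fun setT N, exists B, forall x, `|N x| <= B
    & forall x, x < a \/ b <= x -> N x = 0].

Lemma tame_integrable a b N (D : set R) :
  tame a b N -> measurable D -> mu.-integrable D (EFin \o N).
Proof.
move=> [mN [B hB] h0] mD.
apply: (@integrableS _ _ _ mu setT) => //.
have eN : N = N \_ `[a, b].
  apply/funext => x; rewrite patchE; case: ifPn => // /negP xab; apply: h0.
  have [xa|ax] := ltP x a; [by left|right].
  have [//|xb] := leP b x.
  by exfalso; apply: xab; rewrite inE /= in_itv /= ax ltW.
rewrite eN -restrict_EFin; apply/integrable_restrict => //; rewrite ?setIT ?setTI.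
apply: measurable_bounded_integrable => //.
- by rewrite /= lebesgue_measure_itv /=; case: ifP => // _; rewrite ltry.
- exact: measurable_funS mN.
- exists B; split; first exact: num_real.
  by move=> M BM x _; apply: le_trans (hB x) (ltW BM).
Qed.

(** A nonnegative function with zero integral vanishes almost everywhere, but
    an open interval is not negligible. *)
Lemma Rintegral_gt0 f (D : set R) a b :
  measurable D -> mu.-integrable D (EFin \o f) -> (forall x, 0 <= f x) ->
  a < b -> `]a, b[ `<=` D -> (forall x, a < x < b -> 0 < f x) ->
  0 < \int[mu]_(x in D) f x.
Proof.
move=> mD fi f0 ab abD fpos.
rewrite lt_neqAle Rintegral_ge0 // andbT; apply/negP => /eqP e0.
have [mf _] := integrableP _ _ _ fi.
have [Z [mZ Z0 hZ]] : {ae mu, forall x, D x -> (f x)%:E = 0%E}.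
  apply: (ae_eq_integral_abs mu mD mf).1.
  under eq_integral do rewrite /= ger0_norm //.
  have fin : (\int[mu]_(x in D) (f x)%:E)%E \is a fin_num.
    exact: integrable_fin_num.
  by move: e0; rewrite /Rintegral => e0; rewrite -(fineK fin) -e0.
have : (mu `]a, b[ <= mu Z)%E.
  apply: le_measure; rewrite ?inE //.
  move=> x xab; apply: hZ => /= h; have := h (abD _ xab) => -[] fx.
  by move: xab (fpos x); rewrite /= in_itv /= => xab /(_ xab); rewrite fx ltxx.
by rewrite Z0 lebesgue_measure_itv /= lte_fin ab -EFinD lee_fin leNgt subr_gt0 ab.
Qed.

Definition prim N x := \int[mu]_(r in `]-oo, x]) N r.
Definition mass N := \int[mu]_r N r.

Section Tame.
Variables (a b : R) (N : R -> R).
Hypotheses (tN : tame a b N) (N0 : forall x, 0 <= N x).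

Let iN D : measurable D -> mu.-integrable D (EFin \o N).
Proof. exact: tame_integrable tN. Qed.

Lemma prim_before x : x <= a -> prim N x = 0.
Proof.
move=> xa; rewrite /prim -Rintegral_itv_bndo_bndc; last exact: iN.
rewrite (@eq_Rintegral _ _ _ _ _ (cst 0)); last first.
  move=> y; rewrite inE /= in_itv /= => yx; case: tN => _ _ -> //; left.
  exact: lt_le_trans yx xa.
by rewrite /Rintegral integral0.
Qed.

Lemma prim_after x : b <= x -> prim N x = mass N.
Proof.
move=> bx; rewrite /prim /mass Rintegral_mkcond; apply: eq_Rintegral => y _.
rewrite patchE; case: ifPn => // /negP h; case: tN => _ _ -> //; right.
have [//|yb] := leP b y.
by exfalso; apply: h; rewrite inE /= in_itv /= ltW // (lt_le_trans yb bx).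
Qed.

Lemma prim_ge0 x : 0 <= prim N x.
Proof. exact: Rintegral_ge0. Qed.

Lemma prim_mono x y : x <= y -> prim N x <= prim N y.
Proof.
move=> xy; rewrite /prim [leLHS]Rintegral_mkcond [leRHS]Rintegral_mkcond.
have ir z : mu.-integrable setT (EFin \o (N \_ `]-oo, z])).
  by rewrite -restrict_EFin; apply/integrable_restrict => //; rewrite ?setIT ?setTI; exact: iN.
apply: le_Rintegral => // z _; rewrite !patchE; case: ifPn => [|_]; last first.
  by case: ifP.
rewrite inE /= in_itv /= => zx; rewrite ifT // inE /= in_itv /=.
exact: le_trans xy.
Qed.

Lemma prim_gt0 e x : 0 < e -> (forall y, a < y < a + e -> 0 < N y) ->
  a < x -> 0 < prim N x.
Proof.
move=> e0 he ax; apply: (@Rintegral_gt0 _ _ a (Num.min x (a + e))) => //.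
- exact: iN.
- by rewrite lt_min ax ltrDl.
- move=> y /=; rewrite !in_itv /= => /andP[_]; rewrite lt_min => /andP[yx _].
  exact: ltW.
- by move=> y /andP[ay]; rewrite lt_min => /andP[_ ye]; apply: he; rewrite ay.
Qed.

Lemma mass_gt0 e : 0 < e -> (forall y, a < y < a + e -> 0 < N y) -> 0 < mass N.
Proof.
move=> e0 he; apply: (@Rintegral_gt0 _ _ a (a + e)) => //; first exact: iN.
by rewrite ltrDl.
Qed.

Lemma prim_le_linear B x : (forall y, N y <= B) -> a <= x ->
  prim N x <= B * (x - a).
Proof.
move=> hB ax.
have e1 : prim N x = \int[mu]_(r in `[a, x]) N r.
  rewrite /prim [LHS]Rintegral_mkcond [RHS]Rintegral_mkcond.
  apply: eq_Rintegral => y _; rewrite !patchE !mem_setE !in_itv /=.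
  have [yx|xy] := leP y x; rewrite ?andbF ?andbT //.
  by have [//|ya] := leP a y; case: tN => _ _ -> //; left.
rewrite e1.
have -> : B * (x - a) = \int[mu]_(r in `[a, x]) (cst B r).
  rewrite Rintegral_cst // /= lebesgue_measure_itv /= lte_fin.
  move: ax; rewrite le_eqVlt => /predU1P[->|ax]; first by rewrite ltxx subrr.
  by rewrite ax.
apply: le_Rintegral => //.
- exact: iN.
- apply: measurable_bounded_integrable => //.
    by rewrite /= lebesgue_measure_itv /=; case: ifP => // _; rewrite ltry.
  exists `|B|; split; first exact: num_real.
  by move=> M BM y _ /=; exact: ltW.
Qed.

End Tame.

Lemma prim_le_scale a b a' b' N N' e x c :
  tame a b N -> tame a' b' N' -> (forall y, y < c -> N y <= e * N' y) ->
  x < c -> prim N x <= e * prim N' x.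
Proof.
move=> tN tN' h xc.
rewrite /prim -RintegralZl //; last exact: tame_integrable tN' _.
apply: le_Rintegral => //; first exact: tame_integrable tN _.
  apply: (@eq_integrable _ _ _ mu _ _ (fun z => e%:E * (EFin \o N') z)%E) => //.
  by apply: integrableZl => //; exact: tame_integrable tN' _.
by move=> y; rewrite /= in_itv /= => yx; apply: h; exact: le_lt_trans xc.
Qed.

Lemma integral_comb2 (D : set R) a b a1 b1 a2 b2 N N1 N2 c1 c2 :
  tame a b N -> tame a1 b1 N1 -> tame a2 b2 N2 -> measurable D ->
  (forall x, N x = c1 * N1 x + c2 * N2 x) ->
  \int[mu]_(x in D) N x =
    c1 * (\int[mu]_(x in D) N1 x) + c2 * (\int[mu]_(x in D) N2 x).
Proof.
move=> tN t1 t2 mD h.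
rewrite -RintegralZl //; last exact: tame_integrable t1 _.
rewrite -RintegralZl //; last exact: tame_integrable t2 _.
have iZ c N' a' b' : tame a' b' N' -> mu.-integrable D (EFin \o (fun z => c * N' z)).
  move=> t; apply: (@eq_integrable _ _ _ mu _ _ (fun z => c%:E * (EFin \o N') z)%E) => //.
  by apply: integrableZl => //; exact: tame_integrable t _.
rewrite -RintegralD //; [|exact: iZ t1|exact: iZ t2].
by apply: eq_Rintegral => x _; exact: h.
Qed.

End Primitive.

(** * One step of the spline recursion *)

Section Level.
Context {R : realType}.
Implicit Types (f g : R -> R) (a b x : R) (s : nat -> R).

(** [g = o(f)] to the right of [a], where [f] is positive. The bound is
    required to the left of [a] as well, so that it can be integrated from
    minus infinity. *)
Definition dominates a f g : Prop :=
  forall e, 0 < e -> exists h, [/\ 0 < h, forall x, a < x < a + h -> 0 < f x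
    & forall x, x < a + h -> g x <= e * f x].

(** What the recursion on the order preserves, [w] being the order. Domination
    gives both positivity near the left end, hence a positive integral, and
    linear independence. *)
Definition spline_level s (w : nat) (N : nat -> R -> R) : Prop :=
  [/\ forall i, tame (s i) (s (i + w)%N) (N i),
      forall i x, 0 <= N i x
    & forall i j, (i < j)%N -> s i < s (i + w)%N -> dominates (s i) (N i) (N j)].

Variables (s : nat -> R) (w : nat) (N : nat -> R -> R).
Hypotheses (sS : forall k, s k <= s k.+1) (LN : spline_level s w N).

Let P i := normalized_primitive (N i) (s (i + w)%N).

Lemma knots_mono (i j : nat) : (i <= j)%N -> s i <= s j.
Proof. by move=> /subnK <-; elim: (j - i)%N => // k ih; exact: le_trans (sS _). Qed.

Let tN i : tame (s i) (s (i + w)%N) (N i). Proof. by case: LN. Qed.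
Let N0 i x : 0 <= N i x. Proof. by case: LN. Qed.

Lemma level_pos i : s i < s (i + w)%N ->
  exists2 h, 0 < h & forall x, s i < x < s i + h -> 0 < N i x.
Proof.
move=> h; case: LN => _ _ /(_ i i.+1 (ltnSn i) h 1 ltr01)[e [e0 he _]].
by exists e.
Qed.

Lemma level_mass i : s i < s (i + w)%N -> 0 < mass (N i).
Proof. by move=> /level_pos[h h0 hp]; exact (mass_gt0 (tN i) (N0 i) h0 hp). Qed.

Lemma level_zero i x : s (i + w)%N <= s i -> N i x = 0.
Proof.
move=> h; case: (tN i) => _ _; apply.
by have [xs|xs] := ltP x (s i); [left|right; exact: le_trans xs].
Qed.

Lemma level_massE i : ~~ (s i < s (i + w)%N) -> mass (N i) = 0.
Proof.
rewrite -leNgt => h; rewrite /mass (@eq_Rintegral _ _ _ _ _ (cst 0)).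
  by rewrite /Rintegral integral0.
by move=> x _; rewrite level_zero.
Qed.

(** Here all knots of the spline coincide and it vanishes identically; by
    convention its normalized primitive is the unit step. *)
Lemma prim_atom i x : ~~ (s i < s (i + w)%N) ->
  P i x = if s i <= x then 1 else 0.
Proof.
rewrite -leNgt => h; rewrite /P /normalized_primitive ifT; last first.
  by apply/asboolP => y; exact: level_zero.
have -> : s (i + w)%N = s i by apply/eqP; rewrite eq_le h knots_mono // leq_addr.
by [].
Qed.

Lemma prim_smooth i x : s i < s (i + w)%N -> P i x = (mass (N i))^-1 * prim (N i) x.
Proof.
move=> h; rewrite /P /normalized_primitive ifF; last first.
  apply/asboolP => h0; have := level_mass h.
  rewrite /mass (@eq_Rintegral _ _ _ _ _ (cst 0)) => [|y _]; last by rewrite h0.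
  by rewrite /Rintegral integral0 ltxx.
by rewrite RintegralZl //; exact: tame_integrable (tN i) _.
Qed.

Lemma P_start i x : s i < s (i + w)%N -> x <= s i -> P i x = 0.
Proof. by move=> h xs; rewrite prim_smooth // (prim_before (tN i)) // mulr0. Qed.

Lemma P_before i x : x < s i -> P i x = 0.
Proof.
move=> xs; have [h|h] := boolP (s i < s (i + w)%N).
  by rewrite P_start // ltW.
by rewrite prim_atom // leNgt xs.
Qed.

Lemma P_after i x : s (i + w)%N <= x -> P i x = 1.
Proof.
move=> xs; have [h|h] := boolP (s i < s (i + w)%N).
  by rewrite prim_smooth // (prim_after (tN i)) // mulVf // gt_eqF // level_mass.
by rewrite prim_atom // ifT //; apply: le_trans xs; rewrite knots_mono // leq_addr.
Qed.

Lemma P_mono i x y : x <= y -> P i x <= P i y.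
Proof.
move=> xy; have [h|h] := boolP (s i < s (i + w)%N).
  rewrite !prim_smooth // ler_pM2l ?invr_gt0 ?level_mass //.
  exact (prim_mono (tN i) (N0 i) xy).
rewrite !prim_atom //; case: ifPn => [sx|_]; last by case: ifP.
by rewrite ifT // (le_trans sx).
Qed.

Lemma P_ge0 i x : 0 <= P i x.
Proof.
have [h|h] := boolP (s i < s (i + w)%N).
  by rewrite prim_smooth // mulr_ge0 ?prim_ge0 // invr_ge0 ltW // level_mass.
by rewrite prim_atom //; case: ifP.
Qed.

Lemma P_le1 i x : P i x <= 1.
Proof.
have [xs|xs] := leP x (s (i + w)%N); last by rewrite P_after // ltW.
by rewrite -(P_after (lexx (s (i + w)%N))); exact: P_mono.
Qed.

(** A primitive that starts at [a] or later is small just to the right of [a]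
    unless it jumps there, which [a < s (j + w)] excludes. *)
Lemma P_right_small j a e : 0 < e -> a < s (j + w)%N -> a <= s j ->
  exists2 h, 0 < h & forall x, x < a + h -> P j x <= e.
Proof.
move=> e0 asw; rewrite le_eqVlt => /predU1P[aj|aj]; last first.
  exists (s j - a); rewrite ?subr_gt0 // => x; rewrite addrC subrK => xj.
  by rewrite P_before // ltW.
have h : s j < s (j + w)%N by rewrite -aj.
have [B hB] : exists B, forall x, `|N j x| <= B by case: (tN j).
have B0 : 0 <= B := le_trans (normr_ge0 _) (hB 0).
(* The primitive is at most [B * (x - s j)], to be divided by the mass. *)
exists (e * mass (N j) / (B + 1)).
  by rewrite divr_gt0 ?mulr_gt0 ?level_mass // ltr_wpDl.
move=> x; rewrite aj => xh.
have [xj|jx] := leP x (s j); first by rewrite P_start // ltW.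
rewrite prim_smooth // mulrC ler_pdivrMr ?level_mass //.
have hB' y : N j y <= B := le_trans (ler_norm _) (hB y).
apply: le_trans (prim_le_linear (tN j) hB' (ltW jx)) _.
rewrite -ltrBlDl in xh.
have B1 : 0 < B + 1 by rewrite ltr_wpDl.
rewrite ltr_pdivlMr // in xh.
apply: le_trans (ltW xh); rewrite mulrC ler_wpM2l //; last by rewrite lerDl.
by rewrite subr_ge0 ltW.
Qed.

(** Either [P i] jumps to 1 at [s i], where [P j] is still small, or [P j]
    starts strictly later, or domination of the splines passes to their
    primitives. *)
Lemma P_dominates i j : (i < j)%N -> s i < s (i + w).+1 -> dominates (s i) (P i) (P j).
Proof.
move=> ij hi e e0; have [h|h] := boolP (s i < s (i + w)%N); last first.
  have hj : s i < s (j + w)%N.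
    by apply: lt_le_trans hi _; rewrite knots_mono // -addSn leq_add2r.
  have [d d0 hd] := P_right_small e0 hj (knots_mono (ltnW ij)).
  exists d; split=> // x.
    by move=> /andP[xi _]; rewrite prim_atom // ltW.
  move=> xd; have [xi|ix] := ltP x (s i); last by rewrite (prim_atom _ h) ix mulr1 hd.
  by rewrite !P_before ?mulr0 //; apply: lt_le_trans xi _; rewrite knots_mono // ltnW.
have [d0 d00 hpos] := level_pos h.
have Ppos x : s i < x -> 0 < P i x.
  move=> ix; rewrite prim_smooth // mulr_gt0 ?invr_gt0 ?level_mass //.
  exact (prim_gt0 (tN i) (N0 i) d00 hpos ix).
have [hj|hj] := boolP (s j < s (j + w)%N); last first.
  have ij' : s i < s j.
    rewrite lt_neqAle knots_mono 1?ltnW // andbT; apply: contraNneq hj => e1.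
    by rewrite -e1; apply: lt_le_trans h _; rewrite knots_mono // leq_add2r ltnW.
  exists (s j - s i); split; rewrite ?subr_gt0 // => x; first by move=> /andP[/Ppos].
  by rewrite addrC subrK => xj; rewrite (P_before xj) mulr_ge0 ?P_ge0 // ltW.
case: LN => _ _ /(_ i j ij h) D.
have e1 : 0 < e * (mass (N j) / mass (N i)) by rewrite mulr_gt0 // divr_gt0 ?level_mass.
have [d [dpos _ hd]] := D _ e1.
exists d; split=> // x; first by move=> /andP[/Ppos].
move=> xd; rewrite !prim_smooth // mulrC ler_pdivrMr ?level_mass //.
apply: le_trans (prim_le_scale (tN j) (tN i) hd xd) _.
by rewrite -subr_le0 [leLHS](_ : _ = 0) //; ring.
Qed.

Definition next_level i x := P i x - P i.+1 x.

Lemma next_tame i : tame (s i) (s (i + w.+1)%N) (next_level i).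
Proof.
split.
- apply: measurable_funB; apply: nondecreasing_measurable => // x y; exact: P_mono.
- exists 1 => x; rewrite /next_level ler_norml.
  have := P_ge0 i x; have := P_ge0 i.+1 x; have := P_le1 i x; have := P_le1 i.+1 x.
  lra.
- move=> x [xi|ix]; rewrite /next_level.
    by rewrite !P_before ?subr0 //; exact: lt_le_trans xi (sS i).
  rewrite !P_after ?subrr //; first by rewrite addSnnS.
  by apply: le_trans ix; rewrite addnS.
Qed.

(** Near [s i] the primitive [P i.+1] is at most half of [P i], so that the
    difference keeps half of [P i], whereas the spline of index [j] is at most
    [P j]. *)
Lemma next_dominates i j : (i < j)%N -> s i < s (i + w.+1)%N ->
  dominates (s i) (next_level i) (next_level j).
Proof.
move=> ij; rewrite addnS => h e e0.
have [d [d0 hd1 hd2]] := P_dominates (ltnSn i) h (e:=2^-1) ltac:(lra).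
have [d' [d'0 _ hd'2]] := P_dominates ij h (e:=e/2) ltac:(lra).
exists (Num.min d d'); split; first by rewrite lt_min d0.
  move=> x /andP[ix]; rewrite addr_minr lt_min => /andP[xd _].
  rewrite /next_level subr_gt0; apply: le_lt_trans (hd2 _ xd) _.
  have : 0 < P i x by rewrite hd1 // ix.
  lra.
move=> x; rewrite addr_minr lt_min => /andP[xd xd'].
have := hd2 _ xd; have := hd'2 _ xd'; have := P_ge0 j.+1 x; rewrite /next_level => A B C.
have : e * P i.+1 x <= e * (2^-1 * P i x) by rewrite ler_wpM2l // ltW.
lra.
Qed.

Lemma next_at_start i : s i < s (i + w.+1)%N -> 0 <= next_level i (s i).
Proof.
rewrite addnS => h; rewrite /next_level.
have -> : P i.+1 (s i) = 0.
  have [h'|h'] := boolP (s i.+1 < s (i.+1 + w)%N); first by rewrite P_start.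
  rewrite prim_atom // ifF //; apply/negbTE; rewrite -ltNge.
  by apply: lt_le_trans h _; move: h'; rewrite -leNgt addSn.
by rewrite subr0 P_ge0.
Qed.

End Level.

(** * Knot insertion through the recursion *)

Section InsertionLevel.
Context {R : realType}.

(** [N] lives on the knots [r], and [N'] on the same knots without [r l]. The
    coefficients are pinned down where the new knot is outside of the support
    of [N' i]. Inside, their zero pattern is claimed only for the splines [N i]
    and [N i.+1] that do not vanish identically, the coefficient of a vanishing
    spline being arbitrary. *)
Definition insertion_rule (r : nat -> R) (l w : nat) (N N' : nat -> R -> R) :=
  forall i, exists a b : R, [/\ 0 <= a, 0 <= b,
    forall x, N' i x = a * N i x + b * N i.+1 x,
    ((l <= i)%N -> a = 0 /\ b = 1) /\ ((i + w < l)%N -> a = 1 /\ b = 0) &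
    (i < l <= i + w)%N ->
      (r i < r (i + w)%N -> (a != 0) = (r i < r l)) /\
      (r i.+1 < r (i + w).+1 -> (b != 0) = (r l < r (i + w).+1))].

Variables (r : nat -> R) (l w : nat) (N N' : nat -> R -> R).
Let s k := r (bump l k).
Hypotheses (rS : forall k, r k <= r k.+1) (sS : forall k, s k <= s k.+1).
Hypotheses (LN : spline_level r w N) (LN' : spline_level s w N').
Hypothesis rule : insertion_rule r l w N N'.

Let P i := normalized_primitive (N i) (r (i + w)%N).
Let P' i := normalized_primitive (N' i) (s (i + w)%N).

Let primE i x : prim (N i) x = mass (N i) * P i x.
Proof.
have [h|h] := boolP (r i < r (i + w)%N).
  by rewrite /P (prim_smooth LN) // mulrA divff ?mul1r // gt_eqF // (level_mass LN).
rewrite (level_massE LN h) mul0r.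
have z y : N i y = 0 by apply: (level_zero LN); rewrite leNgt.
rewrite /prim (@eq_Rintegral _ _ _ _ _ (cst 0)) => [|y _]; last by rewrite z.
by rewrite /Rintegral integral0.
Qed.

(** Integrating an insertion identity gives a convex combination of normalized
    primitives: the weight [A] is the share of the first summand in the total
    mass, and vanishes with it. *)
Lemma insertion_primitive i : exists A : R, [/\ 0 <= A, A <= 1,
    forall x, P' i x = A * P i x + (1 - A) * P i.+1 x,
    ((l <= i)%N -> A = 0) /\ ((i + w < l)%N -> A = 1) &
    (i < l <= i + w)%N -> r i < r (i + w).+1 ->
      (A != 0) = (r i < r l) /\ (1 - A != 0) = (r l < r (i + w).+1)].
Proof.
have [a [b [a0 b0 e [hl hr] hin]]] := rule i.
have [li|il] := leqP l i.
  have [ea eb] := hl li; exists 0; split=> //; [|by split=> //; lia].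
  move=> x; rewrite mul0r add0r subr0 mul1r /P' /P.
  have -> : N' i = N i.+1 by apply/funext => y; rewrite e ea eb mul0r add0r mul1r.
  by rewrite /s /bump (_ : (l <= i + w)%N = true) //; lia.
have [iwl|liw] := ltnP (i + w) l.
  have [ea eb] := hr iwl; exists 1; split=> //.
  move=> x; rewrite mul1r subrr mul0r addr0 /P' /P.
  have -> : N' i = N i by apply/funext => y; rewrite e ea eb mul0r addr0 mul1r.
  by rewrite /s /bump (_ : (l <= i + w)%N = false) //; lia.
have si : s i = r i by rewrite /s /bump leqNgt il.
have sw : s (i + w)%N = r (i + w).+1 by rewrite /s /bump liw.
have := @prim_atom _ s w N' sS LN' i; have := @prim_smooth _ s w N' LN' i.
rewrite si sw => hsm hat.
have [h|h] := boolP (r i < r (i + w).+1); last first.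
  exists 1; split=> //.
  move=> x; rewrite mul1r subrr mul0r addr0 /P' sw hat // /P (prim_atom rS LN) //.
  apply: contraNN h => /lt_le_trans; apply; exact: rS.
have m0 : 0 < mass (N' i) by apply: (level_mass LN'); rewrite si sw.
have [tN N0 _] := LN; have [tN' _ _] := LN'.
have mE : mass (N' i) = a * mass (N i) + b * mass (N i.+1).
  exact: integral_comb2 (tN' i) (tN i) (tN i.+1) _ e.
have pE x : prim (N' i) x = a * prim (N i) x + b * prim (N i.+1) x.
  exact: integral_comb2 (tN' i) (tN i) (tN i.+1) _ e.
have mge k : 0 <= mass (N k) by exact: Rintegral_ge0.
have eB : 1 - a * mass (N i) / mass (N' i) = b * mass (N i.+1) / mass (N' i).
  by rewrite -[1](divff (lt0r_neq0 m0)) -mulrBl {1}mE; congr (_ / _); ring.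
have mz k : (mass (N k) != 0) = (r k < r (k + w)%N).
  have [hk|hk] := boolP (r k < r (k + w)%N); last by rewrite (level_massE LN hk) eqxx.
  by rewrite gt_eqF // (level_mass LN hk).
have [h1 h2] := hin (introT andP (conj il liw)).
exists (a * mass (N i) / mass (N' i)); split; [| | |by split=> //; lia|].
- by rewrite divr_ge0 // ?mulr_ge0 // ltW.
- by rewrite ler_pdivrMr // mul1r mE lerDl mulr_ge0.
- move=> x; rewrite eB /P' sw hsm // pE !primE -/(P i x) -/(P i.+1 x); ring.
- move=> _ _; rewrite eB !mulf_eq0 !invr_eq0 !(gt_eqF m0) !orbF !negb_or !mz addSn.
  have m1 := knots_mono rS il; have m2 := knots_mono rS liw.
  have m3 := knots_mono rS (leqnSn i); have m4 := rS (i + w)%N.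
  have m5 : r l <= r (i + w).+1 := le_trans m2 m4.
  have m6 : r i <= r l := le_trans m3 m1.
  split.
    have [hi|hi] := boolP (r i < r (i + w)%N); first by rewrite h1 // andbT.
    rewrite andbF; apply/esym/negbTE; rewrite -leNgt.
    by move: hi; rewrite -leNgt; exact: le_trans m2.
  have [hi|hi] := boolP (r i.+1 < r (i + w).+1); first by rewrite h2 // andbT.
  rewrite andbF; apply/esym/negbTE; rewrite -leNgt.
  by move: hi; rewrite -leNgt => /le_trans; apply.
Qed.

(** In the difference of the convex combinations for [i] and [i.+1], with
    weights [A] and [B], the terms regroup as [A * (P i - P i.+1) + (1 - B) *
    (P i.+1 - P i.+2)]. *)
Lemma insertion_rule_next :
  insertion_rule r l w.+1 (next_level r w N) (next_level s w N').
Proof.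
move=> i; have [A [A0 A1 eA [Al Ar] Ain]] := insertion_primitive i.
have [B [B0 B1 eB [Bl Br] Bin]] := insertion_primitive i.+1.
exists A, (1 - B); split=> //; first by rewrite subr_ge0.
- by move=> x; rewrite /next_level -/(P' i x) -/(P' i.+1 x) eA eB /P; ring.
- rewrite addnS; split=> [li|h]; first by rewrite (Al li) (Bl (leqW li)) subr0.
  by rewrite (Ar (ltnW h)) (Br h) subrr.
- rewrite addnS => /andP[il]; rewrite leq_eqVlt => hl; split=> h.
    case/orP: hl => [/eqP l1|l1].
      by rewrite Ar ?oner_eq0 l1 ?h.
    by apply: (Ain _ h).1; rewrite il.
  move: il; rewrite leq_eqVlt => /orP[/eqP l1|l1].
    by rewrite Bl -?l1 // subr0 oner_eq0 -addSn h.
  have hl' : (l <= (i + w).+1)%N by case/orP: hl => [/eqP ->|/ltnW].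
  by move: Bin; rewrite addSn l1 hl' => /(_ isT h)[].
Qed.

End InsertionLevel.

(** * Generalized B-splines of order 2 *)

Section Hat.
Context {R : realType}.
Implicit Types (f g : R -> R) (a b x y : R) (s : nat -> R) (F G : nat -> R -> R).

Definition det f g x y : R := f x * g y - f y * g x.

Definition chebyshev_pos a b f g : Prop :=
  [/\ forall x y, a <= x -> x < y -> y <= b -> 0 < det f g x y,
      {within `[a, b], continuous f} & {within `[a, b], continuous g}].

(** The functions [F k] and [G k] span the space used between [s k] and [s
    k.+1]; on a degenerate interval they are arbitrary. *)
Definition chain s F G : Prop :=
  (forall k, s k <= s k.+1) /\
  forall k, s k < s k.+1 -> chebyshev_pos (s k) (s k.+1) (F k) (G k).

(** The elements of the span of [f] and [g] with values 0 and 1, resp. 1 and 0,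
    at [a] and [b]. *)
Definition rising a b f g x : R := det f g a x / det f g a b.
Definition falling a b f g x : R := det f g x b / det f g a b.

Definition hat s F G i x : R :=
  if s i <= x < s i.+1 then rising (s i) (s i.+1) (F i) (G i) x
  else if s i.+1 <= x < s i.+2 then falling (s i.+1) (s i.+2) (F i.+1) (G i.+1) x
  else 0.

Lemma det_self f g x : det f g x x = 0. Proof. by rewrite /det subrr. Qed.

Lemma chebyshev_posW a b a' b' f g : a <= a' -> b' <= b ->
  chebyshev_pos a b f g -> chebyshev_pos a' b' f g.
Proof.
move=> aa bb [h1 h2 h3].
have sub : `[a', b'] `<=` `[a, b].
  move=> x /=; rewrite !in_itv /= => /andP[ax xb].
  by rewrite (le_trans aa ax) (le_trans xb bb).
split; [|exact: continuous_subspaceW h2|exact: continuous_subspaceW h3].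
by move=> x y ax xy yb; apply: h1 => //; [exact: le_trans ax|exact: le_trans bb].
Qed.

Lemma comb_continuous a b f g c d : {within `[a, b], continuous f} ->
  {within `[a, b], continuous g} ->
  {within `[a, b], continuous (fun x => c * f x + d * g x)}.
Proof.
move=> cf cg x; apply: cvgD; apply: cvgM.
- exact: cvg_cst.
- exact: cf.
- exact: cvg_cst.
- exact: cg.
Qed.

Section Interval.
Variables (a b : R) (f g : R -> R).
Hypotheses (ab : a < b) (fg : chebyshev_pos a b f g).

Lemma det_pos : 0 < det f g a b. Proof. by case: fg => h _ _; exact: h. Qed.

Lemma rising_at_l : rising a b f g a = 0.
Proof. by rewrite /rising det_self mul0r. Qed.

Lemma falling_at_l : falling a b f g a = 1.
Proof. by rewrite /falling divff // gt_eqF // det_pos. Qed.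

Lemma rising_gt0 x : a < x -> x <= b -> 0 < rising a b f g x.
Proof. by move=> ax xb; rewrite divr_gt0 ?det_pos //; case: fg => h _ _; exact: h. Qed.

Lemma falling_gt0 x : a <= x -> x < b -> 0 < falling a b f g x.
Proof. by move=> ax xb; rewrite divr_gt0 ?det_pos //; case: fg => h _ _; exact: h. Qed.

Lemma rising_ge0 x : a <= x -> x <= b -> 0 <= rising a b f g x.
Proof.
rewrite le_eqVlt => /predU1P[<-|ax] xb; first by rewrite rising_at_l.
exact/ltW/rising_gt0.
Qed.

Lemma rising_continuous : {within `[a, b], continuous (rising a b f g)}.
Proof.
have -> : rising a b f g =
    fun x => (- g a / det f g a b) * f x + (f a / det f g a b) * g x.
  by apply/funext => x; rewrite /rising /det; ring.
by case: fg => _ cf cg; exact: comb_continuous.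
Qed.

Lemma falling_continuous : {within `[a, b], continuous (falling a b f g)}.
Proof.
have -> : falling a b f g =
    fun x => (g b / det f g a b) * f x + (- f b / det f g a b) * g x.
  by apply/funext => x; rewrite /falling /det; ring.
by case: fg => _ cf cg; exact: comb_continuous.
Qed.

End Interval.

Lemma within_bounded a b (w : R -> R) : {within `[a, b], continuous w} ->
  exists B, forall x, a <= x -> x <= b -> `|w x| <= B.
Proof.
move=> cw; have [ab|ab] := leP a b; last first.
  by exists 0 => x ax xb; have := le_lt_trans (le_trans ax xb) ab; rewrite ltxx.
have ne : `[a, b] !=set0 by exists a; rewrite /= in_itv /= lexx ab.
have [c1 _ h1] := compact_EVT_max ne (@segment_compact _ a b) cw.
have [c2 _ h2] := compact_EVT_min ne (@segment_compact _ a b) cw.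
exists (`|w c1| + `|w c2|) => x ax xb.
have xab : x \in `[a, b]%classic by rewrite inE /= in_itv /= ax.
have := h1 x xab; have := h2 x xab; rewrite ler_norml => A B.
have := ler_norm (w c1); have := ler_norm (- w c2); rewrite normrN.
have := normr_ge0 (w c1); have := normr_ge0 (w c2); lra.
Qed.

Lemma within_right_pos a b (w : R -> R) : a < b -> {within `[a, b], continuous w} ->
  0 < w a -> exists h, [/\ 0 < h, a + h <= b & forall x, a <= x < a + h -> 0 < w x].
Proof.
move=> ab /(continuous_within_itvP _ ab)[_ ca _] wa.
have : \forall x \near a^'+, 0 < w x by apply: cvgr_gt ca _ wa.
rewrite near_withinE => /nbhs_ballP[e /= e0 he].
exists (Num.min e (b - a)); split; first by rewrite lt_min e0 subr_gt0.
  by rewrite -lerBrDl ge_min lexx orbT.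
move=> x /andP[]; rewrite le_eqVlt => /predU1P[<- //|ax].
rewrite addr_minr lt_min => /andP[xe _]; apply: he => //=.
by rewrite -ball_normE /= distrC gtr0_norm ?subr_gt0 // ltrBlDl.
Qed.

End Hat.

Section HatLevel.
Context {R : realType}.
Variables (s : nat -> R) (F G : nat -> R -> R).
Hypothesis C : chain s F G.

Let sS k : s k <= s k.+1. Proof. by case: C. Qed.
Let cb k : s k < s k.+1 -> chebyshev_pos (s k) (s k.+1) (F k) (G k).
Proof. by case: C => _; exact. Qed.

Lemma hat_tame i : tame (s i) (s (i + 2)%N) (hat s F G i).
Proof.
rewrite addn2; split.
- have -> : hat s F G i = (rising (s i) (s i.+1) (F i) (G i) \_ `[s i, s i.+1[)
      \+ (falling (s i.+1) (s i.+2) (F i.+1) (G i.+1) \_ `[s i.+1, s i.+2[).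
    apply/funext => x; rewrite /hat /= !patchE !mem_setE !in_itv /=.
    case: ifPn => [/andP[_ h]|_]; first by rewrite leNgt h addr0.
    by rewrite add0r.
  apply: measurable_funD; apply/(measurable_restrictT _ _).1 => //.
    have [h|h] := boolP (s i < s i.+1).
      apply: (@measurable_funS _ _ _ _ `[s i, s i.+1]) => //.
        by move=> x /=; rewrite !in_itv /= => /andP[-> /ltW].
      by apply: subspace_continuous_measurable_fun => //; exact: rising_continuous (cb h).
    rewrite set_itv_ge ?bnd_simp //; exact: measurable_fun_set0.
  have [h|h] := boolP (s i.+1 < s i.+2).
    apply: (@measurable_funS _ _ _ _ `[s i.+1, s i.+2]) => //.
      by move=> x /=; rewrite !in_itv /= => /andP[-> /ltW].
    by apply: subspace_continuous_measurable_fun => //; exact: falling_continuous (cb h).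
  rewrite set_itv_ge ?bnd_simp //; exact: measurable_fun_set0.
- have [B1 h1] : exists B, forall x, s i <= x -> x < s i.+1 ->
      `|rising (s i) (s i.+1) (F i) (G i) x| <= B.
    have [h|h] := ltP (s i) (s i.+1).
      have [B hB] := within_bounded (rising_continuous (cb h)).
      by exists B => x ax xb; apply: hB => //; exact: ltW.
    by exists 0 => x ax xb; have := lt_le_trans (le_lt_trans ax xb) h; rewrite ltxx.
  have [B2 h2] : exists B, forall x, s i.+1 <= x -> x < s i.+2 ->
      `|falling (s i.+1) (s i.+2) (F i.+1) (G i.+1) x| <= B.
    have [h|h] := ltP (s i.+1) (s i.+2).
      have [B hB] := within_bounded (falling_continuous (cb h)).
      by exists B => x ax xb; apply: hB => //; exact: ltW.
    by exists 0 => x ax xb; have := lt_le_trans (le_lt_trans ax xb) h; rewrite ltxx.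
  exists (`|B1| + `|B2|) => x; rewrite /hat.
  have p1 := normr_ge0 B1; have p2 := normr_ge0 B2.
  have q1 := ler_norm B1; have q2 := ler_norm B2.
  case: ifPn => [/andP[xa xb]|_]; first by have := h1 x xa xb; lra.
  case: ifPn => [/andP[xa xb]|_]; first by have := h2 x xa xb; lra.
  by rewrite normr0 addr_ge0.
- move=> x h; rewrite /hat; case: ifPn => [/andP[xa xb]|_].
    case: h => h; first by have := le_lt_trans xa h; rewrite ltxx.
    by have := lt_le_trans xb (le_trans (sS _) h); rewrite ltxx.
  case: ifPn => [/andP[xa xb]|//].
  case: h => h; last by have := lt_le_trans xb h; rewrite ltxx.
  by have := lt_le_trans h (le_trans (sS _) xa); rewrite ltxx.
Qed.

Lemma hat_ge0 i x : 0 <= hat s F G i x.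
Proof.
rewrite /hat; case: ifPn => [/andP[xa xb]|_].
  have h := le_lt_trans xa xb; exact: (rising_ge0 h (cb h) xa (ltW xb)).
case: ifPn => [/andP[xa xb]|//].
by apply/ltW/falling_gt0 => //; [exact: le_lt_trans xa xb|exact/cb/(le_lt_trans xa xb)].
Qed.

(** Either the hat rises on an interval where no later hat has started, or its
    support starts with a falling branch of value 1, while the rising branch of
    the next hat starts from 0. *)
Lemma hat_dominates i j : (i < j)%N -> s i < s (i + 2)%N ->
  dominates (s i) (hat s F G i) (hat s F G j).
Proof.
rewrite addn2 => ij hi e e0.
have zero k x : x < s k -> hat s F G k x = 0.
  by move=> xk; have [_ _ -> //] := hat_tame k; left.
have [h|h] := boolP (s i < s i.+1).
  exists (s i.+1 - s i); rewrite subr_gt0 addrC subrK; split=> // x.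
    by move=> /andP[xa xb]; rewrite /hat (ltW xa) xb /=; exact: (rising_gt0 h (cb h) xa (ltW xb)).
  by move=> xb; rewrite (zero j) ?mulr_ge0 ?hat_ge0 ?ltW // (lt_le_trans xb) // knots_mono.
have e1 : s i.+1 = s i by apply/eqP; rewrite eq_le sS andbT leNgt.
have h' : s i.+1 < s i.+2 by rewrite e1.
have hE x : s i <= x -> x < s i.+2 ->
    hat s F G i x = falling (s i.+1) (s i.+2) (F i.+1) (G i.+1) x.
  by move=> xa xb; rewrite /hat e1 xa xb /= ltNge xa.
have [j1|j1] := eqVneq j i.+1; last first.
  have i2j : s i.+2 <= s j by rewrite knots_mono //; lia.
  exists (s i.+2 - s i); rewrite subr_gt0 addrC subrK; split=> // x.
    move=> /andP[xa xb]; rewrite hE ?ltW //; apply: (falling_gt0 h' (cb h')) => //.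
    by rewrite e1 ltW.
  by move=> xb; rewrite (zero j) ?mulr_ge0 ?hat_ge0 ?ltW // (lt_le_trans xb).
pose up := rising (s i.+1) (s i.+2) (F i.+1) (G i.+1).
pose dn := falling (s i.+1) (s i.+2) (F i.+1) (G i.+1).
have cw : {within `[s i.+1, s i.+2], continuous (fun x => e * dn x - up x)}.
  have cu := rising_continuous (cb h'); have cd := falling_continuous (cb h').
  move=> x; apply: cvgB; last exact: cu.
  by apply: cvgM; [exact: cvg_cst|exact: cd].
have w0 : 0 < e * dn (s i.+1) - up (s i.+1).
  by rewrite /dn /up rising_at_l (falling_at_l h' (cb h')) mulr1 subr0.
have [d [d0 db hd]] := within_right_pos h' cw w0.
exists d; split=> // x.
  move=> /andP[xa xb]; rewrite -e1 in xb.
  have xb' := lt_le_trans xb db.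
  by rewrite hE ?ltW //; apply: (falling_gt0 h' (cb h')) => //; rewrite e1 ltW.
move=> xd; have [xa|ax] := ltP x (s i); first by rewrite !zero ?mulr0 // j1 e1.
rewrite -e1 in xd; have xb := lt_le_trans xd db.
rewrite hE // j1 {1}/hat xb e1 ax /= -e1 -subr_ge0 ltW // hd // e1 ax /=.
by rewrite -e1.
Qed.

Lemma hat_level : spline_level s 2 (hat s F G).
Proof. by split; [exact: hat_tame|exact: hat_ge0|exact: hat_dominates]. Qed.

End HatLevel.

Section HatInsertion.
Context {R : realType}.
Implicit Types (f g : R -> R) (a b c d x : R).

(** A hat function in which the two branches may use unrelated pairs, so that
    the branch receiving a knot can be treated alone. *)
Definition tent a b c f g f' g' x : R :=
  if a <= x < b then rising a b f g x
  else if b <= x < c then falling b c f' g' x else 0.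

Lemma hat_tent s F G i :
  hat s F G i = tent (s i) (s i.+1) (s i.+2) (F i) (G i) (F i.+1) (G i.+1) :> (R -> R).
Proof. by []. Qed.

(** The identity is the three-term relation [det a x * det b c = det a b * det
    x c + det a c * det b x], with [det] the determinant of the values of [f]
    and [g] at two points. *)
Lemma tent_insert_left a b c d f g f' g' x :
  a <= b -> b <= c -> c <= d -> (a < c -> chebyshev_pos a c f g) ->
  tent a c d f g f' g' x =
    (if a < c then rising a c f g b else 0) * tent a b c f g f g x
    + tent b c d f g f' g' x.
Proof.
move=> ab bc cd ch; rewrite /tent.
have [ac|ca] := ltP a c; last first.
  have ea : a = c by apply/eqP; rewrite eq_le ca (le_trans ab bc).
  have eb : b = c by apply/eqP; rewrite eq_le bc -ea ab.
  by rewrite ea eb mul0r add0r.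
have [h _ _] := ch ac.
have nac : det f g a c != 0 by rewrite gt_eqF // h.
have [xa|ax] := ltP x a.
  by rewrite /= !(leNgt b) !(leNgt c) (lt_le_trans xa ab) (lt_trans xa ac) /= mulr0 addr0.
have [xb|bx] := ltP x b.
  rewrite (lt_le_trans xb bc) /= (leNgt c) (lt_le_trans xb bc) /= addr0.
  have nab : det f g a b != 0 by rewrite gt_eqF // h // (le_lt_trans ax xb).
  by rewrite /rising; field; rewrite ?nab ?nac.
have [xc|cx] := ltP x c; rewrite /= ?mulr0 ?add0r //.
have nbc : det f g b c != 0 by rewrite gt_eqF // h // (le_lt_trans bx xc).
by rewrite /rising /falling; move: nac nbc; rewrite /det => nac nbc; field; rewrite ?nab ?nac ?nbc ?andbT /=.
Qed.

Lemma tent_insert_right a b c d f g f' g' x :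
  a <= b -> b <= c -> c <= d -> (b < d -> chebyshev_pos b d f' g') ->
  tent a b d f g f' g' x =
    tent a b c f g f' g' x
    + (if b < d then falling b d f' g' c else 0) * tent b c d f' g' f' g' x.
Proof.
move=> ab bc cd ch; rewrite /tent.
have [xa|ax] := ltP x a.
  by rewrite /= !(leNgt b) !(leNgt c) (lt_le_trans xa ab) (lt_le_trans xa (le_trans ab bc)) /= mulr0 addr0.
have [bd|db] := ltP b d; last first.
  have ed : d = b by apply/eqP; rewrite eq_le db (le_trans bc cd).
  have ec : c = b by apply/eqP; rewrite eq_le bc -{1}ed cd.
  by rewrite ed ec mul0r addr0.
have [h _ _] := ch bd.
have nbd : det f' g' b d != 0 by rewrite gt_eqF // h.
have [xb|bx] := ltP x b.
  by rewrite /= (leNgt c) (lt_le_trans xb bc) /= mulr0 addr0.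
have [xc|cx] := ltP x c.
  rewrite /= (lt_le_trans xc cd).
  have nbc : det f' g' b c != 0 by rewrite gt_eqF // h // (le_lt_trans bx xc).
  by rewrite /rising /falling; move: nbd nbc; rewrite /det => nbd nbc; field; rewrite ?nbd ?nbc ?ncd ?andbT /=.
have [xd|dx] := ltP x d; rewrite /= ?mulr0 ?add0r ?addr0 //.
have ncd : det f' g' c d != 0 by rewrite gt_eqF // h // (le_lt_trans cx xd).
by rewrite /falling; field; rewrite ?nbd ?nbc ?ncd ?andbT /=.
Qed.

Variables (r : nat -> R) (l : nat) (F G : nat -> R -> R).
Hypotheses (l0 : (0 < l)%N) (Fl : F l = F l.-1) (Gl : G l = G l.-1).
Hypothesis C : chain r F G.
Hypothesis C' : chain (r \o bump l) (F \o bump l) (G \o bump l).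

Lemma hat_insertion : insertion_rule r l 2 (hat r F G)
  (hat (r \o bump l) (F \o bump l) (G \o bump l)).
Proof.
have [rS cb] := C; have [_ cb'] := C'.
move=> i; rewrite addn2; have [li|il] := leqP l i.
  exists 0, 1; split=> // [x|]; last by split=> //; lia.
  rewrite mul0r add0r mul1r /hat /= /bump li.
  by rewrite (_ : (l <= i.+1)%N = true) 1?(_ : (l <= i.+2)%N = true) //; lia.
have [il2|] := ltnP i.+2 l.
  exists 1, 0; split=> // x.
  rewrite mul0r addr0 mul1r /hat /= /bump (_ : (l <= i)%N = false); last lia.
  by rewrite (_ : (l <= i.+1)%N = false) 1?(_ : (l <= i.+2)%N = false) //; lia.
rewrite leq_eqVlt => /orP[/eqP el|li].
  move: cb' => /(_ i.+1); rewrite el /= /bump ltnn ltnSn /= add0n add1n => cb'.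
  have Fi : F i.+2 = F i.+1 by rewrite -el Fl el.
  have Gi : G i.+2 = G i.+1 by rewrite -el Gl el.
  exists 1, (if r i.+1 < r i.+3 then falling (r i.+1) (r i.+3) (F i.+1) (G i.+1) (r i.+2) else 0).
  have f0 : r i.+1 < r i.+3 -> r i.+2 < r i.+3 ->
      0 < falling (r i.+1) (r i.+3) (F i.+1) (G i.+1) (r i.+2).
    by move=> h1 h2; exact: (falling_gt0 h1 (cb' h1)).
  have fz : r i.+2 = r i.+3 ->
      falling (r i.+1) (r i.+3) (F i.+1) (G i.+1) (r i.+2) = 0.
    by move=> ->; rewrite /falling det_self mul0r.
  have := rS i.+2; rewrite le_eqVlt => r23; split=> //.
  - case: ifP => // h; case/predU1P: r23 => [/fz -> //|h2]; exact/ltW/f0.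
  - move=> x; rewrite mul1r !hat_tent /= /bump ltnn ltnSn.
    rewrite (_ : (i.+1 < i)%N = false); last lia.
    rewrite !add0n add1n Fi Gi.
    by rewrite -(@tent_insert_right (r i) (r i.+1) (r i.+2) (r i.+3)).
  - move=> _; split=> [->|h]; first by rewrite oner_eq0.
    rewrite h; case/predU1P: r23 => [h2|h2]; first by rewrite fz // h2 ltxx eqxx.
    by rewrite h2 gt_eqF // f0.
have el : l = i.+1 by lia.
move: cb' => /(_ i); rewrite el /= /bump ltnn leqnn /= add0n add1n => cb'.
have Fi : F i.+1 = F i by rewrite -el Fl el.
have Gi : G i.+1 = G i by rewrite -el Gl el.
exists (if r i < r i.+2 then rising (r i) (r i.+2) (F i) (G i) (r i.+1) else 0), 1.
have f0 : r i < r i.+2 -> r i < r i.+1 ->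
    0 < rising (r i) (r i.+2) (F i) (G i) (r i.+1).
  by move=> h1 h2; exact: (rising_gt0 h1 (cb' h1)).
have fz : r i = r i.+1 -> rising (r i) (r i.+2) (F i) (G i) (r i.+1) = 0.
  by move=> <-; rewrite /rising det_self mul0r.
have := rS i; rewrite le_eqVlt => r01; split=> //.
- case: ifP => // h; case/predU1P: r01 => [/fz -> //|h2]; exact/ltW/f0.
- move=> x; rewrite mul1r !hat_tent /= /bump ltnn leqnn.
  have e3 : ((i < i.+2) + i.+2)%N = i.+3 by rewrite (_ : (i < i.+2)%N = true) //; lia.
  rewrite e3 (_ : (false + i)%N = i) // (_ : (true + i.+1)%N = i.+2) // Fi Gi.
  by rewrite -(@tent_insert_left (r i) (r i.+1) (r i.+2) (r i.+3)).
- move=> _; split=> [h|->]; last by rewrite oner_eq0.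
  rewrite h; case/predU1P: r01 => [h2|h2]; first by rewrite fz // h2 ltxx eqxx.
  by rewrite h2 gt_eqF // f0.
Qed.

End HatInsertion.

(** * Generalized B-splines of any order *)

Section Spl.
Context {R : realType}.
Implicit Types (s : nat -> R) (F G : nat -> R -> R).

Fixpoint spl s F G (m : nat) : nat -> R -> R :=
  if m is m'.+1 then next_level s m'.+2 (spl s F G m') else hat s F G.

(** The new knot splits one interval, and both parts keep its pair of
    functions, whence [F l = F l.-1]. *)
Definition spl_insertion m : Prop := forall r l F G,
  (0 < l)%N -> F l = F l.-1 -> G l = G l.-1 ->
  chain r F G -> chain (r \o bump l) (F \o bump l) (G \o bump l) ->
  insertion_rule r l m.+2 (spl r F G m)
    (spl (r \o bump l) (F \o bump l) (G \o bump l) m).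

Definition insert_at l (T : Type) (z : T) (f : nat -> T) k : T :=
  if (k < l)%N then f k else if k == l then z else f k.-1.

Lemma insert_at_bump l T (z : T) f : insert_at l z f \o bump l = f.
Proof.
apply/funext => k; rewrite /= /insert_at /bump; have [lk|kl] := leqP l k.
  rewrite add1n ltnNge (leq_trans lk) //= (_ : (k.+1 == l) = false) //; lia.
by rewrite add0n kl.
Qed.

Lemma chain_insert s F G l z : (0 < l)%N -> chain s F G ->
  s l.-1 <= z -> z <= s l ->
  chain (insert_at l z s) (insert_at l (F l.-1) F) (insert_at l (G l.-1) G).
Proof.
move=> l0 [sS cb] lz zl; rewrite /insert_at; split=> k.
  have [kl|kl] := ltnP k.+1 l; first by rewrite ltnW.
  have [e|ne] := eqVneq k.+1 l; first by rewrite -e ltnSn; move: lz; rewrite -e.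
  have [e|ne'] := eqVneq k l; first by rewrite e ltnn.
  by rewrite (_ : (k < l)%N = false) /=; [move: (sS k.-1); rewrite prednK //; lia | lia].
have [kl|kl] := ltnP k.+1 l; first by rewrite ltnW //; exact: cb.
have [e|ne] := eqVneq k.+1 l.
  rewrite -e ltnSn => h; apply: chebyshev_posW (cb k _) => //; first by rewrite e.
  by apply: lt_le_trans h _; rewrite e.
have [e|ne'] := eqVneq k l.
  rewrite e ltnn /= => h; have {}h' : s l.-1 < s l.-1.+1.
    by rewrite prednK //; exact: le_lt_trans h.
  by apply: chebyshev_posW (cb l.-1 h') => //; rewrite prednK.
rewrite (_ : (k < l)%N = false) /=; last lia.
by have := cb k.-1; rewrite prednK //; lia.
Qed.

(** Nonnegativity at a point [x] inside of the support. Inserting [x] as a knot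
    expresses the spline through two splines for which [x] is nearer to one end
    of the support, counted in knots; the coefficients are nonnegative. After
    finitely many insertions [x] is either outside of the support or its first
    knot, where the value is known. *)
Lemma next_nonneg m :
  (forall s F G, chain s F G -> spline_level s m.+2 (spl s F G m)) ->
  spl_insertion m.+1 ->
  forall s F G, chain s F G -> forall i x, 0 <= spl s F G m.+1 i x.
Proof.
move=> Lm ins.
have Z s F G (C : chain s F G) i y :
    y < s i \/ s (i + m.+3)%N <= y -> spl s F G m.+1 i y = 0.
  by have [sS _] := C; have [_ _] := next_tame sS (Lm _ _ _ C) i; apply.
(* [n1] is the distance, counted in knots, from the first knot to one beyond
   [x], and [n2] the one from the last knot to one before [x]; every insertion
   lowers their sum. *)
suff H n : forall s F G, chain s F G -> forall i x n1 n2, (n1 + n2 <= n)%N ->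
    x <= s (i + n1)%N -> s (i + m.+3 - n2)%N <= x -> (n2 <= m.+3)%N ->
    0 <= spl s F G m.+1 i x.
  move=> s F G C i x; have [sS _] := C.
  have zero := Z _ _ _ C i.
  have [xi|ix] := ltP x (s i); first by rewrite zero //; left.
  have [xe|ex] := leP (s (i + m.+3)%N) x; first by rewrite zero //; right.
  apply: (H _ _ _ _ C i x m.+3 m.+3 (leqnn _)) => //; first exact: ltW.
  by rewrite addnK.
elim: n => [|n IH] s F G C i x n1 n2 hn h1 h2 n2m; have [sS _] := C.
  have zero := Z _ _ _ C i.
  rewrite zero //; right; move: h2; have -> : n2 = 0%N by lia.
  by rewrite subn0.
have zero := Z _ _ _ C i.
have [xi|] := ltP x (s i); first by rewrite zero //; left.
have [xe _|ex] := leP (s (i + m.+3)%N) x; first by rewrite zero //; right.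
rewrite le_eqVlt => /predU1P[ix|ix].
  rewrite -ix; apply: (next_at_start sS (Lm _ _ _ C)); rewrite ix; exact: ex.
have n10 : (0 < n1)%N.
  by rewrite lt0n; apply: contraTneq h1 => ->; rewrite addn0 -ltNge.
have n20 : (0 < n2)%N.
  by rewrite lt0n; apply: contraTneq h2 => ->; rewrite subn0 -ltNge.
have [h1'|h1'] := leP x (s (i + n1).-1).
  by apply: (IH s F G C i x n1.-1 n2) => //; [lia|rewrite -subn1 addnBA // subn1].
have n1m : (n1 <= m.+3)%N.
  rewrite leqNgt; apply/negP => h; move: (lt_trans h1' ex); apply/negP; rewrite -leNgt.
  by apply: knots_mono => //; lia.
pose l := (i + n1)%N.
have l0 : (0 < l)%N by rewrite /l; lia.
pose r := insert_at l x s.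
pose F' := insert_at l (F l.-1) F; pose G' := insert_at l (G l.-1) G.
have Cr : chain r F' G' by apply: chain_insert => //; exact: ltW.
have Fl : F' l = F' l.-1 by rewrite /F' /insert_at ltnn eqxx prednK // leqnn.
have Gl : G' l = G' l.-1 by rewrite /G' /insert_at ltnn eqxx prednK // leqnn.
have := ins r l F' G' l0 Fl Gl Cr; rewrite !insert_at_bump => /(_ C i).
move=> [a [b [a0 b0 -> _ _]]].
have rl : r l = x by rewrite /r /insert_at ltnn eqxx.
have [rS _] := Cr.
have r2 : r (i + m.+3 - n2).+1 <= x.
  have [h|h] := leqP l (i + m.+3 - n2).
    by rewrite /r /insert_at ltnNge (leq_trans h) //= (_ : (_ == l) = false) //; lia.
  by rewrite -rl; exact: knots_mono.
apply: addr_ge0; apply: mulr_ge0 => //.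
  apply: (IH r F' G' Cr i x n1 n2.-1) => //.
  - lia.
  - by rewrite -/l rl.
  - by rewrite (_ : (i + m.+3 - n2.-1 = (i + m.+3 - n2).+1)%N) //; lia.
  - lia.
apply: (IH r F' G' Cr i.+1 x n1.-1 n2) => //.
- lia.
- by rewrite (_ : (i.+1 + n1.-1 = l)%N) ?rl // /l; lia.
- by rewrite (_ : (i.+1 + m.+3 - n2 = (i + m.+3 - n2).+1)%N) //; lia.
Qed.

(** A joint induction: the insertion rule needs nonnegative splines of the
    previous order only, and then yields nonnegativity at its own order. *)
Lemma spl_level_insertion m :
  (forall s F G, chain s F G -> spline_level s m.+2 (spl s F G m)) /\ spl_insertion m.
Proof.
elim: m => [|m [Lm Im]].
  by split=> [s F G C|r l F G *]; [exact: hat_level|exact: hat_insertion].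
have In : spl_insertion m.+1.
  move=> r l F G l0 Fl Gl C C'.
  apply: insertion_rule_next; [by case: C|by case: C'|exact: Lm|exact: Lm|exact: Im].
split=> // s F G C; have [sS _] := C; split.
- exact: next_tame (Lm _ _ _ C).
- exact: next_nonneg.
- exact: next_dominates (Lm _ _ _ C).
Qed.

Lemma spl_level m s F G : chain s F G -> spline_level s m.+2 (spl s F G m).
Proof. exact: (spl_level_insertion m).1. Qed.

Lemma spl_insert m : spl_insertion m.
Proof. exact: (spl_level_insertion m).2. Qed.

End Spl.

(** * Polynomial B-splines *)

Section BSpline.
Context {R : realType}.
Implicit Types (s r : nat -> R) (x : R).

Section Monotone.
Variable s : nat -> R.
Hypothesis sS : forall k, s k <= s k.+1.
Local Notation B := (bspline s).

Lemma bspline_supp d i x : x < s i \/ s (i + d.+1)%N <= x -> B d i x = 0.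
Proof.
elim: d i => [|d IH] i h /=.
  rewrite ifF //; apply/negbTE; rewrite negb_and -!ltNge -leNgt.
  by move: h; rewrite addn1 => -[->|->] //; rewrite orbT.
rewrite !IH ?mulr0 ?addr0 //.
- case: h => h; [left; exact: lt_le_trans h (sS i)|right].
  by rewrite addSnnS.
- case: h => h; [by left|right].
  by apply: le_trans h; rewrite [(i + d.+2)%N]addnS.
Qed.

Lemma bspline_ge0 d i x : 0 <= B d i x.
Proof.
elim: d i => [|d IH] i /=; first by case: ifP.
have mono := knots_mono sS.
have [xi|ix] := ltP x (s i).
  by rewrite !bspline_supp ?mulr0 ?addr0 //; left => //; exact: lt_le_trans xi (sS i).
have [xe|ex] := leP (s (i + d.+2)%N) x.
  rewrite !bspline_supp ?mulr0 ?addr0 //; right; first by rewrite addSnnS.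
  by apply: le_trans xe; rewrite mono // leq_add2l.
by apply: addr_ge0; apply: mulr_ge0 => //; apply: divr_ge0; rewrite subr_ge0 //;
  first [exact: ltW | apply: mono; lia].
Qed.

Lemma bspline_gt0 d i k x : (i <= k <= i + d)%N -> s k < x < s k.+1 -> 0 < B d i x.
Proof.
move=> + /andP[kx xk]; have mono := knots_mono sS.
elim: d i => [|d IH] i /andP[ik kd] /=.
  by rewrite (_ : i = k) ?(ltW kx) ?xk //; lia.
have [kd'|kd'] := leqP k (i + d).
  apply: ltr_pwDl; last first.
    apply: mulr_ge0; last exact: bspline_ge0.
    have h : x < s (i + d.+2)%N by apply: lt_le_trans xk _; apply: mono; lia.
    by apply: divr_ge0; rewrite subr_ge0 ?(ltW h) //; apply: mono; lia.
  apply: mulr_gt0; last by apply: IH; rewrite ik.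
  have h : s i < x by apply: le_lt_trans kx; exact: mono.
  rewrite divr_gt0 ?subr_gt0 //; apply: lt_trans h _; apply: lt_le_trans xk _.
  by apply: mono; lia.
have ek : k = (i + d).+1 by lia.
apply: ltr_wpDl.
  apply: mulr_ge0; last exact: bspline_ge0.
  have h : s i <= x by apply: le_trans (ltW kx); exact: mono.
  by apply: divr_ge0; rewrite subr_ge0 //; apply: mono; lia.
apply: mulr_gt0; last by apply: IH; lia.
have h : x < s (i + d.+2)%N by apply: lt_le_trans xk _; apply: mono; lia.
rewrite divr_gt0 ?subr_gt0 //; apply: le_lt_trans h; apply: le_trans (ltW kx).
by apply: mono; lia.
Qed.

Lemma bspline_start d j a : a <= s j -> a < s (j + d)%N -> B d j a = 0.
Proof.
elim: d j => [|d IH] j; rewrite ?addn0 /= => aj ad; first by rewrite leNgt ad.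
move: aj; rewrite le_eqVlt => /predU1P[aj|aj]; last first.
  by rewrite !bspline_supp ?mulr0 ?addr0 //; left => //; exact: lt_le_trans aj (sS j).
rewrite (IH j.+1) ?mulr0 ?addr0; last by rewrite addSnnS.
  by rewrite aj subrr !mul0r.
by rewrite aj.
Qed.

(** Near its left end a B-spline outgrows the later ones by a linear factor. In
    the induction step, [B d.+1 i] is at least half of [B d i.+1], whose weight
    tends to 1, whereas both terms of [B d.+1 j] carry a factor [x - s i]: one
    in its weight, the other one by induction. *)
Lemma bspline_growth d i j k : (i <= k <= i + d)%N -> s i = s k -> s k < s k.+1 ->
  (i <= j)%N -> exists K h, [/\ 0 <= K, 0 < h <= 1 &
    forall x, s i < x < s i + h ->
      B d j x <= K * B d i x /\ ((i < j)%N -> B d j x <= K * (x - s i) * B d i x)].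
Proof.
move=> + sik skk; have mono := knots_mono sS.
elim: d i j sik => [|d IH] i j sik /andP[ik kd] ij.
  have ek : k = i by lia.
  exists 1, (Num.min 1 (s i.+1 - s i)); split=> //.
    by rewrite lt_min ltr01 subr_gt0 -ek skk ge_min lexx.
  move=> x /andP[ix]; rewrite addr_minr lt_min subrKC => /andP[_ xi].
  have z : (i < j)%N -> B 0 j x = 0.
    by move=> h; apply: bspline_supp; left; apply: lt_le_trans xi (mono _ _ h).
  split=> [|h]; last by rewrite z // mul1r mulr_ge0 ?bspline_ge0 // subr_ge0 ltW.
  by rewrite mul1r; case: (eqVneq i j) => [<- //|ne]; rewrite z ?bspline_ge0 //; lia.
have [kj|jk] := ltnP k j.
  exists 1, (Num.min 1 (s k.+1 - s k)); split=> //.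
    by rewrite lt_min ltr01 subr_gt0 skk ge_min lexx.
  move=> x /andP[ix]; rewrite addr_minr lt_min sik subrKC => /andP[_ xk].
  rewrite (@bspline_supp d.+1 j); last by left; exact: lt_le_trans xk (mono _ _ kj).
  split=> [|_]; first by rewrite mul1r bspline_ge0.
  by rewrite mul1r mulr_ge0 ?bspline_ge0 // subr_ge0 -sik ltW.
have [ei|ni] := eqVneq i j.
  exists 1, 1; rewrite ltr01 lexx; split=> // x _; rewrite ei mul1r; split=> //.
  by rewrite ltnn.
have sj : s j = s i.
  by apply/eqP; rewrite eq_le (mono _ _ ij) andbT sik mono.
have si1 : s i.+1 = s i.
  by apply/eqP; rewrite eq_le sS andbT -sj mono //; lia.
have k1 : (i.+1 <= k <= i.+1 + d)%N by lia.
have s1k : s i.+1 = s k by rewrite si1.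
have ij1 : (i.+1 <= j)%N by lia.
have [K1 [h1 [K10 /andP[h10 h11] H1]]] := IH i.+1 j s1k k1 ij1.
have [K2 [h2 [K20 /andP[h20 h21] H2]]] := IH i.+1 j.+1 s1k k1 (leqW ij1).
pose c := (s (j + d.+1)%N - s j)^-1.
have c0 : 0 <= c by rewrite invr_ge0 subr_ge0 mono // leq_addr.
pose h := Num.min (Num.min h1 h2) ((s k.+1 - s k) / 2).
have hpos : 0 < h.
  by rewrite /h !lt_min h10 h20 divr_gt0 // subr_gt0.
(* [c * K1] bounds the first term of [B d.+1 j] and [K2] the second one; the
   factor 2 makes up for the half lost between [B d i.+1] and [B d.+1 i]. *)
exists ((c * K1 + K2) * 2), h; split.
- by rewrite mulr_ge0 // addr_ge0 // mulr_ge0.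
- by rewrite hpos /h !ge_min h11.
move=> x /andP[ix]; rewrite /h !addr_minr !lt_min => /andP[/andP[xh1 xh2] xk].
have xi : 0 < x - s i by rewrite subr_gt0.
have xi1 : x - s i <= 1 by lra.
have xk1 : x < s k.+1 by move: skk xk; rewrite -sik => skk xk; lra.
have b1 : B d i.+1 x <= 2 * B d.+1 i x.
  rewrite /= mulrDr; apply: le_trans (_ : _ <= 2 * ((s (i + d.+2)%N - x) / (s (i + d.+2)%N - s i.+1) * B d i.+1 x)) _; last first.
    rewrite lerDr; apply: mulr_ge0 => //; apply: mulr_ge0; last exact: bspline_ge0.
    by apply: divr_ge0; rewrite subr_ge0 ?(ltW ix) // mono // leq_addr.
  rewrite mulrA; apply: ler_peMl; first exact: bspline_ge0.
  have hs : s k.+1 <= s (i + d.+2)%N by apply: mono; rewrite addnS ltnS.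
  rewrite si1 mulrA ler_pdivlMr; last by lra.
  by move: skk xk; rewrite -sik => skk xk; lra.
have e1 : B d.+1 j x = c * (x - s i) * B d j x +
   (s (j + d.+2)%N - x) / (s (j + d.+2)%N - s j.+1) * B d j.+1 x.
  by rewrite /= sj /c sj; congr (_ + _); ring.
have [A1 _] := H1 x ltac:(by rewrite si1 ix).
have [_ A2] := H2 x ltac:(by rewrite si1 ix).
have {}A2 := A2 ij1; rewrite si1 in A2.
have b2 : (s (j + d.+2)%N - x) / (s (j + d.+2)%N - s j.+1) * B d j.+1 x <= B d j.+1 x.
  have [kj|kj] := ltnP k j.+1.
    by rewrite bspline_supp ?mulr0 //; left; exact: lt_le_trans xk1 (mono _ _ kj).
  have sj1 : s j.+1 = s i.
    by apply/eqP; rewrite eq_le {1}sik !mono // (leq_trans ij) // leqnSn.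
  apply: ler_piMl; first exact: bspline_ge0.
  rewrite sj1; have [e|ne] := eqVneq (s (j + d.+2)%N) (s i).
    by rewrite e subrr invr0 mulr0.
  have : s i < s (j + d.+2)%N by rewrite lt_neqAle eq_sym ne mono // (leq_trans ij) // leq_addr.
  by move=> hh; rewrite ler_pdivrMr ?subr_gt0 // mul1r lerD2l lerN2 ltW.
have main : B d.+1 j x <= (c * K1 + K2) * 2 * (x - s i) * B d.+1 i x.
  rewrite e1.
  have t1 : c * (x - s i) * B d j x <= c * (x - s i) * (K1 * B d i.+1 x).
    by apply: ler_wpM2l => //; rewrite mulr_ge0 // ltW.
  have t3 : c * (x - s i) * (K1 * B d i.+1 x) + K2 * (x - s i) * B d i.+1 x
      <= (c * K1 + K2) * (x - s i) * (2 * B d.+1 i x).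
    rewrite -subr_ge0 [leRHS](_ : _ = (c * K1 + K2) * (x - s i) * (2 * B d.+1 i x - B d i.+1 x)); last by ring.
    rewrite mulr_ge0 // ?subr_ge0 //; apply: mulr_ge0; last exact: ltW.
    by rewrite addr_ge0 // mulr_ge0.
  apply: le_trans (lerD t1 (le_trans b2 A2)) _; apply: le_trans t3 _.
  by rewrite -subr_ge0 [leRHS](_ : _ = 0) //; ring.
split; last by move=> _; exact: main.
apply: le_trans main _.
rewrite ler_wpM2r ?bspline_ge0 // ler_piMr //.
by rewrite mulr_ge0 // addr_ge0 // mulr_ge0.
Qed.

Lemma last_copy i n : s i < s (i + n)%N ->
  exists k, [/\ (i <= k < i + n)%N, s k = s i & s k < s k.+1].
Proof.
elim: n => [|n IH]; first by rewrite addn0 ltxx.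
have [h|h] := ltP (s i) (s (i + n)%N).
  have [k [/andP[ik kn] e l]] := IH h; exists k; split=> //; lia.
have e : s (i + n)%N = s i.
  by apply/eqP; rewrite eq_le h knots_mono // leq_addr.
by rewrite addnS -{1}e => hl; exists (i + n)%N; split=> //; lia.
Qed.

Lemma bspline_dominates d i j : (i < j)%N -> s i < s (i + d.+1)%N ->
  dominates (s i) (B d i) (B d j).
Proof.
move=> ij hi e e0; have mono := knots_mono sS.
have [k [/andP[ik kd] sk skk]] := last_copy hi.
have kd' : (i <= k <= i + d)%N by lia.
have [K [h [K0 /andP[h0 _] H]]] := bspline_growth kd' (esym sk) skk (ltnW ij).
have K1 : 0 < K + 1 by lra.
exists (Num.min (s k.+1 - s i) (Num.min h (e / (K + 1)))); split.
- by rewrite !lt_min subr_gt0 -sk skk h0 divr_gt0.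
- move=> x /andP[ix]; rewrite addr_minr lt_min subrKC => /andP[xk _].
  by apply: (bspline_gt0 kd'); rewrite sk ix.
move=> x; rewrite !addr_minr !lt_min => /and3P[_ xh xe].
have [ix|] := ltP (s i) x.
  have [_ /(_ ij) hx] := H x ltac:(by rewrite ix).
  apply: le_trans hx _; rewrite ler_wpM2r ?bspline_ge0 //.
  rewrite -ltrBlDl ltr_pdivlMr // in xe.
  have : 0 < x - s i by rewrite subr_gt0.
  nra.
rewrite le_eqVlt => /predU1P[->|xi]; last first.
  rewrite !bspline_supp ?mulr0 //; left => //.
  by apply: lt_le_trans xi _; apply: mono; exact: ltnW.
rewrite bspline_start ?mulr_ge0 ?bspline_ge0 ?(ltW e0) //; first by apply: mono; exact: ltnW.
by apply: lt_le_trans hi _; apply: mono; lia.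
Qed.

End Monotone.

(** Boehm's coefficients; a vanishing denominator occurs only in front of a
    vanishing spline. *)
Definition left_weight r l d i : R :=
  if (l <= i)%N then 0 else if (i + d.+1 < l)%N then 1
  else (r l - r i) / (r (i + d.+1)%N - r i).

Definition right_weight r l d i : R :=
  if (l <= i)%N then 1 else if (i + d.+1 < l)%N then 0
  else (r (i + d.+2)%N - r l) / (r (i + d.+2)%N - r i.+1).

Section BoehmWeights.
(** The induction step of Boehm's formula as identities between knots. The
    knots [p0], [p1], [p2] and [q0], [q1], [q2] are the first and the last ones
    of three consecutive splines [B0], [B1], [B2], and [z] is the new knot; it
    may be well inside of the support, or next to one of its ends. *)
Variables (p0 p1 p2 q0 q1 q2 z x B0 B1 B2 : R).
Hypotheses (p01 : p0 <= p1) (p12 : p1 <= p2) (pq0 : p0 <= q0).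
Hypotheses (q01 : q0 <= q1) (q12 : q1 <= q2) (pq2 : p2 <= q2) (pq1 : p1 <= q1).
Hypotheses (z0 : q0 <= p0 -> B0 = 0) (z1 : q1 <= p1 -> B1 = 0) (z2 : q2 <= p2 -> B2 = 0).

Lemma boehm_inside :
  (x - p0) / (q1 - p0) * ((z - p0) / (q0 - p0) * B0 + (q1 - z) / (q1 - p1) * B1)
  + (q2 - x) / (q2 - p1) * ((z - p1) / (q1 - p1) * B1 + (q2 - z) / (q2 - p2) * B2)
  = (z - p0) / (q1 - p0) * ((x - p0) / (q0 - p0) * B0 + (q1 - x) / (q1 - p1) * B1)
  + (q2 - z) / (q2 - p1) * ((x - p1) / (q1 - p1) * B1 + (q2 - x) / (q2 - p2) * B2).
Proof.
have [h|h] := leP q1 p1; first by rewrite (z1 h); ring.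
have n1 : q1 - p0 != 0 by rewrite subr_eq0 gt_eqF // (le_lt_trans p01).
have n2 : q2 - p1 != 0 by rewrite subr_eq0 gt_eqF // (lt_le_trans h).
have n3 : q1 - p1 != 0 by rewrite subr_eq0 gt_eqF.
move: (q0 - p0)^-1 (q2 - p2)^-1 => u v.
by field; rewrite n1 n2 n3.
Qed.

Lemma boehm_first :
  (x - p0) / (q1 - p0) * ((p1 - p0) / (q0 - p0) * B0 + (q1 - p1) / (q1 - p1) * B1)
  + (q2 - x) / (q2 - p2) * B2
  = (p1 - p0) / (q1 - p0) * ((x - p0) / (q0 - p0) * B0 + (q1 - x) / (q1 - p1) * B1)
  + (q2 - p1) / (q2 - p1) * ((x - p1) / (q1 - p1) * B1 + (q2 - x) / (q2 - p2) * B2).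
Proof.
have [h|h] := leP q2 p1.
  rewrite (z2 (le_trans h p12)) (z1 (le_trans q12 h)); ring.
have n2 : q2 - p1 != 0 by rewrite subr_eq0 gt_eqF.
have [h1|h1] := leP q1 p1.
  by rewrite (z1 h1) (divff n2); ring.
have n1 : q1 - p0 != 0 by rewrite subr_eq0 gt_eqF // (le_lt_trans p01).
have n3 : q1 - p1 != 0 by rewrite subr_eq0 gt_eqF.
move: (q0 - p0)^-1 (q2 - p2)^-1 => u v.
by field; rewrite n1 n2 n3.
Qed.

Lemma boehm_last :
  (x - p0) / (q0 - p0) * B0
  + (q2 - x) / (q2 - p1) * ((q1 - p1) / (q1 - p1) * B1 + (q2 - q1) / (q2 - p2) * B2)
  = (q1 - p0) / (q1 - p0) * ((x - p0) / (q0 - p0) * B0 + (q1 - x) / (q1 - p1) * B1)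
  + (q2 - q1) / (q2 - p1) * ((x - p1) / (q1 - p1) * B1 + (q2 - x) / (q2 - p2) * B2).
Proof.
have [h|h] := leP q1 p0.
  rewrite (z0 (le_trans q01 h)) (z1 (le_trans h p01)); ring.
have n1 : q1 - p0 != 0 by rewrite subr_eq0 gt_eqF.
have [h1|h1] := leP q1 p1.
  by rewrite (z1 h1) (divff n1); ring.
have n2 : q2 - p1 != 0 by rewrite subr_eq0 gt_eqF // (lt_le_trans h1).
have n3 : q1 - p1 != 0 by rewrite subr_eq0 gt_eqF.
move: (q0 - p0)^-1 (q2 - p2)^-1 => u v.
by field; rewrite n1 n2 n3.
Qed.

End BoehmWeights.

(** Boehm's formula, by induction on the degree. In the step the new knot is
    inside of the supports of all splines involved, or next to one end, or
    outside. *)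
Lemma bspline_boehm r l d i x : (forall k, r k <= r k.+1) ->
  bspline (r \o bump l) d i x =
    left_weight r l d i * bspline r d i x + right_weight r l d i * bspline r d i.+1 x.
Proof.
move=> rS; have mono := knots_mono rS.
elim: d i => [|d IH] i.
  rewrite /left_weight /right_weight /= /bump addn1 addn2.
  have [li|il] := leqP l i; first by rewrite (leqW li) mul0r add0r mul1r.
  have [il1|il1] := ltnP i.+1 l; first by rewrite mul0r addr0 mul1r.
  have -> : l = i.+1 by lia.
  have [xi|ix] := ltP x (r i).
    by rewrite /= (leNgt _ x) (lt_le_trans xi (rS i)) /= !mulr0 addr0.
  have [x1|x1] := ltP x (r i.+1).
    rewrite /= mulr0 addr0 mulr1 (lt_le_trans x1 (rS _)) divff // subr_eq0 gt_eqF //.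
    exact: le_lt_trans ix x1.
  have [x2|x2] := ltP x (r i.+2); rewrite /= !mulr0 add0r // mulr1 divff // subr_eq0 gt_eqF //.
  exact: le_lt_trans x1 x2.
rewrite [LHS]/= !IH.
have z j : r (j + d.+1)%N <= r j -> bspline r d j x = 0.
  move=> h; apply: bspline_supp => //.
  by have [xs|xs] := ltP x (r j); [left|right; exact: le_trans xs].
have [li|il] := leqP l i.
  rewrite /left_weight /right_weight li (leqW li) !mul0r !add0r !mul1r /= /bump.
  have tl k : (l <= i + k)%N by exact: leq_trans li (leq_addr k i).
  by rewrite li (leqW li) !tl.
have F1 : (l <= i)%N = false by rewrite leqNgt il.
have e1 : (i.+1 + d.+1 = i + d.+2)%N by rewrite addSnnS.
have e2 : (i.+1 + d.+2 = i + d.+3)%N by rewrite addSnnS.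
have z2 : r (i + d.+3)%N <= r i.+2 -> bspline r d i.+2 x = 0.
  by move=> h; apply: z; rewrite !addSnnS.
have z1 : r (i + d.+2)%N <= r i.+1 -> bspline r d i.+1 x = 0.
  by move=> h; apply: z; rewrite addSnnS.
have z0 := z i.
have m0 : r i <= r i.+1 := rS i. have m1 : r i.+1 <= r i.+2 := rS i.+1.
have m2 : r (i + d.+1)%N <= r (i + d.+2)%N by apply: mono; rewrite leq_add2l.
have m3 : r (i + d.+2)%N <= r (i + d.+3)%N by apply: mono; rewrite leq_add2l.
have m4 : r i <= r (i + d.+1)%N by apply: mono; rewrite leq_addr.
have m5 : r i.+2 <= r (i + d.+3)%N by apply: mono; rewrite !addnS !ltnS ltnW // ltnS leq_addr.
have m6 : r i.+1 <= r (i + d.+2)%N by apply: mono; rewrite !addnS !ltnS ltnW // ltnS leq_addr.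
have e3 : bump l i = i by rewrite /bump F1.
rewrite /left_weight /right_weight [RHS]/= /comp F1 e1 e2 e3.
have [ir|ri] := ltnP (i + d.+2) l.
  have H1 : (i + d.+1 < l)%N by apply: ltn_trans ir; rewrite ltn_add2l.
  have H2 : (i.+1 < l)%N by apply: leq_trans H1; rewrite addnS !ltnS leq_addr.
  by rewrite /bump H1 (leqNgt l i.+1) H2 (leqNgt l (i + d.+1)) H1 (leqNgt l (i + d.+2)) ir /= !add0n !mul0r !addr0 !mul1r.
have e4 : bump l (i + d.+2) = (i + d.+3)%N by rewrite /bump ri add1n [(i + d.+3)%N]addnS.
rewrite e4; have [el|nl] := eqVneq l (i + d.+2)%N.
  have H1 : (i + d.+1 < l)%N by rewrite el ltn_add2l.
  have H2 : (i.+1 < l)%N by apply: leq_trans H1; rewrite addnS !ltnS leq_addr.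
  have e5 : bump l i.+1 = i.+1 by rewrite /bump leqNgt H2.
  have e6 : bump l (i + d.+1) = (i + d.+1)%N by rewrite /bump leqNgt H1.
  rewrite e5 e6 H1 (leqNgt l i.+1) H2 /= mul1r mul0r addr0 el.
  exact: boehm_last.
have H3 : (l <= i + d.+1)%N by rewrite -ltnS -addnS ltn_neqAle nl.
have e6 : bump l (i + d.+1) = (i + d.+2)%N by rewrite /bump H3 add1n [(i + d.+2)%N]addnS.
rewrite e6 (ltnNge _ l) H3 /=.
have [el|nl'] := eqVneq l i.+1.
  rewrite /bump el leqnn add1n mul0r add0r mul1r; exact: boehm_first.
have H2 : (i.+1 < l)%N by rewrite ltn_neqAle eq_sym nl'.
have e5 : bump l i.+1 = i.+1 by rewrite /bump leqNgt H2.
rewrite e5 (leqNgt l i.+1) H2 /=; exact: boehm_inside.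
Qed.

Lemma bspline_insertion r l d : (forall k, r k <= r k.+1) ->
  insertion_rule r l d.+1 (bspline r d) (bspline (r \o bump l) d).
Proof.
move=> rS i; have mono := knots_mono rS.
exists (left_weight r l d i), (right_weight r l d i).
rewrite /left_weight /right_weight; split.
- case: (leqP l i) => // il; case: (ltnP (i + d.+1) l) => // h.
  by rewrite divr_ge0 // subr_ge0 mono //; lia.
- case: (leqP l i) => // il; case: (ltnP (i + d.+1) l) => // h.
  by rewrite divr_ge0 // subr_ge0 mono //; lia.
- by move=> x; exact: bspline_boehm.
- split=> h; first by rewrite h.
  by rewrite h leqNgt (leq_ltn_trans (leq_addr _ _) h).
- move=> /andP[il lr]; rewrite (leqNgt l i) il ltnNge lr /= addnS; split=> h.
    rewrite mulf_eq0 invr_eq0 !subr_eq0 negb_or (gt_eqF h) andbT.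
    by rewrite lt_neqAle eq_sym mono ?andbT // ltnW.
  rewrite mulf_eq0 invr_eq0 !subr_eq0 negb_or !addnS (gt_eqF h) andbT.
  by rewrite lt_neqAle eq_sym mono ?andbT //; rewrite addnS in lr; exact: leqW.
Qed.

End BSpline.

(** * Refinement to consecutive knots *)

Section Refinement.
Context {R : realType}.
Variables (L p : nat) (s : nat -> R).
Hypothesis sS : forall k, s k <= s k.+1.
Hypothesis smult : forall j, (j + p <= L)%N -> s j < s (j + p)%N.
Hypothesis p2 : (1 < p)%N.

Let mono i j : (i <= j)%N -> s i <= s j.
Proof. exact: knots_mono. Qed.

(** What carries one spline of order [p]. Lists of indices are used because
    distinct indices may carry equal knots. *)
Definition index_list (l : seq nat) : Prop :=
  [/\ size l = p.+1, sorted ltn l & all (fun k => (k <= L)%N) l].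

Definition delete (h : nat) (l : seq nat) : seq nat := take h l ++ drop h.+1 l.

(** Splines [S] attached to the index lists satisfying [ok], for which the
    insertion of an index has a zero pattern that is read off the knots. Both
    kinds of splines are instances. *)
Definition insertable (S : seq nat -> R -> R) (ok : seq nat -> Prop) : Prop :=
  forall l h, size l = p.+2 -> sorted ltn l -> all (fun k => (k <= L)%N) l ->
    (0 < h < p.+1)%N -> ok (delete h l) ->
    [/\ ok (take p.+1 l), ok (behead l) & exists a b : R, [/\ 0 <= a, 0 <= b,
      forall x, S (delete h l) x = a * S (take p.+1 l) x + b * S (behead l) x,
      (a != 0) = (s (nth 0%N l 0) < s (nth 0%N l h)) &
      (b != 0) = (s (nth 0%N l h) < s (nth 0%N l p.+1))]].

(** The refined splines that occur in the expansion of the spline on [l] start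
    at this index: it counts the knots that are dropped before the first knot
    of [l] counted with its multiplicity in [l]. *)
Definition leading (l : seq nat) : nat :=
  #|[set k : 'I_L.+1 | (nat_of_ord k \notin l) && (s k <= s (nth 0%N l 0))]%SET|.

Lemma nth_ltn_sorted (l : seq nat) i j : sorted ltn l -> (i < j < size l)%N ->
  (nth 0%N l i < nth 0%N l j)%N.
Proof.
move=> ls /andP[ij jl].
by have := path.sorted_ltn_nth ltn_trans 0%N ls; apply => //; rewrite inE; lia.
Qed.

Lemma index_list_bounds l k : index_list l -> k \in l ->
  (nth 0%N l 0 <= k <= nth 0%N l p)%N.
Proof.
move=> [sl ls _] kl; rewrite -(nth_index 0%N kl).
have kp : (index k l <= p)%N by rewrite -ltnS -sl index_mem.
apply/andP; split.
  have [->//|n0] := eqVneq (index k l) 0%N.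
  by apply/ltnW/nth_ltn_sorted => //; rewrite sl lt0n n0.
have [->//|np] := eqVneq (index k l) p.
by apply/ltnW/nth_ltn_sorted => //; rewrite sl ltn_neqAle np kp /=.
Qed.

Lemma nth_sorted_add l i j : sorted ltn l -> (i + j < size l)%N ->
  (nth 0%N l i + j <= nth 0%N l (i + j))%N.
Proof.
move=> ls; elim: j => [|j IH] h; first by rewrite !addn0.
rewrite !addnS; apply: leq_ltn_trans (IH _) _; first by rewrite addnS in h; exact: ltnW.
by apply: nth_ltn_sorted => //; rewrite ltnSn -addnS h.
Qed.

Lemma index_list_mult l : index_list l -> s (nth 0%N l 0) < s (nth 0%N l p).
Proof.
move=> [sl ls /allP al].
have h : (nth 0%N l 0 + p <= nth 0%N l p)%N by apply: (@nth_sorted_add l 0 p) => //; rewrite sl.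
apply: lt_le_trans (smult _) (mono h).
by apply: leq_trans h _; apply: al; rewrite mem_nth // sl.
Qed.

Lemma leading_iota j : (j + p <= L)%N -> leading (iota j p.+1) = j.
Proof.
move=> jL; rewrite /leading.
have jL1 : (j <= L.+1)%N by lia.
have -> : [set k : 'I_L.+1 | (nat_of_ord k \notin iota j p.+1) && (s k <= s (nth 0%N (iota j p.+1) 0))]%SET
   = [set widen_ord jL1 i | i : 'I_j]%SET.
  apply/setP => k; rewrite inE mem_iota /= negb_and -leqNgt -ltnNge.
  apply/andP/imsetP => [[/orP[kj|jk] sk]|[i _ ->]].
  - by exists (Ordinal kj) => //; apply/val_inj.
  - have := le_lt_trans sk (smult jL); rewrite ltNge mono //; lia.
  - by rewrite /= ltn_ord /= mono // ltnW.
rewrite card_imset ?card_ord // => i i' /(congr1 val) /= e.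
exact: val_inj.
Qed.

Lemma not_iota_gap l : size l = p.+1 -> sorted ltn l ->
  l = iota (nth 0%N l 0) p.+1 \/
  exists2 k, (k < p)%N & ((nth 0%N l k).+1 < nth 0%N l k.+1)%N.
Proof.
move=> sl ls; have [/allP h|/allPn[k]] :=
  boolP (all (fun k => nth 0%N l k.+1 == (nth 0%N l k).+1) (iota 0 p)).
  left; apply: (@eq_from_nth _ 0%N); first by rewrite size_iota.
  rewrite sl => i; elim: i => [|i IH] ip; first by rewrite nth_iota // addn0.
  rewrite nth_iota // addnS -(nth_iota 0%N _ (ltnW ip)) -IH ?(ltnW ip) //.
  by apply/eqP/h; rewrite mem_iota.
rewrite mem_iota /= => kp ne; right; exists k => //.
by rewrite ltn_neqAle eq_sym ne nth_ltn_sorted // sl ltnSn.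
Qed.

(** Removing either end of [l'] gives the two lists over which the spline on
    [l] expands. *)
Lemma gap_insert l k : index_list l -> (k < p)%N ->
  ((nth 0%N l k).+1 < nth 0%N l k.+1)%N ->
  exists l', [/\ [/\ size l' = p.+2, sorted ltn l', all (fun k => (k <= L)%N) l' &
     delete k.+1 l' = l],
   [/\ nth 0%N l' 0 = nth 0%N l 0, nth 0%N l' p.+1 = nth 0%N l p &
     nth 0%N l' k.+1 = (nth 0%N l k).+1] &
   forall j, (j \in l') = (j \in l) || (j == (nth 0%N l k).+1)].
Proof.
move=> [sl ls al] kp gap.
have kl : (k < size l)%N by rewrite sl ltnS ltnW.
pose z := (nth 0%N l k).+1.
exists (take k.+1 l ++ z :: drop k.+1 l).
have st : size (take k.+1 l) = k.+1 by rewrite size_takel.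
have mem j : (j \in take k.+1 l ++ z :: drop k.+1 l) = (j \in l) || (j == z).
  by rewrite -{3}(cat_take_drop k.+1 l) !mem_cat inE; case: (j \in take _ _); case: (j == z); case: (j \in drop _ _).
split=> //; last first.
  rewrite !nth_cat st ltnn subnn /=; split=> //; first by rewrite nth_take.
  rewrite ltnNge ltnS (ltnW kp) /= (_ : (p.+1 - k.+1 = (p - k.+1).+1)%N); last by lia.
  by rewrite /= nth_drop; congr (nth _ _ _); lia.
split.
- by rewrite size_cat /= size_drop st sl; lia.
- rewrite sorted_pairwise; last exact: ltn_trans.
  rewrite pairwise_cat /= -sorted_pairwise; last exact: ltn_trans.
  rewrite -sorted_pairwise; last exact: ltn_trans.
  rewrite take_sorted // drop_sorted // !andbT /=.
  have hz j : j \in drop k.+1 l -> (z < j)%N.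
    move=> jd; apply: leq_trans gap _.
    rewrite -(nth_index 0%N jd) nth_drop.
    have : (index j (drop k.+1 l) < size l - k.+1)%N by rewrite -size_drop index_mem.
    case: (index _ _) => [|i] hi; first by rewrite addn0.
    by apply/ltnW/nth_ltn_sorted => //; lia.
  have hy j : j \in take k.+1 l -> (j < z)%N.
    move=> jt; rewrite -(nth_index 0%N jt) /z ltnS.
    have : (index j (take k.+1 l) < k.+1)%N by rewrite -[X in (_ < X)%N]st index_mem.
    move=> hi; rewrite nth_take //.
    have [->//|ne] := eqVneq (index j (take k.+1 l)) k.
    by apply/ltnW/nth_ltn_sorted => //; lia.
  apply/andP; split; last by apply/allP.
  apply/allrelP => i j it; rewrite inE => /orP[/eqP ->|jd]; first exact: hy.
  by apply: ltn_trans (hy _ it) (hz _ jd).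
- apply/allP => j; rewrite mem => /orP[/(allP al)//|/eqP ->].
  apply: leq_trans (ltnW gap) _; apply: (allP al); rewrite mem_nth // sl ltnS; exact: kp.
- rewrite /delete take_cat st ltnn subnn take0 cats0 drop_cat st ltnNge leqnSn /=.
  by rewrite subSn // subnn /= drop0 cat_take_drop.
Qed.

(** The pattern [X] is the same for all families [S]; this is what makes the
    two refinement matrices comparable. *)
Definition expansion_pattern (l : seq nat) (X : pred nat) : Prop :=
  [/\ X (leading l), forall j, X j -> (leading l <= j)%N,
      forall j, X j -> (j + p <= L)%N &
      forall S ok, insertable S ok -> ok l -> exists alpha : nat -> R,
        [/\ forall j, 0 <= alpha j, forall j, (alpha j != 0) = X j &
            forall x, S l x = \sum_(j < L.+1 - p) alpha j * S (iota j p.+1) x]].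

(** Fill one gap, and expand the two resulting lists, which have a smaller
    span. Their coefficients being nonnegative, a sum vanishes only if both
    parts do, so that the patterns are united. If the new knot lies strictly to
    the right of the first one, the list without the last index has the same
    leading index, and the list without the first index no smaller one. If the
    two knots are equal, the new index takes the place of the removed first
    one, and the list without the last index does not contribute. *)
Lemma expansion_exists l : index_list l -> exists X, expansion_pattern l X.
Proof.
have [n] := ubnP (nth 0 l p - nth 0 l 0)%N; elim: n l => // n IH l hn wl.
have [sl ls al] := wl; have ml := index_list_mult wl.
have [el|[k kp gap]] := not_iota_gap sl ls.
  set j := nth 0%N l 0 in el.
  have jL : (j + p <= L)%N.
    apply: (allP al); rewrite el mem_iota leq_addr /=; lia.
  exists (pred1 j); split.
  - by rewrite el /= leading_iota // eqxx.
  - by move=> i /eqP ->; rewrite el leading_iota.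
  - by move=> i /eqP ->.
  move=> S ok _ _; exists (fun i => (i == j)%:R); split.
  - by move=> i; rewrite ler0n.
  - by move=> i /=; rewrite pnatr_eq0; case: (i == j).
  have jn : (j < L.+1 - p)%N by lia.
  move=> x; pose T i := S (iota i p.+1) x.
  rewrite (_ : S l x = T j); last by rewrite /T -el.
  transitivity (\sum_(i < L.+1 - p) (nat_of_ord i == j)%:R * T i); last by [].
  rewrite (bigD1 (Ordinal jn)) //= eqxx mul1r big1 ?addr0 // => i ne.
  rewrite (_ : (nat_of_ord i == j) = false) ?mul0r //; apply: contraNF ne => /eqP e.
  by apply/eqP/val_inj.
have [l' [[sl' ls' al' dl'] [n0 np nk] mem]] := gap_insert wl kp gap.
set z := (nth 0%N l k).+1 in nk mem.
have ul' : uniq l' by apply: sorted_uniq ls'; [exact: ltn_trans|exact: ltnn].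
have zl : z \notin l.
  apply/negP => h; have hp : (index z l < p.+1)%N by rewrite -sl index_mem.
  have [ik|ki] := leqP (index z l) k.
    have : (z <= nth 0%N l k)%N; last by rewrite ltnn.
    rewrite -{1}(nth_index 0%N h); move: ik; rewrite leq_eqVlt => /predU1P[->//|ik].
    by apply/ltnW/nth_ltn_sorted => //; rewrite ik sl ltnS ltnW.
  have : (nth 0%N l k.+1 <= z)%N; last by rewrite leqNgt gap.
  rewrite -(nth_index 0%N h); move: ki; rewrite leq_eqVlt => /predU1P[<-//|ki].
  by apply/ltnW/nth_ltn_sorted => //; rewrite ki sl.
have h0 : (nth 0%N l 0 < z)%N.
  by rewrite -n0 -nk; apply: nth_ltn_sorted => //; rewrite sl' /= !ltnS ltnW.
have hp : (z < nth 0%N l p)%N.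
  by rewrite -np -nk; apply: nth_ltn_sorted => //; rewrite sl' !ltnS kp leqnn.
pose l0 := take p.+1 l'; pose l1 := behead l'.
have l'c : l' = nth 0%N l 0 :: l1.
  by rewrite /l1 -n0; case: (l') sl'.
have l'r : l' = rcons l0 (nth 0%N l p).
  by rewrite /l0 -np -take_nth ?sl' // take_oversize // sl'.
have mem0 j : (j \in l0) = ((j \in l) || (j == z)) && (j != nth 0%N l p).
  rewrite -mem l'r mem_rcons inE; have [->|_] := eqVneq j (nth 0%N l p); rewrite /= ?andbT //.
  by apply/negbTE; move: ul'; rewrite l'r rcons_uniq => /andP[].
have mem1 j : (j \in l1) = ((j \in l) || (j == z)) && (j != nth 0%N l 0).
  rewrite -mem l'c inE; have [->|_] := eqVneq j (nth 0%N l 0); rewrite /= ?andbT //.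
  by apply/negbTE; move: ul'; rewrite {1}l'c /= => /andP[].
have w0 : index_list l0.
  split; first by rewrite size_takel // sl'.
  - exact: take_sorted.
  - by apply/allP => j /mem_take; exact: (allP al').
have w1 : index_list l1.
  split; first by rewrite size_behead sl'.
  - by rewrite /l1 -drop1; exact: drop_sorted.
  - by apply/allP => j /mem_behead; exact: (allP al').
have n00 : nth 0%N l0 0 = nth 0%N l 0 by rewrite /l0 nth_take.
have n0p : (nth 0%N l0 p < nth 0%N l p)%N.
  by rewrite /l0 nth_take // -np; apply: nth_ltn_sorted => //; rewrite sl' !ltnSn.
have n1p : nth 0%N l1 p = nth 0%N l p by rewrite /l1 nth_behead.
have n10 : (nth 0%N l 0 < nth 0%N l1 0)%N.
  by rewrite /l1 nth_behead -n0; apply: nth_ltn_sorted => //; rewrite sl'.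
have n1z : (nth 0%N l1 0 <= z)%N.
  rewrite -nk /l1 nth_behead; move: kp; case: (k) => // k' kp.
  by apply/ltnW/nth_ltn_sorted => //; rewrite sl'; lia.
have [X0 [lead0 low0 top0 exp0]] : exists X, expansion_pattern l0 X.
  by apply: IH => //; rewrite n00; move: hn h0 hp n0p; rewrite /z; clear; lia.
have [X1 [lead1 low1 top1 exp1]] : exists X, expansion_pattern l1 X.
  by apply: IH => //; rewrite n1p; move: hn h0 hp n10; rewrite /z; clear; lia.
pose X j := ((s (nth 0%N l 0) < s z) && X0 j) || ((s z < s (nth 0%N l p)) && X1 j).
exists X.
have lz : (z <= L)%N by apply: (allP al'); rewrite mem eqxx orbT.
have ll0 : (nth 0%N l 0 <= L)%N by apply: (allP al); rewrite mem_nth // sl.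
have m0z : s (nth 0%N l 0) <= s z by apply: mono; exact: ltnW.
have mzp : s z <= s (nth 0%N l p) by apply: mono; exact: ltnW.
have m01 : s (nth 0%N l 0) <= s (nth 0%N l1 0) by apply: mono; exact: ltnW.
have m1z : s (nth 0%N l1 0) <= s z by apply: mono.
have hlead : if s (nth 0%N l 0) < s z then
    leading l0 = leading l /\ (leading l <= leading l1)%N else leading l1 = leading l.
  case: ltP => hz.
    split.
      rewrite /leading n00; apply: eq_card => j; rewrite !inE mem0.
      have [->|nz] := eqVneq (nat_of_ord j) z; first by rewrite [s z <= _]leNgt hz !andbF.
      have [->|nl] := eqVneq (nat_of_ord j) (nth 0%N l p); last by rewrite orbF andbT.
      by rewrite [s _ <= _]leNgt ml !andbF.
    apply: subset_leq_card; apply/fintype.subsetP => j; rewrite !inE mem1 => /andP[jl js].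
    rewrite (le_trans js) // andbT (negPf jl) /= negb_and.
    have [e|//] := eqVneq (nat_of_ord j) z; move: js; rewrite e leNgt hz //.
  have e0 : s z = s (nth 0%N l 0) by apply/eqP; rewrite eq_le hz.
  have e1 : s (nth 0%N l1 0) = s (nth 0%N l 0).
    by apply/eqP; rewrite eq_le m01 andbT -e0.
  pose oz := Ordinal (lz : (z < L.+1)%N); pose o0 := Ordinal (ll0 : (_ < L.+1)%N).
  rewrite /leading e1; set A := finset _ ; set B := finset _.
  have oA : o0 \in A.
    by rewrite inE /= mem1 eqxx andbF /= lexx.
  have zB : oz \in B by rewrite inE /= zl e0 lexx.
  rewrite (cardsD1 o0 A) (cardsD1 oz B) oA zB; congr (_ + _)%N.
  apply: eq_card => j; rewrite !inE mem1.
  have [->|nz] := eqVneq j oz.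
    by rewrite [RHS]/= [nat_of_ord oz]/= eqxx orbT (gtn_eqF h0) /= andbF.
  have [->|n0'] := eqVneq j o0; first by rewrite /= mem_nth ?sl.
  have z1 : (nat_of_ord j == z) = false by apply/eqP => h; case/eqP: nz; exact: val_inj.
  have z2 : (nat_of_ord j == nth 0%N l 0) = false by apply/eqP => h; case/eqP: n0'; exact: val_inj.
  by rewrite z1 z2 orbF andbT.
split.
- rewrite /X; move: hlead; case: ltP => hz; first by move=> [<- _]; rewrite lead0.
  by move=> <-; rewrite lead1 andbT (le_lt_trans hz ml).
- move=> j; rewrite /X; move: hlead; case: ltP => hz /=.
    by move=> [<- h] /orP[/low0//|/andP[_ /low1]]; exact: leq_trans.
  by move=> <- /andP[_ /low1].
- by move=> j /orP[/andP[_ /top0]|/andP[_ /top1]].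
move=> S ok ins okl.
have hk : (0 < k.+1 < p.+1)%N by rewrite !ltnS.
have [] := ins l' k.+1 sl' ls' al' hk; first by rewrite dl'.
rewrite dl' n0 np nk => ok0 ok1 [a [b [a0 b0 e ea eb]]].
have [al0 [al00 al0X al0e]] := exp0 S ok ins ok0.
have [al1 [al10 al1X al1e]] := exp1 S ok ins ok1.
exists (fun j => a * al0 j + b * al1 j); split.
- by move=> j; rewrite addr_ge0 // mulr_ge0.
- by move=> j; rewrite paddr_eq0 ?mulr_ge0 // negb_and !mulf_eq0 !negb_or ea eb al0X al1X.
move=> x; rewrite e al0e al1e !big_distrr -big_split; apply: eq_bigr => i _ /=.
by rewrite mulrDl !mulrA.
Qed.

End Refinement.

(** * Splines attached to index lists *)

(** Beyond the list the last index is repeated, so that an index list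
    determines an infinite knot sequence. *)
Definition knot_index (l : seq nat) (k : nat) : nat := nth (last 0%N l) l k.

Lemma knot_index_nth l k : (k < size l)%N -> knot_index l k = nth 0%N l k.
Proof. by move=> h; apply: set_nth_default. Qed.

Lemma knot_index_over l k : (size l <= k.+1)%N -> knot_index l k = last 0%N l.
Proof.
move=> h; rewrite /knot_index; have [kl|lk] := ltnP k (size l); last exact: nth_default.
by rewrite -[RHS]nth_last (set_nth_default 0%N) //; congr nth; lia.
Qed.

Lemma knot_index_delete l h : (h.+1 < size l)%N ->
  knot_index (delete h l) = knot_index l \o bump h.
Proof.
move=> hl; apply/funext => k; rewrite /knot_index /delete /=.
have -> : last 0%N (take h l ++ drop h.+1 l) = last 0%N l.
  rewrite -[in RHS](cat_take_drop h.+1 l) !last_cat.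
  by case: (drop h.+1 l) (size_drop h.+1 l) => [/= e|//]; lia.
rewrite nth_cat size_takel; last by lia.
rewrite /bump; have [kh|hk] := ltnP k h; first by rewrite nth_take // add0n.
by rewrite nth_drop; congr nth; lia.
Qed.

Lemma knot_index_take l n k : (k < n)%N -> (n <= size l)%N ->
  knot_index (take n l) k = knot_index l k.
Proof.
by move=> kn nl; rewrite !knot_index_nth ?nth_take // ?size_takel //; exact: leq_trans nl.
Qed.

Lemma knot_index_behead l k : (1 < size l)%N ->
  knot_index (behead l) k = knot_index l k.+1.
Proof. by case: l => [|a [|b l]]. Qed.

Lemma knot_index_iota j n k : (k < n)%N -> knot_index (iota j n) k = (j + k)%N.
Proof. by move=> kn; rewrite knot_index_nth ?size_iota // nth_iota. Qed.

Section Reindex.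
Context {R : realType}.
Implicit Types (s : nat -> R) (F G : nat -> R -> R).

Lemma spl_reindex s s' F F' G G' m i i' :
  (forall k, (k <= m.+2)%N -> s (i + k)%N = s' (i' + k)%N) ->
  (forall k, (k <= m.+1)%N -> F (i + k)%N = F' (i' + k)%N) ->
  (forall k, (k <= m.+1)%N -> G (i + k)%N = G' (i' + k)%N) ->
  spl s F G m i = spl s' F' G' m i'.
Proof.
elim: m i i' => [|m IH] i i' hs hF hG; apply/funext => x /=.
  have := hs 0%N isT; have := hs 1%N isT; have := hs 2%N isT.
  have := hF 0%N isT; have := hF 1%N isT; have := hG 0%N isT; have := hG 1%N isT.
  by rewrite !addn0 !addn1 !addn2 /hat => -> -> -> -> -> -> ->.
have e0 : spl s F G m i = spl s' F' G' m i'.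
  by apply: IH => k hk; [apply: hs|apply: hF|apply: hG]; apply: leqW.
have e1 : spl s F G m i.+1 = spl s' F' G' m i'.+1.
  by apply: IH => k hk; rewrite !addSnnS; [apply: hs|apply: hF|apply: hG].
by rewrite /next_level e0 e1 !addSnnS !hs // leqW.
Qed.

Lemma bspline_reindex s s' d i i' :
  (forall k, (k <= d.+1)%N -> s (i + k)%N = s' (i' + k)%N) ->
  bspline s d i = bspline s' d i'.
Proof.
elim: d i i' => [|d IH] i i' hs; apply/funext => x /=.
  by have := hs 0%N isT; have := hs 1%N isT; rewrite !addn0 !addn1 => -> ->.
rewrite (IH i i'); last by move=> k hk; apply: hs; apply: leqW.
rewrite (IH i.+1 i'.+1); last by move=> k hk; rewrite !addSnnS; apply: hs.
have := hs 0%N isT; have := hs 1%N isT; rewrite !addn0 !addn1 => -> ->.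
by rewrite (hs d.+1 (leqnSn _)) (hs d.+2 (leqnn _)).
Qed.

End Reindex.

Section Families.
Context {R : realType}.
Variables (L p : nat) (s : nat -> R).
Hypothesis sS : forall k, s k <= s k.+1.
Hypothesis smult : forall j, (j + p <= L)%N -> s j < s (j + p)%N.
Hypothesis p2 : (1 < p)%N.

Lemma knots_index_mono l : sorted ltn l -> forall k, s (knot_index l k) <= s (knot_index l k.+1).
Proof.
move=> ls k; apply: knots_mono => //.
have [h|h] := ltnP k.+1 (size l).
  by rewrite !knot_index_nth ?(ltnW h) //; apply/ltnW/nth_ltn_sorted => //; rewrite ltnSn.
by rewrite !knot_index_over // ltnW.
Qed.

Lemma sub_index_lists l : size l = p.+2 -> sorted ltn l -> all (fun k => (k <= L)%N) l ->
  index_list L p (take p.+1 l) /\ index_list L p (behead l).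
Proof.
move=> sl ls al; split; split.
- by rewrite size_takel // sl.
- exact: take_sorted.
- by apply/allP => j /mem_take; exact: (allP al).
- by rewrite size_behead sl.
- by rewrite -drop1; exact: drop_sorted.
- by apply/allP => j /mem_behead; exact: (allP al).
Qed.

(** The common part of the two families: an insertion rule for a function [S]
    of knot sequences yields one for index lists. *)
Lemma insertion_on_list l h (N N' : nat -> R -> R) (S : seq nat -> R -> R) :
  size l = p.+2 -> sorted ltn l -> all (fun k => (k <= L)%N) l -> (0 < h < p.+1)%N ->
  insertion_rule (s \o knot_index l) h p N N' ->
  S (delete h l) = N' 0%N -> S (take p.+1 l) = N 0%N -> S (behead l) = N 1%N ->
  exists a b : R, [/\ 0 <= a, 0 <= b,
    forall x, S (delete h l) x = a * S (take p.+1 l) x + b * S (behead l) x,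
    (a != 0) = (s (nth 0%N l 0) < s (nth 0%N l h)) &
    (b != 0) = (s (nth 0%N l h) < s (nth 0%N l p.+1))].
Proof.
move=> sl ls al /andP[h0 hp] rule -> -> ->.
have [w0 w1] := sub_index_lists sl ls al.
have [a [b [a0 b0 e _ hin]]] := rule 0%N; exists a, b.
have i0 : knot_index l 0 = nth 0%N l 0 by rewrite knot_index_nth // sl.
have ih : knot_index l h = nth 0%N l h by rewrite knot_index_nth // sl ltnW.
have ip : knot_index l p.+1 = nth 0%N l p.+1 by rewrite knot_index_nth // sl.
move: hin; rewrite add0n /= h0 -ltnS hp i0 ih ip => /(_ isT)[ha hb].
split=> //.
  apply: ha; rewrite knot_index_nth ?sl //.
  by have := index_list_mult sS smult p2 w0; rewrite !nth_take.
apply: hb; rewrite knot_index_nth ?sl //.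
by have := index_list_mult sS smult p2 w1; rewrite !nth_behead.
Qed.

Definition list_bspline (l : seq nat) : R -> R :=
  bspline (s \o knot_index l) p.-1 0.

Lemma list_bspline_insertable : insertable L p s list_bspline (fun _ => True).
Proof.
move=> l h sl ls al hh _; split=> //.
have pp : p.-1.+1 = p by rewrite prednK // ltnW.
have rule := bspline_insertion h p.-1 (knots_index_mono ls).
rewrite pp in rule.
apply: (insertion_on_list (S := list_bspline) sl ls al hh rule).
- by rewrite /list_bspline knot_index_delete // sl; lia.
- apply: bspline_reindex => k; rewrite pp !add0n /= => kp.
  by rewrite knot_index_take // sl.
- apply: bspline_reindex => k; rewrite pp /= => kp.
  by rewrite knot_index_behead ?sl.
Qed.

Lemma list_bspline_iota j : list_bspline (iota j p.+1) = bspline s p.-1 j.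
Proof.
apply: bspline_reindex => k; rewrite prednK ?(ltnW p2) // => kp.
by rewrite /comp add0n knot_index_iota.
Qed.

Variables (F G : nat -> R -> R).

Definition list_spline (l : seq nat) : R -> R :=
  spl (s \o knot_index l) (F \o knot_index l) (G \o knot_index l) (p - 2) 0.

(** One pair of functions serves all knot intervals between the indices [i] and
    [i'], so that indices can be inserted between them. *)
Definition compatible_gap (i i' : nat) : Prop :=
  (forall k, (i <= k < i')%N -> F k = F i /\ G k = G i) /\
  (s i < s i' -> chebyshev_pos (s i) (s i') (F i) (G i)).

Definition compatible_list (l : seq nat) : Prop :=
  forall k, (k.+1 < size l)%N -> compatible_gap (nth 0%N l k) (nth 0%N l k.+1).

Lemma compatible_chain l : sorted ltn l -> compatible_list l ->
  chain (s \o knot_index l) (F \o knot_index l) (G \o knot_index l).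
Proof.
move=> ls cl; split; first exact: knots_index_mono.
move=> k /=; have [h|h] := ltnP k.+1 (size l); last first.
  by rewrite !knot_index_over ?ltxx // ltnW.
by rewrite !knot_index_nth ?(ltnW h) //; exact: (cl k h).2.
Qed.

Lemma compatible_gap_split i j i' : (i < j < i')%N -> compatible_gap i i' ->
  compatible_gap i j /\ compatible_gap j i'.
Proof.
move=> /andP[ij ji] [h1 h2]; have mono := knots_mono sS.
have [Fj Gj] : F j = F i /\ G j = G i by apply: h1; rewrite ltnW.
split; split=> [k /andP[k1 k2]|lt].
- by apply: h1; rewrite k1 (ltn_trans k2).
- apply: (chebyshev_posW (lexx _) (mono _ _ (ltnW ji))).
  by apply: h2; apply: lt_le_trans lt (mono _ _ (ltnW ji)).
- by rewrite Fj Gj; apply: h1; rewrite k2 andbT (leq_trans (ltnW ij)).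
- rewrite Fj Gj; apply: (chebyshev_posW (mono _ _ (ltnW ij)) (lexx _)).
  by apply: h2; apply: le_lt_trans lt; exact: mono _ _ (ltnW ij).
Qed.

Lemma nth_delete l h k : (h < size l)%N -> nth 0%N (delete h l) k = nth 0%N l (bump h k).
Proof.
move=> hl; rewrite /delete nth_cat size_takel; last exact: ltnW.
rewrite /bump.
have [kh|hk] := ltnP k h; first by rewrite nth_take // add0n.
by rewrite nth_drop; congr nth; lia.
Qed.

(** An inserted index falls into one gap, and splits it into two compatible
    ones. *)
Lemma compatible_undelete l h : sorted ltn l -> (0 < h)%N -> (h.+1 < size l)%N ->
  compatible_list (delete h l) -> compatible_list l.
Proof.
move=> ls h0 hl cd k kl.
have sd : size (delete h l) = (size l).-1.
  by rewrite size_cat size_takel ?size_drop; lia.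
have cd' j : (j.+2 < size l)%N ->
    compatible_gap (nth 0%N l (bump h j)) (nth 0%N l (bump h j.+1)).
  by move=> jl; rewrite -!nth_delete ?(ltnW hl) //; apply: cd; rewrite sd; lia.
have [gl gr] : compatible_gap (nth 0%N l h.-1) (nth 0%N l h) /\
    compatible_gap (nth 0%N l h) (nth 0%N l h.+1).
  apply: compatible_gap_split.
    by apply/andP; split; apply: nth_ltn_sorted => //; lia.
  have := cd' h.-1; rewrite /bump prednK // leqnn (_ : (h <= h.-1)%N = false); last by lia.
  by apply; lia.
have [kh|hk] := ltnP k.+1 h.
  have := cd' k; rewrite /bump (_ : (h <= k)%N = false) 1?(_ : (h <= k.+1)%N = false); try lia.
  by apply; lia.
have [e|ne] := eqVneq k.+1 h; first by rewrite -e in gl *.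
have [e|ne'] := eqVneq k h; first by rewrite -e in gr *.
have := cd' k.-1; rewrite /bump (_ : (h <= k.-1)%N = true) 1?(_ : (h <= k.-1.+1)%N = true); try lia.
rewrite !add1n prednK; last by lia.
by apply; lia.
Qed.

Lemma list_spline_insertable : insertable L p s list_spline compatible_list.
Proof.
move=> l h sl ls al hh cd.
have hl : (h.+1 < size l)%N by rewrite sl; lia.
have [h0 hp] := andP hh.
have cl := compatible_undelete ls h0 hl cd.
have pp : (p - 2).+2 = p by lia.
split.
- move=> k; rewrite size_takel ?sl // => kp.
  by rewrite !nth_take ?(ltnW kp) //; apply: cl; rewrite sl ltnW.
- move=> k; rewrite size_behead sl /= => kp.
  by rewrite !nth_behead; apply: cl; rewrite sl.
have C := compatible_chain ls cl.
have C' : chain (s \o knot_index l \o bump h) (F \o knot_index l \o bump h) (G \o knot_index l \o bump h).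
  have := compatible_chain _ cd; rewrite knot_index_delete //; apply.
  apply: subseq_sorted ls => //; first exact: ltn_trans.
  rewrite -{2}(cat_take_drop h l) /delete; apply: cat_subseq => //.
  by rewrite -add1n -drop_drop; exact: drop_subseq.
have [Fh Gh] : F (knot_index l h) = F (knot_index l h.-1) /\ G (knot_index l h) = G (knot_index l h.-1).
  rewrite !knot_index_nth; try lia.
  have := cd h.-1; rewrite size_cat size_takel ?size_drop; last by lia.
  move=> /(_ ltac:(lia))[+ _]; rewrite !nth_delete ?(ltnW hl) // /bump prednK // leqnn.
  rewrite (_ : (h <= h.-1)%N = false); last by lia.
  rewrite add0n add1n; apply; rewrite ltnW; last by apply: nth_ltn_sorted => //; lia.
  by apply: nth_ltn_sorted => //; lia.
have rule := spl_insert (p - 2) h0 (Fh : (F \o knot_index l) h = (F \o knot_index l) h.-1)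
  (Gh : (G \o knot_index l) h = (G \o knot_index l) h.-1) C C'.
rewrite pp in rule.
apply: (insertion_on_list (S := list_spline) sl ls al hh rule).
- by rewrite /list_spline knot_index_delete.
- apply: spl_reindex => k; rewrite ?pp !add0n /= => kp; rewrite knot_index_take // ?sl //; lia.
- apply: spl_reindex => k; rewrite ?pp /= => kp; rewrite knot_index_behead ?sl //.
Qed.

Lemma list_spline_iota j : list_spline (iota j p.+1) = spl s F G (p - 2) j.
Proof.
have pp : (p - 2).+2 = p by lia.
by apply: spl_reindex => k; rewrite ?pp /comp add0n => kp; rewrite knot_index_iota //; lia.
Qed.

End Families.

(** * Linear independence from domination *)

Section Independence.
Context {R : realType}.

Lemma dominates_all (a : R) (f : nat -> R -> R) i m e : 0 < e ->
  (forall j, (i < j)%N -> dominates a (f i) (f j)) ->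
  exists2 x, 0 < f i x & forall j, (i < j < m)%N -> f j x <= e * f i x.
Proof.
move=> e0 D.
suff [h [h0 hp hd]] : exists h, [/\ 0 < h, forall x, a < x < a + h -> 0 < f i x &
    forall j x, (i < j < m)%N -> x < a + h -> f j x <= e * f i x].
  exists (a + h / 2); first by apply: hp; lra.
  by move=> j ij; apply: hd => //; lra.
elim: m => [|m [h [h0 hp hd]]].
  have [h [h0 hp _]] := D _ (ltnSn i) _ e0; exists h; split=> // j x; lia.
have [im|mi] := ltnP i m; last first.
  by exists h; split=> // j x ij; apply: hd; lia.
have [h' [h'0 _ hd']] := D _ im _ e0.
exists (Num.min h h'); split; first by rewrite lt_min h0.
  by move=> x /andP[ax]; rewrite addr_minr lt_min => /andP[xh _]; apply: hp; rewrite ax.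
move=> j x ij; rewrite addr_minr lt_min => /andP[xh xh'].
have [->|ne] := eqVneq j m; first exact: hd'.
by apply: hd => //; lia.
Qed.

(** The function with the first nonzero coefficient would outweigh the rest of
    the sum near its left end. *)
Lemma dominated_free n (a : nat -> R) (f : nat -> R -> R) (c : nat -> R) :
  (forall j x, 0 <= f j x) ->
  (forall i j, (i < n)%N -> (i < j)%N -> dominates (a i) (f i) (f j)) ->
  (forall x, \sum_(i < n) c i * f i x = 0) -> forall i, (i < n)%N -> c i = 0.
Proof.
move=> f0 D h0; suff H m : (m <= n)%N -> forall i, (i < m)%N -> c i = 0 by exact: H.
elim: m => // m IH mn i; rewrite ltnS leq_eqVlt => /predU1P[->{i}|im]; last first.
  by apply: IH => //; exact: ltnW.
apply/eqP; apply: contraT => cm.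
pose T := \sum_(j < n) `|c j|.
have T0 : 0 <= T by rewrite sumr_ge0.
(* With this factor of domination the later terms add up to less than the one
   of index [m]. *)
have e0 : 0 < `|c m| / (T + 1) by rewrite divr_gt0 ?normr_gt0 // ltr_wpDl.
have [x fx hx] := dominates_all n e0 (D m ^~ mn).
have := h0 x; rewrite (bigD1 (Ordinal mn)) //= => /eqP; rewrite addr_eq0 => /eqP e.
have : `|c m| * f m x <= T * (`|c m| / (T + 1) * f m x).
  rewrite -[f m x in leLHS]ger0_norm // -normrM e normrN.
  apply: le_trans (ler_norm_sum _ _ _) _.
  rewrite /T big_distrl (bigD1 (Ordinal mn) (P := xpredT)) //=.
  apply: ler_wpDl; first by rewrite mulr_ge0 // mulr_ge0 // ltW.
  apply: ler_sum => j ne; rewrite normrM.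
  have [jm|mj] := ltnP j m.
    by rewrite (IH (ltnW mn) _ jm) normr0 !mul0r.
  rewrite ler_wpM2l // ger0_norm //; apply: hx; rewrite ltn_ord andbT ltn_neqAle mj andbT.
  by apply: contraNN ne => /eqP e1; apply/eqP/val_inj.
rewrite mulrA ler_pM2r // leNgt => /negP []; rewrite mulrCA -ltr_pdivlMl ?normr_gt0 // mulVf ?normr_eq0 //.
by rewrite ltr_pdivrMr ?mul1r ?ltrDl // ltr_wpDl.
Qed.

End Independence.

(** * From admissible pairs to positive kernels *)

Section Generators.
Context {R : realType}.
Implicit Types (f g u v : R -> R) (a b x : R).

Lemma within_itv_proper a b x : a < b -> x \in `[a, b] ->
  ProperFilter (within `[a, b]%classic x^').
Proof.
move=> ab; rewrite in_itv /= => /andP[ax xb].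
apply: Build_ProperFilter_ex => P.
rewrite /within /= => /nbhs_ballP[e /= e0 he].
have [xlb|bx] := ltP x b.
  pose y := x + Num.min e (b - x) / 2.
  have m0 : 0 < Num.min e (b - x) by rewrite lt_min e0 subr_gt0.
  have me : Num.min e (b - x) <= e by rewrite ge_min lexx.
  have mb : Num.min e (b - x) <= b - x by rewrite ge_min lexx orbT.
  exists y; apply: (he y).
  - by rewrite -ball_normE /= /y distrC addrAC subrr add0r gtr0_norm; lra.
  - by rewrite /y; apply/eqP; lra.
  - by rewrite /= in_itv /= /y; lra.
have ex : x = b by apply/eqP; rewrite eq_le xb bx.
pose y := x - Num.min e (b - a) / 2.
have m0 : 0 < Num.min e (b - a) by rewrite lt_min e0 subr_gt0.
have me : Num.min e (b - a) <= e by rewrite ge_min lexx.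
have mb : Num.min e (b - a) <= b - a by rewrite ge_min lexx orbT.
exists y; apply: (he y).
- by rewrite -ball_normE /= /y opprB addrC subrK gtr0_norm; lra.
- by rewrite /y; apply/eqP; lra.
- by rewrite /= in_itv /= /y; lra.
Qed.

(** A limit within [D] is also the limit within the smaller interval, because
    [x] is a limit point of the latter. *)
Lemma deriv_on_restrict (D : set R) a b f g x : a < b -> `[a, b] `<=` D ->
  (forall y, a <= y <= b -> f y = g y) -> x \in `[a, b] ->
  cvg (diff_quot g x @ within D x^') ->
  deriv_on `[a, b] f x = deriv_on D g x.
Proof.
move=> ab sD fg xab cg; rewrite /deriv_on.
have PF := within_itv_proper ab xab.
apply: cvg_lim => //; apply: cvg_trans cg.
apply: cvg_trans (_ : diff_quot g x @ within `[a, b] x^' `=>` _).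
  apply: near_eq_cvg; rewrite near_withinE; near=> y => yab.
  by rewrite /diff_quot !fg.
move=> P /=; rewrite /nbhs /= /within /=; apply: filterS => y h /sD; exact: h.
Unshelve. all: by end_near.
Qed.

Lemma derivn_on_restrict a b a' b' f g n :
  a < b -> a' <= a -> b <= b' -> (forall y, a <= y <= b -> f y = g y) ->
  (forall k, (k < n)%N -> forall x, `[a', b']%classic x ->
     cvg (diff_quot (derivn_on `[a', b'] k g) x @ within `[a', b'] x^')) ->
  forall x, a <= x <= b -> derivn_on `[a, b] n f x = derivn_on `[a', b'] n g x.
Proof.
move=> ab aa bb fg; have sD : `[a, b]%classic `<=` `[a', b'].
  move=> y /=; rewrite !in_itv /= => /andP[ay yb].
  by rewrite (le_trans aa ay) (le_trans yb bb).
elim: n => [|n IH] hc x xab; first exact: fg.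
have xab' : x \in `[a, b] by rewrite in_itv.
rewrite /derivn_on !iterS; apply: deriv_on_restrict => //.
  by move=> y yab; apply: IH => // k kn; apply: hc; exact: ltnW.
by apply: hc => //; exact: sD.
Qed.

(** A zero determinant gives a nontrivial combination of [f] and [g] that
    vanishes at both points. *)
Lemma chebyshev2_det (D : set R) f g x y : chebyshev2 D f g ->
  D x -> D y -> x != y -> det f g x y != 0.
Proof.
move=> [free zeros] Dx Dy xy; apply/eqP => d0.
have vanish c d : c * f x + d * g x = 0 -> c * f y + d * g y = 0 -> c = 0 /\ d = 0.
  move=> hx hy; apply: free => z Dz; apply/eqP; apply: contraT => nz.
  have := zeros (fun t => c * f t + d * g t) (ex_intro _ c (ex_intro _ d erefl))
    (ex_intro2 _ _ z Dz nz) x y Dx Dy hx hy.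
  by move/eqP; rewrite (negPf xy).
have [gx fx] := vanish (- g x) (f x) ltac:(ring) ltac:(rewrite -[RHS]d0 /det; ring).
have [gy fy] := vanish (g y) (- f y) ltac:(rewrite -[RHS]d0 /det; ring) ltac:(ring).
have [] := vanish 1 0; rewrite ?mul0r ?addr0 ?mul1r //.
  by move/eqP: fy; rewrite oppr_eq0 => /eqP.
by move/eqP; rewrite oner_eq0.
Qed.

Lemma nonvanishing_pos a b (w : R -> R) : a <= b -> {within `[a, b], continuous w} ->
  (forall x, a <= x <= b -> w x != 0) -> (0 < w a) = (0 < w b).
Proof.
move=> ab cw nz.
have na : w a != 0 by rewrite nz // lexx.
have nb : w b != 0 by rewrite nz // lexx ab.
have hz : ~ (Num.min (w a) (w b) <= 0 <= Num.max (w a) (w b)).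
  move=> h; have [c] := IVT ab cw h; rewrite in_itv /= => /nz.
  by move=> /[swap] ->; rewrite eqxx.
apply/idP/idP => h; rewrite ltNge; apply/negP => h'; apply: hz.
  by rewrite ge_min le_max h' orbT ltW.
by rewrite ge_min le_max h' (ltW h) orbT.
Qed.

(** The sign makes the determinant positive, and changes neither the span nor
    the normalized generators. *)
Definition orient a b f g : R -> R := fun x => Num.sg (det f g a b) * f x.

Lemma det_orient a b f g x y :
  det (orient a b f g) g x y = Num.sg (det f g a b) * det f g x y.
Proof. by rewrite /det /orient; ring. Qed.

(** The determinant is continuous, and nonzero off the diagonal; moving one
    point at a time from [(a, b)] to [(x, y)] keeps its sign. *)
Lemma chebyshev2_pos a b f g : a < b -> {within `[a, b], continuous f} ->
  {within `[a, b], continuous g} -> chebyshev2 `[a, b] f g ->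
  chebyshev_pos a b (orient a b f g) g.
Proof.
move=> ab cf cg ch.
have cf' : {within `[a, b], continuous (orient a b f g)}.
  have -> : orient a b f g = fun x => Num.sg (det f g a b) * f x + 0 * g x.
    by apply/funext => x; rewrite mul0r addr0.
  exact: comb_continuous.
have nz x y : a <= x <= b -> a <= y <= b -> x != y ->
    det (orient a b f g) g x y != 0.
  move=> xab yab xy; rewrite det_orient mulf_neq0 ?sgr_eq0 //.
    by apply: (chebyshev2_det ch); rewrite /= ?in_itv /= ?lexx ?(ltW ab) // lt_eqF.
  by apply: (chebyshev2_det ch); rewrite /= ?in_itv /=.
have p0 : 0 < det (orient a b f g) g a b.
  rewrite det_orient -normrEsg normr_gt0.
  by apply: (chebyshev2_det ch); rewrite /= ?in_itv /= ?lexx ?(ltW ab) // lt_eqF.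
move: cf' nz p0; move: (orient a b f g) => h ch' nz p0; split=> // x y ax xy yb.
have ay : a < y := le_lt_trans ax xy.
have sub c d : a <= c -> d <= b -> `[c, d]%classic `<=` `[a, b]%classic.
  move=> ac db z /=; rewrite !in_itv /= => /andP[cz zd].
  by rewrite (le_trans ac cz) (le_trans zd db).
have d1 : 0 < det h g a y.
  rewrite (@nonvanishing_pos y b (det h g a)) //.
  - apply: (continuous_subspaceW (sub y b (ltW ay) (lexx b))).
    have -> : det h g a = fun x => (- g a) * h x + h a * g x.
      by apply/funext => z; rewrite /det; ring.
    exact: comb_continuous.
  - move=> z /andP[yz zb]; apply: nz; rewrite ?lexx ?(ltW ab) //.
      by rewrite zb (le_trans (ltW ay)).
    by rewrite lt_eqF // (lt_le_trans ay).
rewrite -(@nonvanishing_pos a x (fun z => det h g z y)) //.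
- apply: (continuous_subspaceW (sub a x (lexx a) (le_trans (ltW xy) yb))).
  have -> : (fun z => det h g z y) = fun x => g y * h x + (- h y) * g x.
    by apply/funext => z; rewrite /det; ring.
  exact: comb_continuous.
- move=> z /andP[az zx]; apply: nz; rewrite ?az ?(ltW ay) ?(le_trans zx) //.
    exact: le_trans (ltW xy) yb.
  by rewrite lt_eqF // (le_lt_trans zx).
Qed.

(** Cramer's rule: a combination of [f] and [g] is determined by its values at
    two points with nonzero determinant. *)
Lemma two_point_interpolation (al be : R) f g a b x :
  (al * f x + be * g x) * det f g a b =
  (al * f a + be * g a) * det f g x b + (al * f b + be * g b) * det f g a x.
Proof. by rewrite /det; ring. Qed.

Lemma span2_l f g : span2 f g f.
Proof. by exists 1, 0; apply/funext => x; rewrite mul1r mul0r addr0. Qed.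

Lemma span2_r f g : span2 f g g.
Proof. by exists 0, 1; apply/funext => x; rewrite mul1r mul0r add0r. Qed.

Lemma generators_exist f g a b : det f g a b != 0 ->
  exists UV, is_generators (span2 f g) a b UV.
Proof.
move=> d0; pose e := Num.sg (det f g a b).
have ed : 0 < e * det f g a b by rewrite -normrEsg normr_gt0.
have e0 : e != 0 by rewrite sgr_eq0.
exists (fun x => e * det f g x b, fun x => e * det f g a x); split => /=.
- apply/seteqP; split=> w /= [c [d ->]].
    exists (e * (c * g b - d * g a)), (e * (d * f a - c * f b)).
    by apply/funext => x; rewrite /det; ring.
  exists ((c * f a + d * g a) / (e * det f g a b)), ((c * f b + d * g b) / (e * det f g a b)).
  apply/funext => x; apply: (mulIf d0); rewrite two_point_interpolation.
  by field; rewrite d0 e0.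
- by rewrite det_self mulr0.
- by rewrite det_self mulr0.
Qed.

(** A generator that vanishes at one end is determined up to a factor, which
    the normalization removes; and derivatives relative to the two intervals
    agree on the smaller one. *)
Lemma generators_normalized (p : nat) a b a' b' u v u' v' x :
  a < b -> a' <= a -> b <= b' -> admissible_pair p a' b' u v ->
  (forall y, a' <= y <= b' -> u' y = u y /\ v' y = v y) ->
  a <= x <= b ->
  let f := derivn_on `[a', b'] (p - 2) u in
  let g := derivn_on `[a', b'] (p - 2) v in
  let UV := generators p a b u' v' in
  UV.1 x / UV.1 a = falling a b f g x /\ UV.2 x / UV.2 b = rising a b f g x.
Proof.
move=> ab aa bb [[_ cu] [_ cv] ch] uv xab f g UV.
have ab' : a' <= a <= b' by rewrite aa (le_trans (ltW ab) bb).
have bb' : a' <= b <= b' by rewrite bb (le_trans aa (ltW ab)).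
have sub y : a <= y <= b -> a' <= y <= b'.
  by move=> /andP[ay yb]; rewrite (le_trans aa ay) (le_trans yb bb).
pose f1 := derivn_on `[a, b] (p - 2) u'; pose g1 := derivn_on `[a, b] (p - 2) v'.
have fE y : a <= y <= b -> f1 y = f y.
  by apply: derivn_on_restrict => // z /sub /uv[].
have gE y : a <= y <= b -> g1 y = g y.
  by apply: derivn_on_restrict => // z /sub /uv[].
have aab : a <= a <= b by rewrite lexx ltW.
have bab : a <= b <= b by rewrite lexx ltW.
have d0 : det f g a b != 0.
  by apply: (@chebyshev2_det `[a', b']%classic f g a b ch); rewrite /= ?in_itv /= ?lt_eqF.
have d1 : det f1 g1 a b != 0 by rewrite /det !fE // !gE.
have [hW [Ua Ub] [Va Vb]] : is_generators (span2 f1 g1) a b UV.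
  by rewrite /UV /generators; apply: xgetPex; exact: generators_exist.
have [c1 [c2 eU]] : span2 f1 g1 UV.1 by rewrite -hW; exact: span2_l.
have [e1 [e2 eV]] : span2 f1 g1 UV.2 by rewrite -hW; exact: span2_r.
have eU' y : a <= y <= b -> UV.1 y = c1 * f y + c2 * g y by move=> h; rewrite eU fE // gE.
have eV' y : a <= y <= b -> UV.2 y = e1 * f y + e2 * g y by move=> h; rewrite eV fE // gE.
have := two_point_interpolation c1 c2 f g a b x; rewrite -!eU' // Ub mul0r addr0 => h1.
have := two_point_interpolation e1 e2 f g a b x; rewrite -!eV' // Va mul0r add0r => h2.
rewrite /falling /rising; split.
  by apply: (mulIf d0); rewrite divfK // mulrAC h1 mulrC mulKf // gt_eqF.
by apply: (mulIf d0); rewrite divfK // mulrAC h2 mulrC mulKf // gt_eqF.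
Qed.

End Generators.

(** * Lines of an index mesh *)

Section MeshTheory.
Context {R : realType}.
Implicit Types (M : set block) (i j k x y : int).

(** The index domain has arbitrary bounds here, so that a transposed mesh is
    again of this form. *)
Definition mesh (a b c d : int) M : Prop :=
  [/\ forall A, M A -> exists i i' j j' : int, [/\ i < i', j < j' & A = (Iv i i', Iv j j')],
      trivIset M (@block_set R)
    & \bigcup_(A in M) block_closed A =
        `[(a%:~R : R), b%:~R] `*` `[(c%:~R : R), d%:~R]].

Definition transpose (A : block) : block := (A.2, A.1).
Definition transpose_mesh M : set block := [set A | M (transpose A)].

Lemma transposeK A : transpose (transpose A) = A. Proof. by case: A. Qed.

Lemma transpose_meshK M : transpose_mesh (transpose_mesh M) = M.
Proof. by apply/seteqP; split=> A; rewrite /transpose_mesh /= transposeK. Qed.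

Lemma block_set_transpose A (z : R * R) :
  block_set (transpose A) z = block_set A (z.2, z.1).
Proof. by rewrite propeqE; split=> -[]. Qed.

Lemma mesh_transpose a b c d M : mesh a b c d M -> mesh c d a b (transpose_mesh M).
Proof.
move=> [h1 h2 h3]; split.
- move=> A /h1[i [i' [j [j' [ii jj e]]]]]; exists j, j', i, i'; split=> //.
  by rewrite -(transposeK A) e.
- move=> A B MA MB [z []]; rewrite -(transposeK A) -(transposeK B) (block_set_transpose (transpose A)).
  by rewrite (block_set_transpose (transpose B)) => zA zB;
    congr transpose; apply: (h2 _ _ MA MB); exists (z.2, z.1).
- apply/seteqP; split=> z.
    move=> [A MA [z1 z2]]; have : (\bigcup_(A in M) block_closed A) (z.2, z.1).
      by exists (transpose A) => //; split.
    by rewrite h3 => -[].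
  move=> [z1 z2]; have : (\bigcup_(A in M) block_closed A) (z.2, z.1) by rewrite h3.
  by move=> [A MA [zA zB]]; exists (transpose A); [rewrite /transpose_mesh /= transposeK|split].
Qed.

Definition cell M i i' j j' : Prop := M (Iv i i', Iv j j').

(** Integer end points compare with the middle of a unit interval as with any
    of its inner points; this turns statements on real sets into statements on
    integers. *)
Definition midpt x : R := x%:~R + 2^-1.

Lemma midpt_in i i' x : (i%:~R < midpt x < (i'%:~R : R)) = (i <= x < i').
Proof.
rewrite /midpt; apply/andP/andP => -[h1 h2].
  split.
    by rewrite -ltzD1 -(ltr_int R) intrD; move: h1; rewrite /=; lra.
  by rewrite -(ltr_int R); lra.
have {}h1 : (i%:~R : R) <= x%:~R by rewrite ler_int.
have : ((x + 1)%:~R : R) <= i'%:~R by rewrite ler_int lezD1.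
by rewrite intrD /= => h3; split; lra.
Qed.

Lemma midpt_in_closed i i' x : (i%:~R <= midpt x <= (i'%:~R : R)) = (i <= x < i').
Proof.
apply/idP/idP; last by rewrite -midpt_in => /andP[/ltW -> /ltW ->].
rewrite /midpt => /andP[h1 h2]; apply/andP; split.
  by rewrite -ltzD1 -(ltr_int R) intrD /=; lra.
by rewrite -(ltr_int R); lra.
Qed.

Lemma midpt_neq x i : midpt x <> (i%:~R : R).
Proof.
move=> e; have := midpt_in i (i + 1) x.
have := midpt_in_closed i i x; rewrite e !lexx /= => h.
by move: h => /esym; lia.
Qed.

Lemma side_set_midpt i i' x : side_set (Iv i i') (midpt x) = (i <= x < i') :> Prop.
Proof. by rewrite -midpt_in /side_set /= in_itv. Qed.

Section Fixed.
Variables (a b c d : int) (M : set block).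
Hypotheses (ab : a < b) (cd : c < d) (MM : mesh a b c d M).

Lemma cell_bounds i i' j j' : cell M i i' j j' ->
  [/\ i < i', j < j', a <= i, i' <= b & (c <= j) && (j' <= d)].
Proof.
move=> C; case: MM => h1 _ h3.
have [i1 [i2 [j1 [j2 [ii jj [e1 e2 e3 e4]]]]]] := h1 _ C.
rewrite -{}e1 -{}e2 in ii; rewrite -{}e3 -{}e4 in jj.
have li : (i%:~R : R) <= i'%:~R by rewrite ler_int ltW.
have lj : (j%:~R : R) <= j'%:~R by rewrite ler_int ltW.
have : (\bigcup_(A in M) @block_closed R A) (i%:~R, j%:~R).
  by exists (Iv i i', Iv j j') => //; split; rewrite /= in_itv /= lexx.
have : (\bigcup_(A in M) @block_closed R A) (i'%:~R, j'%:~R).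
  by exists (Iv i i', Iv j j') => //; split; rewrite /= in_itv /= lexx andbT.
rewrite h3 => -[]; rewrite /= !in_itv /= !ler_int => /andP[_ i'b] /andP[_ j'd].
by move=> -[/andP[ai _] /andP[cj _]]; split=> //; apply/andP.
Qed.

Lemma cell_at x y : a <= x < b -> c <= y < d ->
  exists i i' j j', [/\ cell M i i' j j', i <= x < i' & j <= y < j'].
Proof.
move=> xab ycd; case: MM => h1 _ h3.
have : (\bigcup_(A in M) @block_closed R A) (midpt x, midpt y).
  by rewrite h3; split; rewrite /= in_itv /= midpt_in_closed.
move=> [A MA]; have [i [i' [j [j' [_ _ e]]]]] := h1 _ MA; rewrite e in MA *.
move=> []; rewrite /= !in_itv /= !midpt_in_closed => hx hy.
by exists i, i', j, j'.
Qed.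

Lemma cell_uniq x y i i' j j' k k' l l' : cell M i i' j j' -> cell M k k' l l' ->
  i <= x < i' -> j <= y < j' -> k <= x < k' -> l <= y < l' ->
  [/\ i = k, i' = k', j = l & j' = l'].
Proof.
move=> C1 C2 h1 h2 h3 h4; case: MM => _ h _.
have [] : (Iv i i', Iv j j') = (Iv k k', Iv l l') by
  apply: (h _ _ C1 C2); exists (midpt x, midpt y); split; split; rewrite /= in_itv /= midpt_in.
by [].
Qed.

(** The vertical unit segment from [(k, y)] to [(k, y + 1)] is on the lines of
    the mesh. *)
Definition vunit k y : Prop :=
  forall i i' j j', cell M i i' j j' -> j <= y < j' -> ~ (i < k < i').

Definition hunit x k : Prop :=
  forall i i' j j', cell M i i' j j' -> i <= x < i' -> ~ (j < k < j').

Lemma vertices_bounds v : vertices M v -> (a <= v.1 <= b) && (c <= v.2 <= d).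
Proof.
move=> [A MA]; case: MM => h1 _ _; have [i [i' [j [j' [ii jj e]]]]] := h1 _ MA.
rewrite e in MA *; have [_ _ h2 h3 h4] := cell_bounds MA.
move=> [/= [->|->] [->|->]]; lia.
Qed.

Lemma cell_vertex i i' j j' k l : cell M i i' j j' ->
  (k = i \/ k = i') -> (l = j \/ l = j') -> vertices M (k, l).
Proof. by move=> C hk hl; exists (Iv i i', Iv j j') => //; split. Qed.

Lemma cell_side_vunit i i' j j' k y : cell M i i' j j' -> j <= y < j' ->
  (k = i \/ k = i') -> vunit k y.
Proof.
move=> C yj hk i1 i1' j1 j1' C1 yj1 ik.
have [ii jj _ _ _] := cell_bounds C.
case: hk => e; rewrite e in ik.
  have [] := cell_uniq (x := i) C C1 _ yj _ yj1; lia.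
have [] := cell_uniq (x := i' - 1) C C1 _ yj _ yj1; lia.
Qed.

(** The cell to the right of the unit segment has its left side on the line,
    and would have a corner at the upper end if it did not extend further. On
    the right boundary of the mesh the cell to the left is taken. *)
Lemma vunit_up k y : a <= k <= b -> c <= y < d -> vunit k y ->
  ~ vertices M (k, y + 1) -> y + 1 < d /\ vunit k (y + 1).
Proof.
move=> kab ycd vk nv.
have [kb|kb] := ltP k b.
  have kab' : a <= k < b by lia.
  have [i [i' [j [j' [C hx hy]]]]] := cell_at kab' ycd.
  have ei : i = k by have := vk _ _ _ _ C hy; lia.
  have [_ _ _ _ bd] := cell_bounds C.
  have yj : y + 1 < j'.
    have [//|h] := ltP (y + 1) j'; exfalso; apply: nv.
    by apply: (cell_vertex C); [left|right; lia].
  split; first by lia.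
  by apply: (cell_side_vunit C); [lia|left].
have kab' : a <= k - 1 < b by lia.
have [i [i' [j [j' [C hx hy]]]]] := cell_at kab' ycd.
have [_ _ _ _ bd] := cell_bounds C.
have ei : i' = k by have := cell_bounds C; case; lia.
have yj : y + 1 < j'.
  have [//|h] := ltP (y + 1) j'; exfalso; apply: nv.
  by apply: (cell_vertex C); [right|right; lia].
split; first by lia.
by apply: (cell_side_vunit C); [lia|right].
Qed.

Lemma vunit_down k y : a <= k <= b -> c <= y < d -> vunit k y ->
  ~ vertices M (k, y) -> c < y /\ vunit k (y - 1).
Proof.
move=> kab ycd vk nv.
have [kb|kb] := ltP k b.
  have kab' : a <= k < b by lia.
  have [i [i' [j [j' [C hx hy]]]]] := cell_at kab' ycd.
  have ei : i = k by have := vk _ _ _ _ C hy; lia.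
  have [_ _ _ _ bd] := cell_bounds C.
  have yj : j < y.
    have [//|h] := ltP j y; exfalso; apply: nv.
    by apply: (cell_vertex C); [left|left; lia].
  split; first by lia.
  by apply: (cell_side_vunit C); [lia|left].
have kab' : a <= k - 1 < b by lia.
have [i [i' [j [j' [C hx hy]]]]] := cell_at kab' ycd.
have [_ _ _ _ bd] := cell_bounds C.
have ei : i' = k by have := cell_bounds C; case; lia.
have yj : j < y.
  have [//|h] := ltP j y; exfalso; apply: nv.
  by apply: (cell_vertex C); [right|left; lia].
split; first by lia.
by apply: (cell_side_vunit C); [lia|right].
Qed.

Lemma vunit_to_upper_vertex k y : a <= k <= b -> c <= y < d -> vunit k y ->
  exists j, [/\ y < j, vertices M (k, j), forall t, y <= t < j -> vunit k t &
    forall t, y < t < j -> ~ vertices M (k, t)].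
Proof.
move=> kab; have [n] := ubnP `|d - y|%N; elim: n y => // n IH y hn ycd vk.
have [v|nv] := pselect (vertices M (k, y + 1)).
  exists (y + 1); split=> //; first by lia.
    by move=> t ht; have -> : t = y by lia.
  by move=> t; lia.
have [yd v1] := vunit_up kab ycd vk nv.
have [||j [yj vj hv hn']] := IH (y + 1) _ _ v1; try lia.
exists j; split=> //; first by lia.
  move=> t ht; have [->//|ne] := eqVneq t y; apply: hv; lia.
move=> t ht; have [->//|ne] := eqVneq t (y + 1); apply: hn'; lia.
Qed.

Lemma vunit_to_lower_vertex k y : a <= k <= b -> c <= y < d -> vunit k y ->
  exists j, [/\ j <= y, vertices M (k, j), forall t, j <= t <= y -> vunit k t &
    forall t, j < t <= y -> ~ vertices M (k, t)].
Proof.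
move=> kab; have [n] := ubnP `|y - c|%N; elim: n y => // n IH y hn ycd vk.
have [v|nv] := pselect (vertices M (k, y)).
  exists y; split=> //.
    by move=> t ht; have -> : t = y by lia.
  by move=> t; lia.
have [yd v1] := vunit_down kab ycd vk nv.
have [||j [yj vj hv hn']] := IH (y - 1) _ _ v1; try lia.
exists j; split=> //; first by lia.
  move=> t ht; have [->//|ne] := eqVneq t y; apply: hv; lia.
move=> t ht; have [->//|ne] := eqVneq t y; apply: hn'; lia.
Qed.

Lemma vunit_on_lines k j j' : (forall t, j <= t < j' -> vunit k t) ->
  on_lines (R := R) M (Pt k, Iv j j').
Proof.
move=> hv C MC; apply/seteqP; split=> // -[u v] [[/= -> hvj]].
case: MM => h1 _ _; have [i [i' [l [l' [ii ll e]]]]] := h1 _ MC.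
rewrite e in MC * => -[/=]; move: hvj; rewrite !in_itv /= !ltr_int.
move=> /andP[jv vj'] ki /andP[lv vl'].
have jl' : j < l' by rewrite -(ltr_int R); exact: lt_trans jv vl'.
have lj' : l < j' by rewrite -(ltr_int R); exact: lt_trans lv vj'.
have jj' : j < j' by rewrite -(ltr_int R); exact: lt_trans jv vj'.
have := hv (Num.max j l) _ _ _ _ _ MC; rewrite ki; apply => //.
  by rewrite le_max lexx gt_max /= jj'.
by rewrite le_max lexx orbT gt_max /= jl'.
Qed.

(** Follow the line in both directions up to the first vertex. *)
Lemma vunit_vedge k y : a <= k <= b -> c <= y < d -> vunit k y ->
  exists j j', j <= y < j' /\ vedges (R := R) M (Pt k, Iv j j').
Proof.
move=> kab ycd vk.
have [j' [yj' vj' hv' hn']] := vunit_to_upper_vertex kab ycd vk.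
have [j [yj vj hv hn]] := vunit_to_lower_vertex kab ycd vk.
exists j, j'; split; first by rewrite yj.
exists k, j, j'; split=> //; first by lia.
split; last first.
  apply: vunit_on_lines => t ht; have [ty|yt] := leP t y; [apply: hv|apply: hv']; lia.
by move=> t ht; have [ty|yt] := leP t y; [apply: hn|apply: hn']; lia.
Qed.

Lemma vS_vunit k y : vS (R := R) M (k%:~R, midpt y) ->
  [/\ a <= k <= b, c <= y < d & vunit k y].
Proof.
case=> [[A [i [j [j' [e jj v1 v2 [_ ol]]]]]]|].
  rewrite e => -[/= /eqP]; rewrite eqr_int => /eqP -> hy.
  move: (hy); rewrite in_itv /= midpt_in => hy'.
  have /andP[/= b1 b2] := vertices_bounds v1; have /andP[/= b3 b4] := vertices_bounds v2.
  split; [lia|lia|].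
  move=> k1 k1' l l' C hl hk; rewrite e in ol.
  have : (block_set (Pt i, Iv j j') `&` block_set (Iv k1 k1', Iv l l')) ((i%:~R : R), midpt y).
    by split; split=> //=; rewrite in_itv /= ?midpt_in // !ltr_int.
  by rewrite ol.
by move=> [v _ [_ /esym /midpt_neq]].
Qed.

Lemma vunit_vS k y (t : R) : a <= k <= b -> c <= y < d -> vunit k y ->
  y%:~R <= t <= (y + 1)%:~R -> vS M (k%:~R, t).
Proof.
move=> kab ycd vk /andP[yt ty].
have [j [j' [/andP[jy yj'] ve]]] := vunit_vedge kab ycd vk.
have [_ [_ [_ [[<- <- <-] _ v1 v2 _]]]] := ve.
have jt : j%:~R <= t by apply: le_trans yt; rewrite ler_int.
have tj : t <= j'%:~R by apply: le_trans ty _; rewrite ler_int lezD1.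
move: jt; rewrite le_eqVlt => /predU1P[<-|jt]; first by right; exists (k, j).
move: tj; rewrite le_eqVlt => /predU1P[->|tj]; first by right; exists (k, j').
by left; exists (Pt k, Iv j j') => //; split=> //=; rewrite in_itv /= jt.
Qed.

Lemma vS_int k j : vS (R := R) M (k%:~R, j%:~R) ->
  a <= k <= b /\ ((c <= j < d /\ vunit k j) \/ (c < j <= d /\ vunit k (j - 1))).
Proof.
case=> [[A [i [l [l' [e ll v1 v2 [_ ol]]]]]]|].
  rewrite e => -[/= /eqP]; rewrite eqr_int => /eqP -> hy.
  move: (hy); rewrite in_itv /= !ltr_int => hj.
  have /andP[/= b1 b2] := vertices_bounds v1; have /andP[/= b3 b4] := vertices_bounds v2.
  split=> //; left; split; first by lia.
  move=> k1 k1' m m' C hl hk; rewrite e in ol.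
  have : (block_set (Pt i, Iv l l') `&` block_set (Iv k1 k1', Iv m m')) ((i%:~R : R), midpt j).
    by split; split=> //=; rewrite in_itv /= ?midpt_in ?ltr_int //; lia.
  by rewrite ol.
move=> [v vM [/eqP]]; rewrite eqr_int => /eqP <- /eqP; rewrite eqr_int => /eqP <-.
move: vM => [A MA]; case: MM => h1 _ _; have [i [i' [m [m' [ii mm e]]]]] := h1 _ MA.
rewrite e in MA * => -[/= hk hj]; have [_ _ b1 b2 b3] := cell_bounds MA.
split; first by case: hk => ->; lia.
case: hj => ->; [left|right]; split; try lia; apply: (cell_side_vunit MA) => //; lia.
Qed.

Lemma vertex_corner k j : a <= k < b -> c <= j < d -> vunit k j -> hunit k j ->
  vertices M (k, j).
Proof.
move=> hk hj v h; have [i [i' [l [l' [C hx hy]]]]] := cell_at hk hj.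
apply: (cell_vertex C); left.
  by have := v _ _ _ _ C hy; lia.
by have := h _ _ _ _ C hx; lia.
Qed.

Lemma vertex_corner_below k j : a <= k < b -> c < j <= d -> vunit k (j - 1) -> hunit k j ->
  vertices M (k, j).
Proof.
move=> hk hj v h; have hj' : c <= j - 1 < d by lia.
have [i [i' [l [l' [C hx hy]]]]] := cell_at hk hj'.
apply: (cell_vertex C); [left|right].
  by have := v _ _ _ _ C hy; lia.
by have := h _ _ _ _ C hx; lia.
Qed.

End Fixed.
End MeshTheory.

(** * Index vectors of anchors *)

Section Transposition.
Context {R : realType}.
Implicit Types (M : set block).

Lemma vertices_transpose M x y : vertices (transpose_mesh M) (x, y) = vertices M (y, x).
Proof.
rewrite propeqE; split=> -[A MA [h1 h2]]; exists (transpose A) => //.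
by rewrite /transpose_mesh /= transposeK.
Qed.

Lemma block_set_swap A (z : R * R) : block_set A z -> block_set (transpose A) (z.2, z.1).
Proof. by move=> [h1 h2]; split. Qed.

Lemma on_lines_transpose M A :
  on_lines (R := R) (transpose_mesh M) (transpose A) = on_lines (R := R) M A.
Proof.
rewrite propeqE; split=> h C MC; apply/seteqP; split=> // z [zA zC].
  have MC' : transpose_mesh M (transpose C) by rewrite /transpose_mesh /= transposeK.
  have /seteqP[+ _] := h _ MC'.
  by move=> /(_ (z.2, z.1)); apply; split; exact: block_set_swap.
have /seteqP[+ _] := h _ (MC : M (transpose C)).
move=> /(_ (z.2, z.1)); apply; split; last exact: block_set_swap.
by case: zA.
Qed.

Lemma vedges_transpose M A :
  vedges (R := R) (transpose_mesh M) (transpose A) = hedges (R := R) M A.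
Proof.
rewrite propeqE; split.
  move=> [i [j [j' [e jj v1 v2 [nv ol]]]]]; exists j, j', i.
  have eA : A = (Iv j j', Pt i) by rewrite -(transposeK A) e.
  rewrite !vertices_transpose in v1 v2; split=> //; split.
    by move=> k hk; rewrite -vertices_transpose; exact: nv.
  by rewrite -on_lines_transpose.
move=> [j [j' [i [e jj v1 v2 [nv ol]]]]]; exists i, j, j'.
split; rewrite ?vertices_transpose //; first by rewrite e.
split; first by move=> k hk; rewrite vertices_transpose; exact: nv.
by rewrite on_lines_transpose.
Qed.

Lemma hedges_transpose M A :
  hedges (R := R) (transpose_mesh M) (transpose A) = vedges (R := R) M A.
Proof. by rewrite -vedges_transpose transpose_meshK transposeK. Qed.

Lemma vS_transpose M (x y : R) : vS (transpose_mesh M) (x, y) = hS M (y, x).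
Proof.
have vE : vertex_set (transpose_mesh M) (x, y) = vertex_set M (y, x).
  rewrite propeqE; split=> -[[i j] v [<- <-]]; exists (j, i) => //.
    by rewrite -vertices_transpose.
  by rewrite vertices_transpose.
rewrite propeqE; split.
  case=> [[A + zA]|]; last by rewrite vE; right.
  rewrite -(transposeK A) vedges_transpose => h; left; exists (transpose A) => //.
  by rewrite block_set_transpose.
case=> [[A hA zA]|]; last by rewrite -vE; right.
left; exists (transpose A); first by rewrite vedges_transpose.
by rewrite block_set_transpose.
Qed.

Lemma It_transpose M A : It (R := R) M A = Is (R := R) (transpose_mesh M) (transpose A).
Proof.
apply/seteqP; split=> j h [x y] [/= h1 h2].
  by rewrite vS_transpose; apply: h; split.
by rewrite -vS_transpose; apply: h; split.
Qed.

Lemma anchors_transpose p q mu nu M A :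
  anchors (R := R) p q mu nu M A -> anchors (R := R) q p nu mu (transpose_mesh M) (transpose A).
Proof.
move=> [h1 h2]; split.
  move: h1; case: (odd p); case: (odd q); rewrite ?hedges_transpose ?vedges_transpose //.
    by rewrite /transpose_mesh /= transposeK.
  by move=> [[i j] v <-]; exists (j, i) => //; rewrite vertices_transpose.
move=> [x y]; rewrite block_set_transpose => /h2[]; split => //.
Qed.

End Transposition.

Section Framed.
Context {R : realType}.
Implicit Types (M : set block) (i j k l x y : int).

(** The part of admissibility that the index vectors depend on, in a form that
    is stable under transposition. *)
Definition framed (p q mu nu : nat) M : Prop :=
  [/\ mesh (R := R) (ilo p) (ihi p mu) (ilo q) (ihi q nu) M,
      forall l, frame_index p mu l ->
        forall y, ilo q <= y < ihi q nu -> vunit M l y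
    & forall l, frame_index q nu l ->
        forall x, ilo p <= x < ihi p mu -> vunit (transpose_mesh M) l x].

Lemma framed_transpose p q mu nu M :
  framed p q mu nu M -> framed q p nu mu (transpose_mesh M).
Proof.
by move=> [h1 h2 h3]; split; [exact: mesh_transpose|exact: h3|rewrite transpose_meshK].
Qed.

Lemma ilo_lt_ihi p mu : (1 < p)%N -> (0 < mu)%N -> ilo p < ihi p mu.
Proof. by rewrite /ilo /ihi => p2 mu0; have : (0 < p./2)%N by [lia]; lia. Qed.

Lemma frame_bounds p mu l : (0 < mu)%N -> frame_index p mu l -> ilo p <= l <= ihi p mu.
Proof. by rewrite /frame_index /ilo /ihi; lia. Qed.

Lemma skeleton_vunit (a b c d : int) M k y : a < b -> c < d -> mesh (R := R) a b c d M ->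
  skeleton (R := R) M (k%:~R, midpt y) -> vunit M k y.
Proof.
move=> ab cd MM [|h]; last by case: (vS_vunit ab cd MM h).
case=> [[A [i [i' [j [e _ _ _ _]]]]]|[v _ [_ /esym /midpt_neq //]]].
by rewrite e => -[/= _ /midpt_neq].
Qed.

Lemma admissible_framed p q mu nu M : (1 < p)%N -> (1 < q)%N -> (0 < mu)%N -> (0 < nu)%N ->
  admissible (R := R) p q mu nu M -> framed p q mu nu M.
Proof.
move=> p2 q2 mu0 nu0 [MM fs ft _].
have ab := ilo_lt_ihi p2 mu0; have cd := ilo_lt_ihi q2 nu0.
have MM' : mesh (R := R) (ilo p) (ihi p mu) (ilo q) (ihi q nu) M by [].
split=> // l fl x hx.
  have hx' : index_range q nu (midpt x : R).
    by rewrite /index_range /= in_itv /= midpt_in_closed.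
  have [h _] := fs _ fl (l%:~R, midpt x) (conj erefl hx').
  exact: (skeleton_vunit ab cd MM' h).
have hx' : index_range p mu (midpt x : R).
  by rewrite /index_range /= in_itv /= midpt_in_closed.
have [h _] := ft _ fl (midpt x, l%:~R) (conj hx' erefl).
apply: (skeleton_vunit cd ab (mesh_transpose MM')).
case: h => h; [right; by rewrite vS_transpose|left].
by rewrite -vS_transpose transpose_meshK.
Qed.

Section Fixed.
Variables (p q mu nu : nat) (M : set block).
Hypotheses (p2 : (1 < p)%N) (q2 : (1 < q)%N) (mu0 : (0 < mu)%N) (nu0 : (0 < nu)%N).
Hypothesis FM : framed p q mu nu M.

Let a := ilo p. Let b := ihi p mu. Let c := ilo q. Let d := ihi q nu.
Let ab : a < b. Proof. exact: ilo_lt_ihi. Qed.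
Let cd : c < d. Proof. exact: ilo_lt_ihi. Qed.
Let MM : mesh (R := R) a b c d M. Proof. by case: FM. Qed.

Definition side_range (c d : int) (s : side) : Prop :=
  match s with Pt j => c <= j <= d | Iv j j' => [/\ c <= j, j < j' & j' <= d] end.

(** Of the two unit segments next to an integer point one suffices, because
    every vertex is the end of a vertical edge. *)
Definition vline k (s : side) : Prop :=
  match s with
  | Pt j => (c <= j < d /\ vunit M k j) \/ (c < j <= d /\ vunit M k (j - 1))
  | Iv j j' => forall y, j <= y < j' -> vunit M k y
  end.

Lemma Is_vline A k : side_range c d A.2 ->
  Is (R := R) M A k <-> a <= k <= b /\ vline k A.2.
Proof.
case: A => A1 [j|j j'] /= hr; split.
- by move=> /(_ (k%:~R, j%:~R)) h; apply: (vS_int ab cd MM); apply: h.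
- move=> [kab hv] [x y] [/= -> ->].
  case: hv => -[hj v].
    by apply: (vunit_vS ab cd MM kab hj v); rewrite lexx ler_int lerDl.
  have hj' : c <= j - 1 < d by lia.
  by apply: (vunit_vS ab cd MM kab hj' v); rewrite subrK lexx ler_int gerBl.
- move=> h; case: hr => r1 r2 r3.
  have h' y : j <= y < j' -> vS (R := R) M (k%:~R, midpt y).
    by move=> hy; apply: h; split=> //=; rewrite in_itv /= midpt_in.
  have hj : j <= j < j' by lia.
  have [kab _ _] := vS_vunit ab cd MM (h' _ hj); split=> // y hy.
  by have [] := vS_vunit ab cd MM (h' _ hy).
- move=> [kab hv] [x t] [/= -> ]; rewrite in_itv /= => /andP[jt tj]; case: hr => r1 r2 r3.
  have f1 : (Num.floor t)%:~R <= t by exact: floor_le.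
  have f2 : t < (Num.floor t + 1)%:~R by exact: floorD1_gt.
  have y1 : j <= Num.floor t.
    by rewrite -ltzD1 -(ltr_int R); exact: lt_trans jt f2.
  have y2 : Num.floor t < j' by rewrite -(ltr_int R); exact: le_lt_trans f1 tj.
  apply: (vunit_vS ab cd MM kab _ (hv (Num.floor t) _)); try lia.
  by rewrite f1 ltW.
Qed.

Lemma Is_frame A k : side_range c d A.2 -> frame_index p mu k -> Is (R := R) M A k.
Proof.
move=> hr fk; case: FM => _ hv _; apply/(Is_vline _ hr); split; first exact: frame_bounds.
case: A.2 hr => [j|j j'] /= hr.
  have [jd|dj] := ltP j d; [left|right]; split; try lia; apply: hv => //; lia.
by case: hr => r1 r2 r3 y hy; apply: hv => //; rewrite -/c -/d; lia.
Qed.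

End Fixed.

(** The condition on the first side of an anchor under which its local index
    vector exists. *)
Definition side_ok p (mu : nat) (I : set int) (s : side) : Prop :=
  if odd p then exists i i', [/\ s = Iv i i', 1 <= i, i' <= mu%:Z & consecutive I i i']
  else exists i, [/\ s = Pt i, 1 <= i, i <= mu%:Z & I i].

Lemma active_side mu nu (A : block) : block_set (R := R) A `<=` active_region mu nu ->
  (exists y : R, side_set A.2 y) ->
  match A.1 return Prop with Pt i => 1 <= i <= mu%:Z | Iv i i' => i < i' -> 1 <= i /\ i' <= mu%:Z end.
Proof.
move=> h [y hy]; case: A h hy => -[i|i i'] A2 /= h hy.
  have [+ _] := h (i%:~R, y) (conj erefl hy).
  by rewrite /= in_itv /= -[1]/(1%:~R) -[mu%:R]/(mu%:Z%:~R) !ler_int.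
move=> ii.
have h1 : side_set (Iv i i') (midpt i : R) by rewrite side_set_midpt; lia.
have h2 : side_set (Iv i i') (midpt (i' - 1) : R) by rewrite side_set_midpt; lia.
have [+ _] := h (midpt i, y) (conj h1 hy); have [+ _] := h (midpt (i' - 1), y) (conj h2 hy).
rewrite /= !in_itv /= -[1]/(1%:~R) -[mu%:R]/(mu%:Z%:~R) !midpt_in_closed; lia.
Qed.

Lemma side_nonempty (c d : int) s : side_range c d s -> exists y : R, side_set s y.
Proof.
case: s => [j _|j j' [_ jj _]]; first by exists j%:~R.
by exists (midpt j); rewrite side_set_midpt; lia.
Qed.

End Framed.

Section Anchors.
Context {R : realType}.
Implicit Types (i j k l x y : int).

Section Fixed.
Variables (p q mu nu : nat) (M : set block).
Hypotheses (p2 : (1 < p)%N) (q2 : (1 < q)%N) (mu0 : (0 < mu)%N) (nu0 : (0 < nu)%N).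
Hypothesis FM : framed (R := R) p q mu nu M.

Let a := ilo p. Let b := ihi p mu. Let c := ilo q. Let d := ihi q nu.
Let ab : a < b. Proof. exact: ilo_lt_ihi. Qed.
Let cd : c < d. Proof. exact: ilo_lt_ihi. Qed.
Let MM : mesh (R := R) a b c d M. Proof. by case: FM. Qed.

Lemma anchor_range A : anchors (R := R) p q mu nu M A -> side_range c d A.2.
Proof.
move=> [h _]; move: h; case: (odd p); case: (odd q).
- move=> MA; have [h1 _ _] := MM; have [i [i' [j [j' [_ _ e]]]]] := h1 _ MA.
  by rewrite e in MA *; have [_ jj _ _ /andP[]] := cell_bounds MM MA.
- by move=> [i [i' [j [-> _ v _ _]]]]; have /andP[] := vertices_bounds ab cd MM v.
- move=> [i [j [j' [-> jj v1 v2 _]]]] /=.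
  have /andP[_ /andP[/= h1 _]] := vertices_bounds ab cd MM v1.
  by have /andP[_ /andP[/= _ h2]] := vertices_bounds ab cd MM v2.
- by move=> [v vM <-]; have /andP[] := vertices_bounds ab cd MM vM.
Qed.

Lemma hedge_hunit i i' j x : hedges (R := R) M (Iv i i', Pt j) -> i <= x < i' -> hunit M x j.
Proof.
move=> [_ [_ [_ [[<- <- <-] _ _ _ [_ ol]]]]] hx k k' l l' C hk hl.
have : (block_set (Iv i i', Pt j) `&` block_set (Iv k k', Iv l l')) ((midpt x : R), j%:~R).
  by split; split=> //=; rewrite in_itv /= ?midpt_in // !ltr_int.
by rewrite ol.
Qed.

(** For odd [p] no global index lies strictly inside of the side: the segment
    would cut the cell, resp. meet the horizontal edge in a vertex. *)
Lemma anchor_side A : anchors (R := R) p q mu nu M A ->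
  side_ok p mu (Is (R := R) M A) A.1.
Proof.
move=> AM; have hr := anchor_range AM; have [h hact] := AM.
have act := active_side hact (side_nonempty hr).
have IsE k := Is_vline p2 q2 mu0 nu0 FM k hr.
rewrite /side_ok; move: h act hr IsE hact; case: (odd p); case: (odd q).
- move=> MA; have [h1 _ _] := MM; have [i [i' [j [j' [ii jj e]]]]] := h1 _ MA.
  rewrite e /= in MA * => /(_ ii)[i1 i2] hr IsE hact.
  have [_ _ b1 b2 b3] := cell_bounds MM MA.
  exists i, i'; split=> //; split=> //.
  + apply/IsE; split; first by lia.
    by move=> y hy; apply: (cell_side_vunit ab cd MM MA hy); left.
  + apply/IsE; split; first by lia.
    by move=> y hy; apply: (cell_side_vunit ab cd MM MA hy); right.
  + move=> k hk /IsE[_ hv]; have hj : j <= j < j' by lia.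
    by apply: (hv j hj _ _ _ _ MA).
- move=> hA; have [i [i' [j [e ii v1 v2 [nv _]]]]] := hA.
  rewrite e /= in hA * => /(_ ii)[i1 i2] hr IsE hact.
  exists i, i'; split=> //; split=> //.
  + by move=> [x y] [/= -> ->]; right; exists (i, j).
  + by move=> [x y] [/= -> ->]; right; exists (i', j).
  + move=> k hk /IsE[kab hv]; apply: (nv k hk).
    have /andP[/= b1 _] := vertices_bounds ab cd MM v1.
    have /andP[/= b2 _] := vertices_bounds ab cd MM v2.
    have kab' : a <= k < b by lia.
    have hk' : i <= k < i' by lia.
    have hh := hedge_hunit hA hk'.
    by case: hv => -[hj v];
      [exact: (vertex_corner ab cd MM)|exact: (vertex_corner_below ab cd MM)].
- move=> hA; have [i [j [j' [e _ _ _ _]]]] := hA.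
  rewrite e /= in hA * => /andP[i1 i2] _ _ hact; exists i; split=> // -[x y] [/= -> hy].
  by left; exists (Pt i, Iv j j').
- move=> [[i j] vM <-] /= /andP[i1 i2] _ _ _; exists i; split=> // -[x y] [/= -> ->].
  by right; exists (i, j).
Qed.

Lemma Is_bounds A k : side_range c d A.2 -> Is (R := R) M A k -> ilo p <= k <= ihi p mu.
Proof. by move=> hr /(Is_vline p2 q2 mu0 nu0 FM _ hr)[]. Qed.

End Fixed.
End Anchors.

(** * Local index vectors *)

Section LocalIndex.
Variables (p mu : nat) (I : set int).
Hypotheses (p2 : (1 < p)%N) (mu0 : (0 < mu)%N).
Hypothesis I_frame : forall k, frame_index p mu k -> I k.

Definition next_index : rel int := fun k k' => `[< consecutive I k k' >].

Lemma next_exists k x : I k -> I x -> k < x ->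
  exists k', next_index k k' /\ k' <= x.
Proof.
have [n] := ubnP `|x - k|%N; elim: n x => // n IH x hn Ik Ix kx.
have [[y [yk Iy]]|h] := pselect (exists y, k < y < x /\ I y).
  have [||k' [h1 h2]] := IH y _ Ik Iy; try lia.
  by exists k'; split=> //; lia.
exists x; split=> //; apply/asboolP; split=> // y hy Iy; apply: h; by exists y.
Qed.

Lemma prev_exists k x : I k -> I x -> k < x ->
  exists k', next_index k' x /\ k <= k'.
Proof.
have [n] := ubnP `|x - k|%N; elim: n k => // n IH k hn Ik Ix kx.
have [[y [yk Iy]]|h] := pselect (exists y, k < y < x /\ I y).
  have [||k' [h1 h2]] := IH y _ Iy Ix; try lia.
  by exists k'; split=> //; lia.
exists k; split=> //; apply/asboolP; split=> // y hy Iy; apply: h; by exists y.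
Qed.

Lemma right_chain m i : (m <= p./2)%N -> I i -> i <= ihi p mu - m%:Z ->
  exists2 s, size s = m & path next_index i s.
Proof.
elim: m i => [|m IH] i mp Ii hi; first by exists [::].
have Ie : I (ihi p mu - m%:Z) by apply: I_frame; rewrite /frame_index /ihi /ilo; lia.
have [|k [ik ke]] := next_exists Ii Ie; first by lia.
have [|s sm hs] := IH k (ltnW mp) _ ke; first by move/asboolP: ik => [].
by exists (k :: s); rewrite /= ?sm // ik.
Qed.

Lemma left_chain m i : (m <= p./2)%N -> I i -> ilo p + m%:Z <= i ->
  exists2 r, size r = m & forall s, path next_index i s -> sorted next_index (r ++ i :: s).
Proof.
elim: m i => [|m IH] i mp Ii hi; first by exists [::].
have Ie : I (ilo p + m%:Z) by apply: I_frame; rewrite /frame_index /ihi /ilo; lia.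
have [|k [ik ke]] := prev_exists Ie Ii; first by lia.
have [|r rm hr] := IH k (ltnW mp) _ ke; first by move/asboolP: ik => [].
exists (rcons r k) => [|s hs]; first by rewrite size_rcons rm.
by rewrite cat_rcons; apply: hr; rewrite /= ik.
Qed.

Lemma chain_local_index a (l : seq int) : size l = p.+1 -> sorted next_index l ->
  a = (if odd p then Iv (nth 0 l p./2) (nth 0 l p./2.+1) else Pt (nth 0 l p./2)) ->
  is_local_index p I a l.
Proof.
move=> sl hl e.
have cl k : (k < p)%N -> consecutive I (nth 0 l k) (nth 0 l k.+1).
  move=> kp; apply/asboolP; move/(sortedP 0): hl; apply; by rewrite sl ltnS.
split=> // k; rewrite ltnS leq_eqVlt => /predU1P[->|kp]; last by case: (cl k kp).
have := cl p.-1; rewrite prednK; last by lia.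
by move=> /(_ ltac:(lia))[].
Qed.

(** The frame provides [p./2] indices on either side of the active region. *)
Lemma local_index_spec a : side_ok p mu I a -> is_local_index p I a (local_index p I a).
Proof.
move=> ha; apply: xgetPex; move: ha; rewrite /side_ok /=.
have hp : p = (odd p + p./2.*2)%N by rewrite odd_double_half.
case: ifP => op; rewrite op in hp.
  move=> [i [i' [-> i1 i2 cc]]]; have [Ii Ii' ii _] := cc.
  have [|r rm hr] := left_chain (leqnn _) Ii; first by rewrite /ilo; lia.
  have [|s sm hs] := right_chain (leqnn _) Ii'; first by rewrite /ihi; lia.
  exists (r ++ i :: i' :: s); apply: chain_local_index.
  - by rewrite size_cat /= rm sm; lia.
  - by apply: hr => /=; rewrite hs andbT; apply/asboolP.
  - by rewrite op !nth_cat rm ltnn subnn ltnNge leqnSn /= subSn // subnn.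
move=> [i [-> i1 i2 Ii]].
have [|r rm hr] := left_chain (leqnn _) Ii; first by rewrite /ilo; lia.
have [|s sm hs] := right_chain (leqnn _) Ii; first by rewrite /ihi; lia.
exists (r ++ i :: s); apply: chain_local_index.
- by rewrite size_cat /= rm sm; lia.
- exact: hr.
- by rewrite op !nth_cat rm ltnn subnn.
Qed.

End LocalIndex.

(** * The full grid *)

Section FullGrid.
Context {R : realType}.
Implicit Types (i j k l x y : int).

Lemma unit_cover (a b : int) (u : R) : a < b -> a%:~R <= u <= b%:~R ->
  exists2 x, a <= x < b & x%:~R <= u <= (x + 1)%:~R.
Proof.
move=> ab /andP[au ub]; have [ue|ue] := eqVneq u b%:~R.
  exists (b - 1); first by lia.
  by rewrite ue subrK lexx ler_int gerBl.
exists (Num.floor u); last by rewrite floor_le ltW // floorD1_gt.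
rewrite -(ltr_int R) floor_ge_int au /=.
by apply: le_lt_trans (floor_le u) _; rewrite lt_neqAle ue.
Qed.

Lemma transpose_full_grid p q mu nu :
  transpose_mesh (full_grid p q mu nu) = full_grid q p nu mu.
Proof.
apply/seteqP; split=> A.
  move=> [i [j [h1 h2 h3 h4 e]]]; exists j, i; split=> //.
  by rewrite -(transposeK A) e.
by move=> [i [j [h1 h2 h3 h4 ->]]]; exists j, i.
Qed.

Lemma full_grid_vunit p q mu nu k y : vunit (full_grid p q mu nu) k y.
Proof. move=> i i' j j' [i1 [j1 [_ _ _ _ [-> -> _ _]]]]; lia. Qed.

Lemma full_grid_framed p q mu nu : (1 < p)%N -> (1 < q)%N -> (0 < mu)%N -> (0 < nu)%N ->
  framed (R := R) p q mu nu (full_grid p q mu nu).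
Proof.
move=> p2 q2 mu0 nu0.
have ab := ilo_lt_ihi p2 mu0; have cd := ilo_lt_ihi q2 nu0.
split; last first.
- by move=> l _ x _; rewrite transpose_full_grid; exact: full_grid_vunit.
- by move=> l _ x _; exact: full_grid_vunit.
split.
- by move=> A [i [j [_ _ _ _ ->]]]; exists i, (i + 1), j, (j + 1); split=> //; lia.
- move=> A B [i [j [_ _ _ _ ->]]] [k [l [_ _ _ _ ->]]] [z [[/= a1 a2] [/= b1 b2]]].
  move: a1 a2 b1 b2; rewrite !in_itv /= => /andP[a1 a2] /andP[a3 a4] /andP[b1 b2] /andP[b3 b4].
  have h1 := lt_trans a1 b2; have h2 := lt_trans b1 a2.
  have h3 := lt_trans a3 b4; have h4 := lt_trans b3 a4.
  rewrite !ltr_int in h1 h2 h3 h4.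
  by have -> : i = k by [lia]; have -> : j = l by [lia].
- have sub (a b i : int) (t : R) : a <= i -> i < b -> t \in `[i%:~R, (i + 1)%:~R] ->
      t \in `[a%:~R, b%:~R].
    rewrite !in_itv /= => ai ib /andP[t1 t2].
    by rewrite (le_trans _ t1) ?ler_int //= (le_trans t2) // ler_int; lia.
  apply/seteqP; split=> [z [A [i [j [h1 h2 h3 h4 ->]]]] [z1 z2]|z [z1 z2]].
    by split; [exact: (sub _ _ i)|exact: (sub _ _ j)].
  have [x x1 x2] : exists2 x, ilo p <= x < ihi p mu & x%:~R <= z.1 <= (x + 1)%:~R.
    by apply: unit_cover => //; move: z1; rewrite /= in_itv.
  have [y y1 y2] : exists2 y, ilo q <= y < ihi q nu & y%:~R <= z.2 <= (y + 1)%:~R.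
    by apply: unit_cover => //; move: z2; rewrite /= in_itv.
  exists (Iv x (x + 1), Iv y (y + 1)); first by exists x, y; split=> //; lia.
  by split; rewrite /= in_itv.
Qed.

Lemma full_grid_Is p q mu nu A k : (1 < p)%N -> (1 < q)%N -> (0 < mu)%N -> (0 < nu)%N ->
  side_range (ilo q) (ihi q nu) A.2 ->
  Is (R := R) (full_grid p q mu nu) A k <-> ilo p <= k <= ihi p mu.
Proof.
move=> p2 q2 mu0 nu0 hr; have F := full_grid_framed p2 q2 mu0 nu0.
split=> [/(Is_vline p2 q2 mu0 nu0 F _ hr)[]//|hk].
apply/(Is_vline p2 q2 mu0 nu0 F _ hr); split=> //.
have cd := ilo_lt_ihi q2 nu0.
case: A.2 hr => [j|j j'] /= hr; last by move=> *; exact: full_grid_vunit.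
have [jd|dj] := ltP j (ihi q nu); [left|right]; split; try lia; exact: full_grid_vunit.
Qed.

Definition full_side (p j : nat) : side :=
  if odd p then Iv (1 + j%:Z) (2 + j%:Z) else Pt (1 + j%:Z).

(** The number of anchor sides in the active region of the full grid: the
    points [1], ..., [mu] if [p] is even, and the unit intervals between them
    if [p] is odd. *)
Definition spline_count (p mu : nat) : nat := (mu - odd p)%N.

Lemma side_ok_full (p mu : nat) I s : (forall k, I k <-> ilo p <= k <= ihi p mu) ->
  side_ok p mu I s -> exists2 j : nat, (j < spline_count p mu)%N & s = full_side p j.
Proof.
move=> hI; rewrite /side_ok /full_side /spline_count; case: (odd p).
  move=> [i [i' [-> i1 i2 [Ii Ii' ii nI]]]]; exists `|i - 1|%N; first by lia.
  have e : i' = i + 1.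
    apply/eqP; apply: contraT => ne; case: (nI (i + 1)); first by lia.
    by apply/hI; move/hI: Ii; move/hI: Ii'; lia.
  by rewrite e; congr Iv; lia.
by move=> [i [-> i1 i2 _]]; exists `|i - 1|%N; [lia|congr Pt; lia].
Qed.

Lemma full_side_set (p mu j : nat) (z : R) : (j < spline_count p mu)%N ->
  side_set (full_side p j) z -> 1 <= z <= mu%:R.
Proof.
have e (n : nat) : n%:R = (n%:Z%:~R : R) by [].
rewrite /full_side /spline_count; case: (odd p) => hj /=; last first.
  by move=> ->; rewrite -[1]/(1%:~R) e !ler_int; lia.
rewrite in_itv /= -[1]/(1%:~R) e => /andP[h1 h2]; apply/andP; split.
  by apply: le_trans (ltW h1); rewrite ler_int; lia.
by apply: le_trans (ltW h2) _; rewrite ler_int; lia.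
Qed.

Lemma full_grid_vertex p q mu nu x y : (1 < p)%N -> (1 < q)%N -> (0 < mu)%N -> (0 < nu)%N ->
  ilo p <= x <= ihi p mu -> ilo q <= y <= ihi q nu -> vertices (full_grid p q mu nu) (x, y).
Proof.
move=> p2 q2 mu0 nu0 hx hy.
have ab := ilo_lt_ihi p2 mu0; have cd := ilo_lt_ihi q2 nu0.
have [i hi] : exists i, (ilo p <= i < ihi p mu) /\ (x = i \/ x = i + 1).
  have [h|h] := ltP x (ihi p mu); [exists x|exists (x - 1)]; split; lia.
have [j hj] : exists j, (ilo q <= j < ihi q nu) /\ (y = j \/ y = j + 1).
  have [h|h] := ltP y (ihi q nu); [exists y|exists (y - 1)]; split; lia.
case: hi hj => h1 h2 [h3 h4].
apply: (@cell_vertex _ i (i + 1) j (j + 1)) => //.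
by exists i, j; split=> //; lia.
Qed.

Lemma full_grid_vedge p q mu nu x y : (1 < p)%N -> (1 < q)%N -> (0 < mu)%N -> (0 < nu)%N ->
  ilo p <= x <= ihi p mu -> ilo q <= y < ihi q nu ->
  vedges (R := R) (full_grid p q mu nu) (Pt x, Iv y (y + 1)).
Proof.
move=> p2 q2 mu0 nu0 hx hy.
have ab := ilo_lt_ihi p2 mu0; have cd := ilo_lt_ihi q2 nu0.
have [MM _ _] := full_grid_framed p2 q2 mu0 nu0.
have [j [j' [hj hv]]] := vunit_vedge ab cd MM hx hy (full_grid_vunit (k := x) (y := y)).
have [_ [_ [_ [[<- <- <-] _ _ _ [nv _]]]]] := hv.
have e1 : j = y.
  apply/eqP; apply: contraT => ne; case: (nv y); first by lia.
  by apply: full_grid_vertex => //; lia.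
have e2 : j' = y + 1.
  apply/eqP; apply: contraT => ne; case: (nv (y + 1)); first by lia.
  by apply: full_grid_vertex => //; lia.
by rewrite -e2 -{1}e1.
Qed.

Lemma full_side_anchor (p q mu nu j k : nat) : (1 < p)%N -> (1 < q)%N -> (0 < mu)%N -> (0 < nu)%N ->
  (j < spline_count p mu)%N -> (k < spline_count q nu)%N ->
  anchors (R := R) p q mu nu (full_grid p q mu nu) (full_side p j, full_side q k).
Proof.
move=> p2 q2 mu0 nu0 hj hk.
split; last first.
  by move=> z [/(full_side_set hj) h1 /(full_side_set hk) h2]; split; rewrite /= in_itv.
have lp : ilo p <= 0 /\ mu%:Z < ihi p mu by rewrite /ilo /ihi; lia.
have lq : ilo q <= 0 /\ nu%:Z < ihi q nu by rewrite /ilo /ihi; lia.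
move: hj hk; rewrite /full_side /spline_count; case: (odd p); case: (odd q) => hj hk.
- exists (1 + j%:Z), (1 + k%:Z); split; try lia; congr (Iv _ _, Iv _ _); lia.
- rewrite -(transpose_full_grid q p) -(transposeK (Iv _ _, _)) hedges_transpose.
  have -> : 2 + j%:Z = 1 + j%:Z + 1 by lia.
  by apply: full_grid_vedge => //; lia.
- have -> : 2 + k%:Z = 1 + k%:Z + 1 by lia.
  by apply: full_grid_vedge => //; lia.
- by exists (1 + j%:Z, 1 + k%:Z) => //; apply: full_grid_vertex => //; lia.
Qed.

Lemma full_anchor_sides (p q mu nu : nat) A : (1 < p)%N -> (1 < q)%N -> (0 < mu)%N -> (0 < nu)%N ->
  anchors (R := R) p q mu nu (full_grid p q mu nu) A ->
  exists j k : nat, [/\ (j < spline_count p mu)%N, (k < spline_count q nu)%N &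
    A = (full_side p j, full_side q k)].
Proof.
move=> p2 q2 mu0 nu0 hA; have F := full_grid_framed p2 q2 mu0 nu0.
have hA' := anchors_transpose hA; rewrite transpose_full_grid in hA'.
have F' := full_grid_framed q2 p2 nu0 mu0.
have r1 := anchor_range p2 q2 mu0 nu0 F hA.
have r2 := anchor_range q2 p2 nu0 mu0 F' hA'.
have [j hj ej] := side_ok_full (fun k => full_grid_Is k p2 q2 mu0 nu0 r1)
  (anchor_side p2 q2 mu0 nu0 F hA).
have [k hk ek] := side_ok_full (fun k => full_grid_Is k q2 p2 nu0 mu0 r2)
  (anchor_side q2 p2 nu0 mu0 F' hA').
exists j, k; split=> //; rewrite -ej; move: ek; case: (A) => A1 A2 /= ->.
by [].
Qed.

Lemma full_side_ok (p mu : nat) I (j : nat) : (forall k, I k <-> ilo p <= k <= ihi p mu) ->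
  (j < spline_count p mu)%N -> side_ok p mu I (full_side p j).
Proof.
move=> hI hj.
move: hj; rewrite /side_ok /full_side /spline_count; case: (odd p) => hj.
  exists (1 + j%:Z), (2 + j%:Z); split=> //; try lia.
  split; [| |lia|by move=> k; lia]; apply/hI; rewrite /ilo /ihi; lia.
by exists (1 + j%:Z); split=> //; try lia; apply/hI; rewrite /ilo /ihi; lia.
Qed.

Lemma full_local_index (p mu : nat) I (j : nat) : (forall k, I k <-> ilo p <= k <= ihi p mu) ->
  (j < spline_count p mu)%N -> (1 < p)%N -> (0 < mu)%N ->
  forall t, (t < p.+1)%N ->
    nth 0 (local_index p I (full_side p j)) t = ilo p + (j + t)%N%:Z.
Proof.
move=> hI hj p2 mu0.
have hok := full_side_ok hI hj.
have hf k : frame_index p mu k -> I k by move=> h; apply/hI; exact: frame_bounds.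
have [sl hIl hc hcen] := local_index_spec p2 mu0 hf hok.
move: sl hIl hc hcen; set l := local_index _ _ _ => sl hIl hc hcen.
have step t : (t < p)%N -> nth 0 l t.+1 = nth 0 l t + 1.
  move=> tp; have [I1 I2 lt no] := hc t tp; apply/eqP; apply: contraT => ne.
  case: (no (nth 0 l t + 1)); first by lia.
  by apply/hI; move/hI: I1; move/hI: I2; lia.
have fromO t : (t < p.+1)%N -> nth 0 l t = nth 0 l 0 + t%:Z.
  elim: t => [|t IH] tp; first by rewrite addr0.
  by rewrite step // IH; [lia|exact: ltnW].
have hc0 : nth 0 l p./2 = 1 + j%:Z.
  by move: hcen; rewrite /full_side; case: (odd p) => -[].
have hp2 : (p./2 < p.+1)%N by lia.
move=> t tp; rewrite fromO //; move: hc0; rewrite fromO // /ilo; lia.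
Qed.

End FullGrid.

(** * Tensor-product meshes *)

Section Tensor.
Context {R : realType}.
Variables (p q mu nu : nat) (M : set block).
Hypotheses (p2 : (1 < p)%N) (q2 : (1 < q)%N) (mu0 : (0 < mu)%N) (nu0 : (0 < nu)%N).
Hypothesis FM : framed (R := R) p q mu nu M.

(** Up, down, right and left, for an edge with end point [v]. *)
Definition direction (v : int * int) (A : block) : 'I_4 :=
  match A with
  | (Pt _, Iv j _) => if j == v.2 then inord 0 else inord 1
  | (Iv i _, _) => if i == v.1 then inord 2 else inord 3
  | _ => inord 0
  end.

Lemma direction_inj v A B : (hedges (R := R) M `|` vedges (R := R) M) A -> corners A v ->
  (hedges (R := R) M `|` vedges (R := R) M) B -> corners B v ->
  direction v A = direction v B -> A = B.
Proof.
move: v => [x y].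
have dneq (m n : nat) : (m < 4)%N -> (n < 4)%N -> m != n -> (inord m : 'I_4) <> inord n.
  by move=> m4 n4 mn /(congr1 val); rewrite /= !inordK // => /eqP; rewrite (negPf mn).
have noHV i i' j k l l' : direction (x, y) (Iv i i', Pt j) <> direction (x, y) (Pt k, Iv l l').
  by rewrite /=; case: ifP => _; case: ifP => _; exact: dneq.
move=> [] [i1 [i2 [i3 [-> lt1 v1 w1 [n1 _]]]]] c1 [] [j1 [j2 [j3 [-> lt2 v2 w2 [n2 _]]]]] c2.
- move: c1 c2 => [/= c1 c1'] [/= c2 c2'] /=.
  rewrite -{}c1' in v1 w1 n1 *; rewrite -{}c2' in v2 w2 n2 *.
  case: eqP => [e1|ne1]; case: eqP => [e2|ne2]; try by move/dneq; case.
    move=> _; rewrite {}e1 in v1 w1 n1 lt1 *; rewrite {}e2 in v2 w2 n2 lt2 *.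
    have [h|h|-> //] := ltgtP i2 j2; [case: (n2 i2)|case: (n1 j2)] => //; lia.
  have e1 : i2 = x by case: c1 => // /esym.
  have e2 : j2 = x by case: c2 => // /esym.
  move=> _; rewrite {}e1 in v1 w1 n1 lt1 *; rewrite {}e2 in v2 w2 n2 lt2 *.
  have [h|h|-> //] := ltgtP i1 j1; [case: (n1 j1)|case: (n2 i1)] => //; lia.
- by move/noHV.
- by move/esym/noHV.
- move: c1 c2 => [/= c1' c1] [/= c2' c2] /=.
  rewrite -{}c1' in v1 w1 n1 *; rewrite -{}c2' in v2 w2 n2 *.
  case: eqP => [e1|ne1]; case: eqP => [e2|ne2]; try by move/dneq; case.
    move=> _; rewrite {}e1 in v1 w1 n1 lt1 *; rewrite {}e2 in v2 w2 n2 lt2 *.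
    have [h|h|-> //] := ltgtP i3 j3; [case: (n2 i3)|case: (n1 j3)] => //; lia.
  have e1 : i3 = y by case: c1 => // /esym.
  have e2 : j3 = y by case: c2 => // /esym.
  move=> _; rewrite {}e1 in v1 w1 n1 lt1 *; rewrite {}e2 in v2 w2 n2 lt2 *.
  have [h|h|-> //] := ltgtP i2 j2; [case: (n1 j2)|case: (n2 i2)] => //; lia.
Qed.

(** As no two edges leave [v] in the same direction, four edges leave in all
    four. *)
Lemma valence4_direction v d : valence (R := R) M v 4 ->
  exists A, [/\ (hedges (R := R) M `|` vedges (R := R) M) A, corners A v & direction v A = d].
Proof.
move=> /card_set_bijP[f [_ _ fs]].
have /choice[h hh] : forall i : 'I_4, exists A,
    ((hedges (R := R) M `|` vedges (R := R) M) A /\ corners A v) /\ f A = i.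
  by move=> i; have [A hA e] := fs i (ltn_ord i); exists A.
have gi : injective (fun i => direction v (h i)).
  move=> i j; have [[hi ci] ei] := hh i; have [[hj cj] ej] := hh j.
  move=> /(direction_inj hi ci hj cj) e; apply/val_inj.
  by rewrite -[LHS]/(nat_of_ord i) -ei e ej.
have /codomP[i ei] : d \in codom (fun i => direction v (h i)) by apply: (injF_onto gi).
have [[hi ci] _] := hh i.
by exists (h i).
Qed.

(** A line goes on beyond a vertex of valence 4, because an edge leaves the
    vertex in that direction. *)
Lemma tensor_vunit k y y' : tensor_product (R := R) p q mu nu M ->
  ilo p <= k <= ihi p mu -> ilo q <= y < ihi q nu -> ilo q <= y' < ihi q nu ->
  vunit M k y -> vunit M k y'.
Proof.
have ab := ilo_lt_ihi p2 mu0; have cd := ilo_lt_ihi q2 nu0.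
have [MM _ _] := FM => TP kab.
have ind m n : (m < 4)%N -> (n < 4)%N -> m != n -> (inord m : 'I_4) <> inord n.
  by move=> m4 n4 mn /(congr1 val); rewrite /= !inordK // => /eqP; rewrite (negPf mn).
have edge_unit j j' t : j <= t < j' -> vedges (R := R) M (Pt k, Iv j j') -> vunit M k t.
  move=> ht hv; have : vS (R := R) M (k%:~R, midpt t).
    by left; exists (Pt k, Iv j j') => //; split=> //=; rewrite in_itv /= midpt_in.
  by move/(vS_vunit ab cd MM) => [].
have bdry t : (k == ilo p) || (k == ihi p mu) -> vunit M k t.
  by move=> hk i i' j j' C _; have [_ _ h1 h2 _] := cell_bounds MM C; lia.
have up t : ilo q <= t -> t + 1 < ihi q nu -> vunit M k t -> vunit M k (t + 1).
  move=> t1 t2 vt; have [v|nv] := pselect (vertices M (k, t + 1)); last first.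
    by have ht : ilo q <= t < ihi q nu by [lia]; have [] := vunit_up ab cd MM kab ht vt nv.
  have [/bdry //|hk] := boolP ((k == ilo p) || (k == ihi p mu)).
  have := TP _ v; rewrite /interior_index /= => /(_ ltac:(lia)) V.
  have [A [hA cA dA]] := valence4_direction (inord 0) V.
  case: hA cA dA => [[i [i' [j [-> _ _ _ _]]]]|hA] /=.
    by move=> _; case: ifP => _ /ind; case.
  have [i [j [j' [e jj _ _ _]]]] := hA; rewrite e in hA *.
  move=> [/= ek hj]; rewrite -{}ek in hA; case: eqP => [ej _|_ /ind []//].
  by apply: edge_unit hA; lia.
have down t : ilo q < t -> t < ihi q nu -> vunit M k t -> vunit M k (t - 1).
  move=> t1 t2 vt; have [v|nv] := pselect (vertices M (k, t)); last first.
    by have ht : ilo q <= t < ihi q nu by [lia]; have [] := vunit_down ab cd MM kab ht vt nv.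
  have [/bdry //|hk] := boolP ((k == ilo p) || (k == ihi p mu)).
  have := TP _ v; rewrite /interior_index /= => /(_ ltac:(lia)) V.
  have [A [hA cA dA]] := valence4_direction (inord 1) V.
  case: hA cA dA => [[i [i' [j [-> _ _ _ _]]]]|hA] /=.
    by move=> _; case: ifP => _ /ind; case.
  have [i [j [j' [e jj _ _ _]]]] := hA; rewrite e in hA *.
  move=> [/= ek hj]; rewrite -{}ek in hA; case: eqP => [_ /ind []//|nej _].
  by apply: edge_unit hA; case: hj; lia.
move=> hy hy' vy.
have [n] := ubnP `|y - y'|%N; elim: n y hy vy => // n IH y hy vy hn.
have [h|h|<- //] := ltgtP y y'.
  by apply: (IH (y + 1)); [lia|apply: up => //; lia|lia].
by apply: (IH (y - 1)); [lia|apply: down => //; lia|lia].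
Qed.

(** A line that is present at one height is present at all heights, so that the
    second side of the anchor does not matter. *)
Lemma tensor_Is A B : tensor_product (R := R) p q mu nu M ->
  side_range (ilo q) (ihi q nu) A.2 -> side_range (ilo q) (ihi q nu) B.2 ->
  Is (R := R) M A = Is (R := R) M B.
Proof.
move=> TP.
suff H : forall A B, side_range (ilo q) (ihi q nu) A.2 -> side_range (ilo q) (ihi q nu) B.2 ->
    Is (R := R) M A `<=` Is (R := R) M B by move=> rA rB; apply/seteqP; split; exact: H.
move=> {A B} A B rA rB k /(Is_vline p2 q2 mu0 nu0 FM _ rA)[hk vA].
apply/(Is_vline p2 q2 mu0 nu0 FM _ rB); split=> //.
have cd := ilo_lt_ihi q2 nu0.
have [y hy vy] : exists2 y, ilo q <= y < ihi q nu & vunit M k y.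
  case: A.2 rA vA => [j|j j'] /= hr.
    by move=> [[h v]|[h v]]; [exists j|exists (j - 1)] => //; lia.
  by case: hr => r1 r2 r3 h; exists j; [lia|apply: h; lia].
have all t : ilo q <= t < ihi q nu -> vunit M k t by move=> ht; exact: tensor_vunit TP hk hy ht vy.
case: B.2 rB => [j|j j'] /= hr.
  have [jd|dj] := ltP j (ihi q nu); [left|right]; split; try lia; apply: all; lia.
by case: hr => r1 r2 r3 t ht; apply: all; lia.
Qed.

End Tensor.

(** * Univariate splines on local index vectors *)

Section UnivariateLink.
Context {R : realType}.

Lemma gb_spline_spl (p : nat) (s s' : nat -> R) (u v F G : nat -> R -> R) :
  (1 < p)%N -> (forall k, (k <= p)%N -> s' k = s k) ->
  (forall k, (k < p)%N -> s k < s k.+1 -> forall x, s k <= x <= s k.+1 ->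
     gbU p s' u v k x / gbU p s' u v k (s k) = falling (s k) (s k.+1) (F k) (G k) x /\
     gbV p s' u v k x / gbV p s' u v k (s k.+1) = rising (s k) (s k.+1) (F k) (G k) x) ->
  gb_spline p s' u v = spl s F G (p - 2) 0.
Proof.
move=> p2 hs hUV; rewrite /gb_spline.
suff H m i : (i + m.+2 <= p)%N -> gbN p s' u v m i = spl s F G m i.
  by apply: H; rewrite add0n; lia.
elim: m i => [|m IH] i hi; apply/funext => x /=.
  rewrite addn2 in hi; rewrite !hs //; try lia.
  rewrite /hat; case: ifPn => [/andP[x1 x2]|_].
    by rewrite (hUV i _ (le_lt_trans x1 x2) x _).2 //; [lia|rewrite x1 ltW].
  case: ifPn => [/andP[x1 x2]|//].
  by rewrite (hUV i.+1 _ (le_lt_trans x1 x2) x _).1 //; rewrite x1 ltW.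
have e1 : gbN p s' u v m i = spl s F G m i by apply: IH; lia.
have e2 : gbN p s' u v m i.+1 = spl s F G m i.+1 by apply: IH; lia.
rewrite /next_level -e1 -e2 !hs //; lia.
Qed.

Lemma falling_orient (a b a' b' : R) f g x : det f g a' b' != 0 ->
  falling a b (orient a' b' f g) g x = falling a b f g x.
Proof. by move=> h; rewrite /falling !det_orient -mulf_div divff ?mul1r // sgr_eq0. Qed.

Lemma rising_orient (a b a' b' : R) f g x : det f g a' b' != 0 ->
  rising a b (orient a' b' f g) g x = rising a b f g x.
Proof. by move=> h; rewrite /rising !det_orient -mulf_div divff ?mul1r // sgr_eq0. Qed.

Section Fixed.
Variables (p mu : nat) (ss : int -> R).
Hypotheses (p2 : (1 < p)%N) (mu0 : (0 < mu)%N) (hss : knot_vector p mu ss).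

Definition last_index : nat := (mu + (p./2).*2).-1.
Local Notation L := last_index.

(** The knots counted from 0, the last one being repeated. *)
Definition knot (k : nat) : R := ss (ilo p + (minn k L)%:Z).

Lemma last_indexE : ilo p + L%:Z = ihi p mu.
Proof. by rewrite /ilo /ihi /last_index; lia. Qed.

Lemma spline_countE : (L.+1 - p)%N = spline_count p mu.
Proof. by rewrite /last_index /spline_count -{2}(odd_double_half p); lia. Qed.

Lemma knotE k : (k <= L)%N -> knot k = ss (ilo p + k%:Z).
Proof. by move=> kL; rewrite /knot (minn_idPl kL). Qed.

Lemma knot_mono k : knot k <= knot k.+1.
Proof.
have e := last_indexE.
by case: hss => h _; apply: h; rewrite -?e; lia.
Qed.

Lemma knot_mult j : (j + p <= L)%N -> knot j < knot (j + p).
Proof.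
move=> jL; have mono := knots_mono knot_mono.
rewrite lt_neqAle mono ?leq_addr // andbT; apply/negP => /eqP e.
have [_ h] := hss; have := h (knot j); apply/negP.
pose f (t : nat) : int := ilo p + (j + t)%N%:Z.
have sub : f @` `I_p.+1 `<=` [set i | ilo p <= i <= ihi p mu /\ ss i = knot j].
  move=> _ [t /= tp <-]; split; first by rewrite -last_indexE /f; lia.
  rewrite /f -knotE; last by lia.
  by apply/eqP; rewrite eq_le {1}e !mono ?leq_addr //; lia.
apply/negP => hc; have := card_le_trans (subset_card_le sub) hc.
have fi : {in `I_p.+1 &, injective f} by move=> x y _ _; rewrite /f; lia.
rewrite (card_le_eql (inj_card_eq fi)) card_le_II; lia.
Qed.

Definition shift_indices (l : seq int) : seq nat := [seq `|k - ilo p|%N | k <- l].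

Definition full_list (j : nat) : seq int := [seq ilo p + t%:Z | t <- iota j p.+1].

Lemma nth_full_list j t : (t <= p)%N -> nth 0 (full_list j) t = ilo p + (j + t)%N%:Z.
Proof. by move=> tp; rewrite (nth_map 0%N) ?size_iota // nth_iota. Qed.

Lemma nth_shift l t : (t < size l)%N -> (forall k, k \in l -> ilo p <= k) ->
  nth 0 l t = ilo p + (nth 0%N (shift_indices l) t)%:Z.
Proof.
move=> tl h; rewrite /shift_indices (nth_map 0) //.
by move: (h _ (mem_nth 0 tl)); move: (nth 0 l t) => z; lia.
Qed.

Section Local.
Variable I : set int.
Hypothesis I_bounds : forall k, I k -> ilo p <= k <= ihi p mu.
Hypothesis I_frame : forall k, frame_index p mu k -> I k.

Lemma local_shift (a : side) : side_ok p mu I a ->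
  let l := local_index p I a in
  [/\ index_list L p (shift_indices l),
      forall t, (t <= p)%N -> nth 0 l t = ilo p + (nth 0%N (shift_indices l) t)%:Z &
      forall t, (t < p)%N -> consecutive I (nth 0 l t) (nth 0 l t.+1)].
Proof.
move=> ha l; have [sl hI hc _] := local_index_spec p2 mu0 I_frame ha.
rewrite -/l in sl hI hc.
have bl k : k \in l -> ilo p <= k <= ihi p mu.
  by move=> kl; apply: I_bounds; rewrite -(nth_index 0 kl); apply: hI; rewrite -sl index_mem.
have nE t : (t <= p)%N -> nth 0 l t = ilo p + (nth 0%N (shift_indices l) t)%:Z.
  by move=> tp; apply: nth_shift; rewrite ?sl // => k /bl /andP[].
split=> //; split.
- by rewrite size_map.
- apply/(sortedP 0%N) => t; rewrite size_map sl ltnS => tp.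
  by have [_ _ + _] := hc t tp; rewrite !nE ?(ltnW tp) //; lia.
- apply/allP => _ /mapP[k /bl hk ->]; move: hk; rewrite -last_indexE; lia.
Qed.

Definition leading_index (a : side) : nat :=
  leading L knot (shift_indices (local_index p I a)).

Lemma chain_mem (l : seq int) k m : (forall t, (t < m)%N -> consecutive I (nth 0 l t) (nth 0 l t.+1)) ->
  I k -> nth 0 l 0 <= k <= nth 0 l m -> exists2 t, (t <= m)%N & k = nth 0 l t.
Proof.
elim: m => [|m IH] hc Ik hk; first by exists 0%N => //; lia.
have [h|h] := leP k (nth 0 l m).
  have [||t tm e] := IH _ Ik; try lia; first by move=> t tm; apply: hc; exact: leqW.
  by exists t => //; exact: leqW.
have [ke|ne] := eqVneq k (nth 0 l m.+1); first by exists m.+1.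
by have [_ _ _ no] := hc m (ltnSn m); case: (no k) => //; lia.
Qed.

(** The first index of the list moves to the right with the side, and the old
    first index is counted by the leading index of the new list only. All other
    indices counted for the old list are also counted for the new one. *)
Lemma leading_lt (a a' : side) : side_ok p mu I a -> side_ok p mu I a' ->
  nth 0 (local_index p I a) p./2 < nth 0 (local_index p I a') p./2 ->
  (leading_index a < leading_index a')%N.
Proof.
move=> ha ha'; have [w nE hc] := local_shift ha; have [w' nE' hc'] := local_shift ha'.
rewrite /leading_index; move: w nE hc w' nE' hc'.
set l := local_index p I a; set l' := local_index p I a'.
set n := shift_indices l; set n' := shift_indices l'.
move=> w nE hc w' nE' hc' hlt.
have h0 : nth 0 l 0 < nth 0 l' 0.
  have : (p./2 <= p)%N by lia.
  elim: p./2 hlt => // t IH hlt tp; apply: IH; last exact: ltnW.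
  have [_ I1 lt1 _] := hc t tp; have [_ _ _ no] := hc' t tp.
  by rewrite ltNge; apply/negP => h; case: (no (nth 0 l t.+1)) => //; lia.
have h0n : (nth 0%N n 0 < nth 0%N n' 0)%N by move: h0; rewrite nE // nE' //; lia.
have mono := knots_mono knot_mono.
have ml := index_list_mult knot_mono knot_mult p2 w.
have [sn _ aln] := w; have [sn' _ _] := w'.
have n0L : (nth 0%N n 0 < L.+1)%N by rewrite ltnS; apply: (allP aln); rewrite mem_nth // sn.
have n0n' : nth 0%N n 0 \notin n'.
  by apply/negP => /(index_list_bounds p2 w'); lia.
apply: proper_card; apply/properP; split; last first.
  exists (Ordinal n0L); rewrite !inE /= ?n0n' ?mono ?(ltnW h0n) //.
  by rewrite mem_nth ?sn.
apply/fintype.subsetP => k; rewrite !inE => /andP[kn ks]; apply/andP; split; last first.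
  by apply: le_trans ks (mono _ _ (ltnW h0n)).
apply/negP => kn'; have hb := index_list_bounds p2 w' kn'.
have [t tp et] : exists2 t, (t <= p)%N & nat_of_ord k = nth 0%N n' t.
  by exists (index (nat_of_ord k) n'); rewrite ?nth_index // -ltnS -sn' index_mem.
have Ik : I (ilo p + (nat_of_ord k)%:Z).
  rewrite et -nE' //.
  have [t0|t0] := ltnP t p; first by have [] := hc' t t0.
  have -> : t = p.-1.+1 by lia.
  by have [] := hc' p.-1 ltac:(lia).
have [kp|pk] := leqP k (nth 0%N n p); last first.
  have := le_lt_trans ks ml; rewrite ltNge mono //; exact: ltnW.
have [|t' t'p e'] := chain_mem hc Ik; first by rewrite !nE // !lerD2l !lez_nat kp andbT; case/andP: hb => hb _; exact: leq_trans (ltnW h0n) hb.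
move: kn; rewrite nE // in e'; have -> : nat_of_ord k = nth 0%N n t' by lia.
by rewrite mem_nth // sn.
Qed.

(** The leading index determines the left end of the side, and the global index
    vector determines the side from its left end. *)
Lemma leading_index_inj (a a' : side) : side_ok p mu I a -> side_ok p mu I a' ->
  leading_index a = leading_index a' -> a = a'.
Proof.
move=> ha ha' e.
have [h|h|h] := ltgtP (nth 0 (local_index p I a) p./2) (nth 0 (local_index p I a') p./2).
- by have := leading_lt ha ha' h; rewrite e ltnn.
- by have := leading_lt ha' ha h; rewrite e ltnn.
have [_ _ hc e1] := local_index_spec p2 mu0 I_frame ha.
have [_ _ hc' e1'] := local_index_spec p2 mu0 I_frame ha'.
move: h hc hc' e1 e1'; set l := local_index p I a; set l' := local_index p I a'.
move=> h hc hc' -> ->; rewrite -h; case: (odd p) => //; congr Iv.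
have pp : (p./2 < p)%N by lia.
have [_ I1 lt1 no1] := hc _ pp; have [_ I2 lt2 no2] := hc' _ pp; rewrite -h in lt2 no2.
have [h1|h1|//] := ltgtP (nth 0 l p./2.+1) (nth 0 l' p./2.+1).
  by case: (no2 (nth 0 l p./2.+1)) => //; rewrite lt1.
by case: (no1 (nth 0 l' p./2.+1)) => //; rewrite lt2.
Qed.

Lemma gap_around (k : int) : ilo p <= k < ihi p mu ->
  exists ii : int * int, consecutive I ii.1 ii.2 /\ ii.1 <= k < ii.2.
Proof.
have Ia : I (ilo p) by apply: I_frame; rewrite /frame_index /ilo; lia.
have Ib : I (ihi p mu) by apply: I_frame; rewrite /frame_index /ihi; lia.
move: Ia Ib; move: (ilo p) (ihi p mu) => i x Ii Ix.
have [n] := ubnP `|x - i|%N; elim: n i x Ii Ix => // n IH i x Ii Ix hn hk.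
have [[y [yk Iy]]|h] := pselect (exists y, i < y < x /\ I y).
  have [yk'|ky] := leP y k; first by apply: (IH y x) => //; lia.
  by apply: (IH i y) => //; lia.
exists (i, x); split=> //=; split=> //=; first by lia.
by move=> y hy Iy; apply: h; exists y.
Qed.

Lemma gap_unique i i' j j' k : consecutive I i i' -> consecutive I j j' ->
  i <= k < i' -> j <= k < j' -> (i, i') = (j, j').
Proof.
move=> [Ii Ii' _ n1] [Ij Ij' _ n2] h1 h2.
have -> : i = j.
  have [h|h|//] := ltgtP i j; [case: (n1 j)|case: (n2 i)] => //; lia.
by congr pair; have [h|h|//] := ltgtP i' j'; [case: (n2 i')|case: (n1 j')] => //; lia.
Qed.

Variables (us vs : int -> R -> R).
Hypothesis compat : compatible p ss us vs I.

(** The gap of the global index vector that contains the [k]-th knot interval;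
    its pair of functions is used there. *)
Definition gap_of (k : nat) : int * int :=
  xget (0, 0) [set ii | consecutive I ii.1 ii.2 /\ ii.1 <= ilo p + k%:Z < ii.2].

Lemma gap_ofE i i' k : consecutive I i i' -> i <= ilo p + k%:Z < i' -> gap_of k = (i, i').
Proof.
move=> cc h; have : exists ii, [set ii | consecutive I ii.1 ii.2 /\ ii.1 <= ilo p + k%:Z < ii.2] ii.
  by exists (i, i').
move=> /(xgetPex (0, 0)) [c1 h1]; rewrite [gap_of k]surjective_pairing.
exact: gap_unique c1 cc h1 h.
Qed.

Definition gap_v (ii : int * int) : R -> R :=
  derivn_on `[ss ii.1, ss ii.2] (p - 2) (vs ii.1).
Definition gap_u (ii : int * int) : R -> R :=
  derivn_on `[ss ii.1, ss ii.2] (p - 2) (us ii.1).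
(** Together with [kernel_g], a positively oriented pair that spans the
    derivatives used on the [k]-th knot interval. *)
Definition kernel_f (k : nat) : R -> R :=
  orient (ss (gap_of k).1) (ss (gap_of k).2) (gap_u (gap_of k)) (gap_v (gap_of k)).
Definition kernel_g (k : nat) : R -> R := gap_v (gap_of k).

Lemma ss_mono i j : ilo p <= i -> i <= j -> j <= ihi p mu -> ss i <= ss j.
Proof. by case: hss => h _; exact: h. Qed.

Lemma compatible_gapP i i' (n n' : nat) : consecutive I i i' ->
  i = ilo p + n%:Z -> i' = ilo p + n'%:Z -> compatible_gap knot kernel_f kernel_g n n'.
Proof.
move=> cc e e'; have [Ii Ii' ii _] := cc.
have nL : (n <= L)%N by have := I_bounds Ii; rewrite -last_indexE; lia.
have n'L : (n' <= L)%N by have := I_bounds Ii'; rewrite -last_indexE; lia.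
have gE k : (n <= k < n')%N -> gap_of k = (i, i').
  by move=> hk; apply: gap_ofE => //; lia.
have gn : gap_of n = (i, i') by apply: gE; lia.
split=> [k hk|]; first by rewrite /kernel_f /kernel_g gE // gn.
rewrite !knotE // -e -e' => lt; rewrite /kernel_f /kernel_g gn /=.
have [h _] := compat cc; have [[cu _] [cv _] ch] := h lt.
exact: chebyshev2_pos (cu _ (leqnn _)) (cv _ (leqnn _)) ch.
Qed.

Lemma kernel_chain : chain knot kernel_f kernel_g.
Proof.
split; first exact: knot_mono.
move=> k; have [kL|Lk] := ltnP k L; last first.
  by rewrite /knot !(minn_idPr _) ?ltxx // ltnW.
have [|[i i'] [cc h]] := @gap_around (ilo p + k%:Z); first by rewrite -last_indexE; lia.
have [Ii Ii' ii _] := cc; rewrite /= in cc h Ii Ii' ii.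
have [bi _] := andP (I_bounds Ii); have [bi' _] := andP (I_bounds Ii').
have cg : compatible_gap knot kernel_f kernel_g `|i - ilo p|%N `|i' - ilo p|%N.
  by apply: (compatible_gapP cc); lia.
have mono := knots_mono knot_mono.
have [Fk Gk] := cg.1 k ltac:(lia).
move=> lt; rewrite Fk Gk; apply: chebyshev_posW (cg.2 _).
- by apply: mono; lia.
- by apply: mono; lia.
- by apply: lt_le_trans (mono _ _ _); [apply: le_lt_trans (mono _ _ _) lt|]; lia.
Qed.

Lemma gap_generators i i' (k k' : nat) x : consecutive I i i' ->
  i <= ilo p + k%:Z -> ilo p + k'%:Z <= i' -> (k < k')%N -> knot k < knot k' ->
  knot k <= x <= knot k' ->
  let UV := generators p (knot k) (knot k') (us (ilo p + k%:Z)) (vs (ilo p + k%:Z)) in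
  UV.1 x / UV.1 (knot k) = falling (knot k) (knot k') (kernel_f k) (kernel_g k) x /\
  UV.2 x / UV.2 (knot k') = rising (knot k) (knot k') (kernel_f k) (kernel_g k) x.
Proof.
move=> cc ik ki kk lt hx UV; have [Ii Ii' ii _] := cc.
have [bi bi1] := andP (I_bounds Ii); have [bi' bi'1] := andP (I_bounds Ii').
rewrite -last_indexE in bi1 bi'1.
have k'L : (k' <= L)%N by lia.
have kL : (k <= L)%N by lia.
have gk : gap_of k = (i, i') by apply: gap_ofE => //; lia.
have l1 : ss i <= knot k by rewrite knotE //; apply: ss_mono => //; rewrite -last_indexE; lia.
have l2 : knot k' <= ss i' by rewrite knotE //; apply: ss_mono => //; rewrite -?last_indexE; lia.
have lii : ss i < ss i' by apply: le_lt_trans l1 (lt_le_trans lt l2).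
have [h hext] := compat cc; have adm := h lii.
have ext y : ss i <= y <= ss i' -> us (ilo p + k%:Z) y = us i y /\ vs (ilo p + k%:Z) y = vs i y.
  by apply: hext; lia.
have := generators_normalized lt l1 l2 adm ext hx; rewrite -/UV /= => -[-> ->].
rewrite /kernel_f /kernel_g gk /= /gap_u /gap_v /=.
have nz : det (derivn_on `[ss i, ss i'] (p - 2) (us i)) (derivn_on `[ss i, ss i'] (p - 2) (vs i))
    (ss i) (ss i') != 0.
  case: adm => _ _ ch; apply: (chebyshev2_det ch); rewrite /= ?in_itv /= ?lexx ?(ltW lii) //.
  by rewrite lt_eqF.
by rewrite falling_orient ?rising_orient.
Qed.

Lemma gb_spline_list (l : seq int) (n : seq nat) : index_list L p n ->
  (forall t, (t <= p)%N -> nth 0 l t = ilo p + (nth 0%N n t)%:Z) ->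
  (forall t, (t < p)%N -> exists ii : int * int, [/\ consecutive I ii.1 ii.2,
     ii.1 <= nth 0 l t & nth 0 l t.+1 <= ii.2]) ->
  gb_spline p (restrict_to ss l) (restrict_to us l) (restrict_to vs l) =
  list_spline p knot kernel_f kernel_g n.
Proof.
move=> [sn lsn aln] nE hg.
have kn t : (t <= p)%N -> knot_index n t = nth 0%N n t by move=> tp; rewrite knot_index_nth // sn.
have nL t : (t <= p)%N -> (nth 0%N n t <= L)%N.
  by move=> tp; apply: (allP aln); rewrite mem_nth // sn.
have sE t : (t <= p)%N -> restrict_to ss l t = knot (nth 0%N n t).
  by move=> tp; rewrite /restrict_to nE // knotE // nL.
apply: gb_spline_spl => // [t tp|t tp lt x hx]; first by rewrite /= kn // sE.
rewrite /= !kn ?(ltnW tp) // in lt hx *.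
have [[i i'] [cc h1 h2]] := hg t tp; rewrite /= in cc h1 h2.
rewrite nE ?(ltnW tp) // in h1; rewrite nE // in h2.
have tt' : (nth 0%N n t < nth 0%N n t.+1)%N by apply: nth_ltn_sorted => //; rewrite sn ltnSn.
have := gap_generators cc h1 h2 tt' lt hx.
by rewrite /gbU /gbV !sE ?(ltnW tp) // /restrict_to nE ?(ltnW tp).
Qed.

End Local.

Lemma bspline_list (l : seq int) (n : seq nat) : index_list L p n ->
  (forall t, (t <= p)%N -> nth 0 l t = ilo p + (nth 0%N n t)%:Z) ->
  bspline (restrict_to ss l) (p - 1) 0 = list_bspline p knot n.
Proof.
move=> [sn lsn aln] nE; rewrite subn1; apply: bspline_reindex => t.
rewrite prednK ?(ltnW p2) // add0n => tp; rewrite /restrict_to nE // /= knot_index_nth ?sn //.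
by rewrite knotE //; apply: (allP aln); rewrite mem_nth // sn.
Qed.

Lemma index_list_full j : (j < spline_count p mu)%N -> index_list L p (iota j p.+1).
Proof.
rewrite -spline_countE => hj; split; rewrite ?size_iota ?iota_ltn_sorted //.
by apply/allP => k; rewrite mem_iota; lia.
Qed.

Lemma full_local_list I j : (forall k, I k <-> ilo p <= k <= ihi p mu) ->
  (j < spline_count p mu)%N -> local_index p I (full_side p j) = full_list j.
Proof.
move=> hI hj.
have hf k : frame_index p mu k -> I k by move=> /(frame_bounds mu0) h; apply/hI.
have [sl _ _ _] := local_index_spec p2 mu0 hf (full_side_ok hI hj).
apply: (@eq_from_nth _ 0); first by rewrite sl size_map size_iota.
by move=> t; rewrite sl => tp; rewrite (full_local_index hI) // nth_full_list.
Qed.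

End Fixed.
End UnivariateLink.

Section UnivariateExpansion.
Context {R : realType}.
Variables (p mu : nat) (ss : int -> R).
Hypotheses (p2 : (1 < p)%N) (mu0 : (0 < mu)%N) (hss : knot_vector p mu ss).
Local Notation L := (last_index p mu).
Local Notation s := (knot p mu ss).

Definition full_bspline (j : nat) : R -> R :=
  bspline (restrict_to ss (full_list p j)) (p - 1) 0.

Definition full_gb_spline (us vs : int -> R -> R) (j : nat) : R -> R :=
  gb_spline p (restrict_to ss (full_list p j)) (restrict_to us (full_list p j))
    (restrict_to vs (full_list p j)).

Lemma full_bsplineE j : (j < spline_count p mu)%N -> full_bspline j = bspline s p.-1 j.
Proof.
move=> hj; rewrite -list_bspline_iota //; apply: bspline_list => //.
  exact: index_list_full.
by move=> t tp; rewrite nth_full_list // nth_iota.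
Qed.

Lemma count_mult j : (j < spline_count p mu)%N -> s j < s (j + p)%N.
Proof. by rewrite -spline_countE // => hj; apply: knot_mult => //; lia. Qed.

Lemma full_bspline_free (c : nat -> R) :
  (forall x, \sum_(j < spline_count p mu) c j * full_bspline j x = 0) ->
  forall j, (j < spline_count p mu)%N -> c j = 0.
Proof.
move=> h; have sS := knot_mono p2 mu0 hss.
apply: (@dominated_free _ _ s (bspline s p.-1)).
- exact: bspline_ge0.
- move=> i j hi ij; apply: bspline_dominates => //.
  by rewrite prednK 1?ltnW // count_mult.
- by move=> x; rewrite -[RHS](h x); apply: eq_bigr => j _; rewrite full_bsplineE.
Qed.

Section Local.
Variable I : set int.
Hypothesis I_bounds : forall k, I k -> ilo p <= k <= ihi p mu.
Hypothesis I_frame : forall k, frame_index p mu k -> I k.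

Lemma full_gb_splineE us vs j : compatible p ss us vs I -> (j < spline_count p mu)%N ->
  full_gb_spline us vs j =
  spl s (kernel_f p ss I us vs) (kernel_g p ss I vs) (p - 2) j.
Proof.
move=> cc hj; rewrite -list_spline_iota //.
apply: (gb_spline_list p2 mu0 hss I_bounds cc).
- exact: index_list_full.
- by move=> t tp; rewrite nth_full_list // nth_iota.
- move=> t tp; rewrite !nth_full_list ?(ltnW tp) //.
  have [|ii [h1 h2]] := gap_around p2 mu0 I_frame (k := ilo p + (j + t)%N%:Z).
    rewrite -last_indexE //; move: hj; rewrite -spline_countE //; lia.
  by exists ii; split=> //; lia.
Qed.

(** Compatibility along any one global index vector provides a Chebyshev pair
    on every knot interval. *)
Lemma full_gb_spline_free us vs (c : nat -> R) : compatible p ss us vs I ->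
  (forall x, \sum_(j < spline_count p mu) c j * full_gb_spline us vs j x = 0) ->
  forall j, (j < spline_count p mu)%N -> c j = 0.
Proof.
move=> cc h; have C := kernel_chain p2 mu0 hss I_bounds I_frame cc.
have [_ N0 D] := spl_level (p - 2) C.
have pp : (p - 2).+2 = p by lia.
apply: (@dominated_free _ _ s (spl s (kernel_f p ss I us vs) (kernel_g p ss I vs) (p - 2))).
- exact: N0.
- by move=> i j hi ij; apply: D => //; rewrite pp count_mult.
- by move=> x; rewrite -[RHS](h x); apply: eq_bigr => j _; rewrite full_gb_splineE.
Qed.

(** The pattern [X] serves the polynomial spline and the generalized ones for
    all compatible functions. *)
Lemma univariate_expansion (a : side) : side_ok p mu I a ->
  exists X : pred nat,
  [/\ X (leading_index p mu ss I a),
      forall j, X j -> (leading_index p mu ss I a <= j < spline_count p mu)%N,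
      exists b : nat -> R, (forall j, (b j != 0) = X j) /\
        forall x, bspline (restrict_to ss (local_index p I a)) (p - 1) 0 x =
          \sum_(j < spline_count p mu) b j * full_bspline j x &
      forall us vs, compatible p ss us vs I ->
      exists b : nat -> R, (forall j, (b j != 0) = X j) /\
        forall x, gb_spline p (restrict_to ss (local_index p I a))
            (restrict_to us (local_index p I a)) (restrict_to vs (local_index p I a)) x =
          \sum_(j < spline_count p mu) b j * full_gb_spline us vs j x].
Proof.
move=> ha; have [w nE hc] := local_shift p2 mu0 I_bounds I_frame ha.
have sS := knot_mono p2 mu0 hss.
have [X [Xl Xge Xle Xexp]] := expansion_exists sS (knot_mult p2 mu0 hss) p2 w.
exists X; split=> //.
- move=> j Xj; rewrite /leading_index Xge //= -spline_countE //.
  by have := Xle j Xj; lia.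
- have [b [_ bX bE]] := Xexp _ _ (list_bspline_insertable sS (knot_mult p2 mu0 hss) p2) Logic.I.
  exists b; split=> // x; rewrite (bspline_list ss p2 w nE) bE spline_countE //.
  apply: eq_bigr => j _; congr (_ * _).
  by rewrite (list_bspline_iota _ p2) full_bsplineE.
move=> us vs cc.
have cl : compatible_list s (kernel_f p ss I us vs) (kernel_g p ss I vs)
    (shift_indices p (local_index p I a)).
  have [sn _ _] := w; move=> t; rewrite sn ltnS => tp.
  by apply: (compatible_gapP p2 mu0 I_bounds cc (hc t tp)); rewrite -nE // ltnW.
have [b [_ bX bE]] := Xexp _ _ (list_spline_insertable sS (knot_mult p2 mu0 hss) p2
  (F := kernel_f p ss I us vs) (G := kernel_g p ss I vs)) cl.
exists b; split=> // x.
rewrite (gb_spline_list p2 mu0 hss I_bounds cc w nE); last first.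
  by move=> t tp; exists (nth 0 (local_index p I a) t, nth 0 (local_index p I a) t.+1); split=> //; exact: hc.
rewrite bE spline_countE //; apply: eq_bigr => j _; congr (_ * _).
by rewrite (list_spline_iota _ p2) full_gb_splineE.
Qed.

End Local.
End UnivariateExpansion.

(** * Bivariate splines *)

Section Bivariate.
Context {R : realType}.
Variables (n1 n2 : nat) (f g : nat -> R -> R).
Hypothesis f_free : forall c : nat -> R,
  (forall x, \sum_(j < n1) c j * f j x = 0) -> forall j, (j < n1)%N -> c j = 0.
Hypothesis g_free : forall c : nat -> R,
  (forall x, \sum_(j < n2) c j * g j x = 0) -> forall j, (j < n2)%N -> c j = 0.

Lemma product_free (c : 'I_n1 * 'I_n2 -> R) :
  (forall x y, \sum_(jk : 'I_n1 * 'I_n2) c jk * (f jk.1 x * g jk.2 y) = 0) ->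
  forall jk, c jk = 0.
Proof.
move=> h [j k].
pose c' (j k : nat) : R :=
  if insub j is Some j' then if insub k is Some k' then c (j', k') else 0 else 0.
have cE (j' : 'I_n1) (k' : 'I_n2) : c' j' k' = c (j', k') by rewrite /c' !valK.
rewrite -cE; apply: (g_free (c := c' j)) => // y.
apply: (f_free (c := fun j => \sum_(k < n2) c' j k * g k y)) => // x.
transitivity (\sum_(j : 'I_n1) \sum_(k : 'I_n2) c (j, k) * (f j x * g k y)); last first.
  by rewrite pair_bigA -[RHS](h x y); apply: eq_bigr => -[].
apply: eq_bigr => j' _; rewrite big_distrl; apply: eq_bigr => k' _ /=.
by rewrite cE -mulrA [g _ _ * _]mulrC.
Qed.

Variables (n' : nat) (h : 'I_n' -> 'I_n1 * 'I_n2).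
Hypothesis h_bij : bijective h.
Let G (j' : 'I_n') x y := f (h j').1 x * g (h j').2 y.

Lemma product_basis_free (c : 'I_n' -> R) :
  (forall x y, \sum_j' c j' * G j' x y = 0) -> forall j', c j' = 0.
Proof.
move=> hc j'; have [h' hK h'K] := h_bij.
rewrite -(hK j'); apply: (product_free (c := c \o h')) => x y.
rewrite -[RHS](hc x y) (reindex h) /=; last exact: onW_bij.
by apply: eq_bigr => i _; rewrite hK.
Qed.

Lemma product_coefficients (F1 F2 : R -> R) (a b : nat -> R) (c : 'I_n' -> R) :
  (forall x, F1 x = \sum_(j < n1) a j * f j x) ->
  (forall y, F2 y = \sum_(k < n2) b k * g k y) ->
  (forall x y, F1 x * F2 y = \sum_j' c j' * G j' x y) ->
  forall j', c j' = a (h j').1 * b (h j').2.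
Proof.
move=> hF1 hF2 hc j'; apply/eqP; rewrite -subr_eq0; apply/eqP.
apply: (product_basis_free (c := fun j' => c j' - a (h j').1 * b (h j').2)) => x y.
under eq_bigr do rewrite mulrBl.
rewrite sumrB -hc hF1 hF2 big_distrlr pair_bigA (reindex h) /=; last exact: onW_bij.
by apply/eqP; rewrite subr_eq0; apply/eqP/eq_bigr => i _; rewrite /G; ring.
Qed.

End Bivariate.

(** * Refinement matrices of a mesh *)

Lemma valence_transpose (R : realType) (M : set block) x y k :
  valence (R := R) M (y, x) k -> valence (R := R) (transpose_mesh M) (x, y) k.
Proof.
rewrite /valence => h; apply: card_eq_trans h.
set S := [set B | (hedges (R := R) M `|` vedges (R := R) M) B /\ corners B (y, x)].
have -> : [set B | (hedges (R := R) (transpose_mesh M) `|` vedges (R := R) (transpose_mesh M)) B /\ corners B (x, y)]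
    = transpose @` S.
  apply/seteqP; split=> [B|_ [B [hB [c1 c2]] <-]].
    rewrite -{1}[B]transposeK => -[hB [c1 c2]]; exists (transpose B); last exact: transposeK.
    split; last by split.
    by case: hB => /=; rewrite ?hedges_transpose ?vedges_transpose => hB; [right|left].
  split; last by split.
  by case: hB => /= hB; [right|left]; rewrite /= ?hedges_transpose ?vedges_transpose.
by apply: inj_card_eq => B B' _ _ e; rewrite -[B]transposeK e transposeK.
Qed.

Lemma tensor_product_transpose (R : realType) p q mu nu (M : set block) :
  tensor_product (R := R) p q mu nu M ->
  tensor_product (R := R) q p nu mu (transpose_mesh M).
Proof.
move=> TP [x y]; rewrite vertices_transpose => hv hi.
by apply: valence_transpose; apply: TP hv _; move: hi; rewrite /interior_index /= andbC.
Qed.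

Lemma combine_rows (R : realType) n n' (F : 'I_n -> R -> R -> R) (G : 'I_n' -> R -> R -> R)
    (C : 'M[R]_(n, n')) (c : 'I_n -> R) x y : refinement_matrix F G C ->
  \sum_j (\sum_i c i * C i j) * G j x y = \sum_i c i * F i x y.
Proof.
move=> hC; under [RHS]eq_bigr => i _ do rewrite hC big_distrr.
rewrite exchange_big; apply: eq_bigr => j _; rewrite big_distrl.
by apply: eq_bigr => i _; rewrite /= mulrA.
Qed.

Lemma anchor_data (R : realType) p q mu nu (M : set block) A :
  (1 < p)%N -> (1 < q)%N -> (0 < mu)%N -> (0 < nu)%N -> framed (R := R) p q mu nu M ->
  anchors (R := R) p q mu nu M A ->
  [/\ side_ok p mu (Is (R := R) M A) A.1,
      forall k, Is (R := R) M A k -> ilo p <= k <= ihi p mu &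
      forall k, frame_index p mu k -> Is (R := R) M A k].
Proof.
move=> hp hq hmu hnu FM hA; have hr := anchor_range hp hq hmu hnu FM hA; split.
- exact: (anchor_side hp hq hmu hnu FM).
- by move=> k; exact: (Is_bounds hp hq hmu hnu FM hr).
- by move=> k; exact: (Is_frame hp hq hmu hnu FM hr).
Qed.

Section Assembly.
Context {R : realType}.
Variables (p q mu nu : nat) (ss tt : int -> R) (us vs ut vt : int -> R -> R) (M : set block).
Hypotheses (hp : (1 < p)%N) (hq : (1 < q)%N) (hmu : (0 < mu)%N) (hnu : (0 < nu)%N).
Hypotheses (hss : knot_vector p mu ss) (htt : knot_vector q nu tt).
Hypothesis FM : framed (R := R) p q mu nu M.
Hypothesis hcomp : compatible_functions p q mu nu ss us vs tt ut vt M.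

Local Notation n1 := (spline_count p mu).
Local Notation n2 := (spline_count q nu).

Let MT := transpose_mesh M.

Lemma anchor_It A : It (R := R) M A = Is (R := R) MT (transpose A).
Proof. exact: It_transpose. Qed.

Lemma full_anchor_enumeration n' (A' : 'I_n' -> block) :
  enumerates A' (anchors (R := R) p q mu nu (full_grid p q mu nu)) ->
  exists2 h : 'I_n' -> 'I_n1 * 'I_n2, bijective h &
    forall j', A' j' = (full_side p (h j').1, full_side q (h j').2).
Proof.
move=> [A'inj A'range].
have /choice[h hE] : forall j', exists jk : 'I_n1 * 'I_n2,
    A' j' = (full_side p jk.1, full_side q jk.2).
  move=> j'; have : anchors (R := R) p q mu nu (full_grid p q mu nu) (A' j').
    by rewrite -A'range; exists j'.
  by move=> /(full_anchor_sides hp hq hmu hnu)[j [k [hj hk ->]]]; exists (Ordinal hj, Ordinal hk).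
have side_inj r j j' : full_side r j = full_side r j' -> j = j'.
  by rewrite /full_side; case: (odd r) => -[]; lia.
have /choice[h' h'E] : forall jk : 'I_n1 * 'I_n2, exists j',
    A' j' = (full_side p jk.1, full_side q jk.2).
  move=> [j k]; have := full_side_anchor (R := R) hp hq hmu hnu (ltn_ord j) (ltn_ord k).
  by rewrite -A'range => -[j' _ e]; exists j'.
exists h => //; exists h'.
  by move=> j'; apply: A'inj; rewrite h'E -hE.
move=> [j k]; have := h'E (j, k); rewrite hE; case: (h _) => j2 k2 /= [e1 e2].
by congr pair; apply/val_inj; [exact: side_inj e1|exact: side_inj e2].
Qed.

Lemma full_local_s (jk : 'I_n1 * 'I_n2) :
  local_s (R := R) p (full_grid p q mu nu) (full_side p jk.1, full_side q jk.2) = full_list p jk.1.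
Proof.
have an := full_side_anchor (R := R) hp hq hmu hnu (ltn_ord jk.1) (ltn_ord jk.2).
have F := full_grid_framed (R := R) hp hq hmu hnu.
rewrite /local_s (full_local_list (mu := mu)) // => k.
exact: full_grid_Is hp hq hmu hnu (anchor_range hp hq hmu hnu F an).
Qed.

Lemma full_local_t (jk : 'I_n1 * 'I_n2) :
  local_t (R := R) q (full_grid p q mu nu) (full_side p jk.1, full_side q jk.2) = full_list q jk.2.
Proof.
have an := full_side_anchor (R := R) hq hp hnu hmu (ltn_ord jk.2) (ltn_ord jk.1).
have F := full_grid_framed (R := R) hq hp hnu hmu.
rewrite /local_t It_transpose transpose_full_grid (full_local_list (mu := nu)) // => k.
exact: full_grid_Is hq hp hnu hmu (anchor_range hq hp hnu hmu F an).
Qed.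

Definition lead_s (B : block) : nat := leading_index p mu ss (Is (R := R) M B) B.1.
Definition lead_t (B : block) : nat := leading_index q nu tt (It (R := R) M B) B.2.

Lemma anchor_data_t B : anchors (R := R) p q mu nu M B ->
  [/\ side_ok q nu (It (R := R) M B) B.2,
      forall k, It (R := R) M B k -> ilo q <= k <= ihi q nu &
      forall k, frame_index q nu k -> It (R := R) M B k].
Proof.
move=> hB; rewrite anchor_It.
exact: (anchor_data hq hp hnu hmu (framed_transpose FM) (anchors_transpose hB)).
Qed.

Section Refine.
Variables (n' : nat) (A' : 'I_n' -> block) (h : 'I_n' -> 'I_n1 * 'I_n2).
Hypothesis h_bij : bijective h.
Hypothesis A'E : forall j', A' j' = (full_side p (h j').1, full_side q (h j').2).

Lemma full_gt_spline j' x y :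
  gt_spline p q ss us vs tt ut vt (full_grid p q mu nu) (A' j') x y =
  full_gb_spline p ss us vs (h j').1 x * full_gb_spline q tt ut vt (h j').2 y.
Proof. by rewrite /gt_spline A'E full_local_s full_local_t. Qed.

Lemma full_t_spline j' x y :
  t_spline p q ss tt (full_grid p q mu nu) (A' j') x y =
  full_bspline p ss (h j').1 x * full_bspline q tt (h j').2 y.
Proof. by rewrite /t_spline A'E full_local_s full_local_t. Qed.

Lemma full_t_spline_free (c : 'I_n' -> R) :
  (forall x y, \sum_j' c j' * t_spline p q ss tt (full_grid p q mu nu) (A' j') x y = 0) ->
  forall j', c j' = 0.
Proof.
move=> hc; apply: (product_basis_free (full_bspline_free hp hmu hss) (full_bspline_free hq hnu htt) h_bij).
by move=> x y; rewrite -[RHS](hc x y); apply: eq_bigr => j' _; rewrite full_t_spline.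
Qed.

Section OneAnchor.
Variable B : block.
Hypothesis hB : anchors (R := R) p q mu nu M B.

Lemma full_gt_spline_free (c : 'I_n' -> R) :
  (forall x y, \sum_j' c j' *
     gt_spline p q ss us vs tt ut vt (full_grid p q mu nu) (A' j') x y = 0) ->
  forall j', c j' = 0.
Proof.
have [_ b1 f1] := anchor_data hp hq hmu hnu FM hB; have [_ b2 f2] := anchor_data_t hB.
have [c1 c2] := hcomp hB.
move=> hc; apply: (product_basis_free
  (fun c => @full_gb_spline_free _ _ _ _ hp hmu hss _ b1 f1 _ _ c c1)
  (fun c => @full_gb_spline_free _ _ _ _ hq hnu htt _ b2 f2 _ _ c c2) h_bij).
by move=> x y; rewrite -[RHS](hc x y); apply: eq_bigr => j' _; rewrite full_gt_spline.
Qed.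

(** The rows of both refinement matrices have the product of the two univariate
    patterns as their pattern, since the splines on the full grid are free and
    coefficients are unique. *)
Lemma anchor_expansion : exists X Y : pred nat,
  [/\ X (lead_s B) /\ Y (lead_t B),
      forall j, X j -> (lead_s B <= j < n1)%N,
      forall k, Y k -> (lead_t B <= k < n2)%N,
      forall c : 'I_n' -> R,
        (forall x y, gt_spline p q ss us vs tt ut vt M B x y = \sum_j' c j' *
           gt_spline p q ss us vs tt ut vt (full_grid p q mu nu) (A' j') x y) ->
        forall j', (c j' != 0) = X (h j').1 && Y (h j').2 &
      forall c : 'I_n' -> R,
        (forall x y, t_spline p q ss tt M B x y = \sum_j' c j' *
           t_spline p q ss tt (full_grid p q mu nu) (A' j') x y) ->
        forall j', (c j' != 0) = X (h j').1 && Y (h j').2].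
Proof.
have [k1 b1 f1] := anchor_data hp hq hmu hnu FM hB; have [k2 b2 f2] := anchor_data_t hB.
have [c1 c2] := hcomp hB.
have [X [Xl Xb [b [bX bE]] E1]] := univariate_expansion hp hmu hss b1 f1 k1.
have [Y [Yl Yb [b' [bY b'E]] E2]] := univariate_expansion hq hnu htt b2 f2 k2.
have [g [gX gE]] := E1 _ _ c1; have [g' [gY g'E]] := E2 _ _ c2.
exists X, Y; split=> // c hc j'.
  rewrite (product_coefficients
    (fun c => @full_gb_spline_free _ _ _ _ hp hmu hss _ b1 f1 _ _ c c1)
    (fun c => @full_gb_spline_free _ _ _ _ hq hnu htt _ b2 f2 _ _ c c2) h_bij gE g'E (c := c)).
    by rewrite mulf_eq0 negb_or gX gY.
  by move=> x y; rewrite [LHS](hc x y); apply: eq_bigr => k _; rewrite full_gt_spline.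
rewrite (product_coefficients (full_bspline_free hp hmu hss) (full_bspline_free hq hnu htt)
  h_bij bE b'E (c := c)).
  by rewrite mulf_eq0 negb_or bX bY.
by move=> x y; rewrite [LHS](hc x y); apply: eq_bigr => k _; rewrite full_t_spline.
Qed.

End OneAnchor.

(** By the equality of all global index vectors, in both directions, the sides
    of the two anchors are compared along the same index vectors. *)
Lemma lead_inj B B' : tensor_product (R := R) p q mu nu M ->
  anchors (R := R) p q mu nu M B -> anchors (R := R) p q mu nu M B' ->
  lead_s B = lead_s B' -> lead_t B = lead_t B' -> B = B'.
Proof.
move=> TP hB hB'.
have rB := anchor_range hp hq hmu hnu FM hB; have rB' := anchor_range hp hq hmu hnu FM hB'.
have FT := framed_transpose FM.
have rTB := anchor_range hq hp hnu hmu FT (anchors_transpose hB).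
have rTB' := anchor_range hq hp hnu hmu FT (anchors_transpose hB').
have eI := tensor_Is hp hq hmu hnu FM TP rB rB'.
have eJ := tensor_Is hq hp hnu hmu FT (tensor_product_transpose TP) rTB rTB'.
rewrite -!anchor_It in eJ.
have [k1 b1 f1] := anchor_data hp hq hmu hnu FM hB; have [k2 b2 f2] := anchor_data_t hB.
have [k1' _ _] := anchor_data hp hq hmu hnu FM hB'; have [k2' _ _] := anchor_data_t hB'.
rewrite -eI in k1'; rewrite -eJ in k2'; rewrite /lead_s /lead_t -eI -eJ => e1 e2.
rewrite [B]surjective_pairing [B']surjective_pairing.
rewrite (leading_index_inj hp hmu hss b1 f1 k1 k1' e1).
by rewrite (leading_index_inj hq hnu htt b2 f2 k2 k2' e2).
Qed.

Variables (n : nat) (A : 'I_n -> block).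
Hypothesis hA : enumerates A (anchors (R := R) p q mu nu M).
Variables (C D : 'M[R]_(n, n')).
Hypothesis hC : refinement_matrix
  (fun i => gt_spline p q ss us vs tt ut vt M (A i))
  (fun j => gt_spline p q ss us vs tt ut vt (full_grid p q mu nu) (A' j)) C.
Hypothesis hD : refinement_matrix
  (fun i => t_spline p q ss tt M (A i))
  (fun j => t_spline p q ss tt (full_grid p q mu nu) (A' j)) D.

Lemma enumerated i : anchors (R := R) p q mu nu M (A i).
Proof. by case: hA => _ <-; exists i. Qed.

Lemma same_pattern : VMCR C <-> VMCR D.
Proof.
apply: VMCR_pattern => i j'.
have [X [Y [_ _ _ hX hY]]] := anchor_expansion (enumerated i).
by rewrite (hX (C i)) ?(hY (D i)).
Qed.

Lemma gt_free : VMCR C -> lin_indep (fun i => gt_spline p q ss us vs tt ut vt M (A i)).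
Proof.
move=> vC c hc i; apply: (VMCR_rows_free vC).
apply: (full_gt_spline_free (enumerated i)) => x y.
by rewrite -[RHS](hc x y) (combine_rows c x y hC).
Qed.

Lemma t_free : VMCR D -> lin_indep (fun i => t_spline p q ss tt M (A i)).
Proof.
move=> vD c hc i; apply: (VMCR_rows_free vD).
apply: full_t_spline_free => x y.
by rewrite -[RHS](hc x y) (combine_rows c x y hD).
Qed.

(** In a set of anchors choose one with the least sum of leading indices. An
    anchor with a nonzero entry at its leading pair has leading indices that
    are not larger, hence equal. *)
Lemma tensor_VMCR : tensor_product (R := R) p q mu nu M -> VMCR C.
Proof.
move=> TP; apply: VMCR_echelon => J /finset.set0Pn[i1 Ji1].
pose m i := (lead_s (A i) + lead_t (A i))%N.
have [i0 Ji0 hmin] := arg_minnP m Ji1; rewrite -/(i0 \in J) in Ji0.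
have [h' _ h'K] := h_bij.
have [X [Y [[Xl Yl] Xb Yb hX _]]] := anchor_expansion (enumerated i0).
have [/andP[_ l1] /andP[_ l2]] := (Xb _ Xl, Yb _ Yl).
pose j' := h' (Ordinal l1, Ordinal l2).
have hj : h j' = (Ordinal l1, Ordinal l2) by rewrite h'K.
exists j', i0 => //; split.
  by rewrite (hX (C i0)) ?hj /= ?Xl.
move=> i Ji ne; apply/eqP; apply: contraNT ne.
have [X' [Y' [_ Xb' Yb' hX' _]]] := anchor_expansion (enumerated i).
rewrite (hX' (C i)) // hj /= => /andP[/Xb'/andP[le1 _] /Yb'/andP[le2 _]].
have := hmin i Ji; rewrite /m => le.
case: hA => Ainj _; apply/eqP; apply: Ainj.
by apply: lead_inj => //; try exact: enumerated; lia.
Qed.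

End Refine.
End Assembly.

Theorem corollary4p8 (R : realType) (p q mu nu : nat)
  (hp : (2 <= p)%N) (hq : (2 <= q)%N) (hmu : (0 < mu)%N) (hnu : (0 < nu)%N)
  (ss tt : int -> R) (us vs ut vt : int -> R -> R)
  (hss : knot_vector p mu ss) (htt : knot_vector q nu tt)
  (M : set block) (hM : admissible (R := R) p q mu nu M)
  (hcomp : compatible_functions p q mu nu ss us vs tt ut vt M)
  (n n' : nat) (A : 'I_n -> block) (A' : 'I_n' -> block)
  (hA : enumerates A (anchors (R := R) p q mu nu M))
  (hA' : enumerates A' (anchors (R := R) p q mu nu (full_grid p q mu nu)))
  (C D : 'M[R]_(n, n'))
  (hC : refinement_matrix
          (fun i => gt_spline p q ss us vs tt ut vt M (A i))
          (fun j => gt_spline p q ss us vs tt ut vt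
                      (full_grid p q mu nu) (A' j)) C)
  (hD : refinement_matrix
          (fun i => t_spline p q ss tt M (A i))
          (fun j => t_spline p q ss tt (full_grid p q mu nu) (A' j)) D) :
  [/\ VMCR C <-> VMCR D,
      VMCR C ->
        lin_indep (fun i => gt_spline p q ss us vs tt ut vt M (A i)) /\
        lin_indep (fun i => t_spline p q ss tt M (A i))
    & tensor_product (R := R) p q mu nu M -> VMCR C].
Proof.
have FM := admissible_framed hp hq hmu hnu hM.
have [h hb A'E] := full_anchor_enumeration hp hq hmu hnu hA'.
have eCD : VMCR C <-> VMCR D.
  exact: (same_pattern hp hq hmu hnu hss htt FM hcomp hb A'E hA hC hD).
split=> // [vC|].
  split; last by apply: (t_free hp hq hmu hnu hss htt hb A'E hD); apply/eCD.
  exact: (gt_free hp hq hmu hnu hss htt FM hcomp hb A'E hA hC vC).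
exact: (tensor_VMCR hp hq hmu hnu hss htt FM hcomp hb A'E hA hC).
Qed.
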